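(* Let $H$ be a finitely generated subgroup of $PL_o(I)$ which has towers of arbitrarily large finite height. Then $H$ contains a subgroup isomorphic to $(\mathbf{Z}\wr)^{\infty}$ or a subgroup isomorphic to $(\wr\mathbf{Z})^{\infty}$.
   Context: $PL_o(I)$ is the group of orientation-preserving piecewise-linear homeomorphisms of $I=[0,1]$ with finitely many breaks in slope, acting on the right. An orbital of $g$ is a connected component of the set of points moved by $g$. A signed orbital of $H$ is a pair $(A,g)$, $g\in H$, $A$ an orbital of $g$. A tower of $H$ is a set of signed orbitals of $H$ with pairwise distinct orbitals which are pairwise comparable under inclusion; its height is its cardinality. Restricted wreath product: $A\wr\mathbf{Z}=(\bigoplus_{i\in\mathbf{Z}}A)\rtimes\mathbf{Z}$. Let $W_1=\mathbf{Z}$, $W_{k+1}=W_k\wr\mathbf{Z}$, with $W_k$ embedded in $W_{k+1}$ as the index-$0$ summand of the base group; $(\mathbf{Z}\wr)^{\infty}=\ldots(((\mathbf{Z}\wr\mathbf{Z})\wr\mathbf{Z})\wr\mathbf{Z})\ldots$ is the ascending union of the $W_k$. For permutation groups $(K,X)$, $(L,Y)$, the permutation wreath product $K\wr L$ is the subgroup of $\mathrm{Sym}(X\times Y)$ generated by the maps $(x,y)\mapsto(x\kappa,y)$, $(x,y')\mapsto(x,y')$ for $y'\neq y$ (for $\kappa\in K$, $y\in Y$) and $(x,y)\mapsto(x,y\lambda)$ (for $\lambda\in L$). Let $P_1=\mathbf{Z}$ acting on $X_1=\mathbf{Z}$ by translation, and $P_{k+1}=\mathbf{Z}\wr P_k$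 (permutation wreath product, $\mathbf{Z}$ acting on itself by translation) acting on $X_{k+1}=\mathbf{Z}\times X_k$, with $P_k$ embedded as the top group; $(\wr\mathbf{Z})^{\infty}=\ldots\wr(\mathbf{Z}\wr(\mathbf{Z}\wr(\mathbf{Z}\wr\mathbf{Z})))\ldots$ is the ascending union of the $P_k$. *)

(* Defs.v *)
From Stdlib Require Import Reals ZArith List Classical ClassicalDescription.
Open Scope R_scope.

(** * PL_o(I)
    Elements of PL_o(I) are represented as functions R -> R that are the
    identity outside I = [0,1] (so that Leibniz equality of functions is
    equality of homeomorphisms of I). On I the function is piecewise affine
    with finitely many pieces, each of positive slope, and fixes 0 and 1;
    hence it is an orientation-preserving PL homeomorphism of I. *)
Definition is_PLo (f : R -> R) : Prop :=
  (forall x, (x < 0 \/ 1 < x) -> f x = x) /\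
  f 0 = 0 /\ f 1 = 1 /\
  exists (n : nat) (b a c : nat -> R),
    b 0%nat = 0 /\ b n = 1 /\
    (forall i, (i < n)%nat -> b i < b (S i)) /\
    (forall i, (i < n)%nat -> 0 < a i) /\
    (forall i x, (i < n)%nat -> b i <= x <= b (S i) -> f x = a i * x + c i).

(** Right action: x (g h) = (x g) h, i.e. the product g h is  h o g. *)
Definition rmul (g h : R -> R) : R -> R := fun x => h (g x).

Inductive subgroup_gen (S : (R -> R) -> Prop) : (R -> R) -> Prop :=
| sg_gen g : S g -> subgroup_gen S g
| sg_id : subgroup_gen S (fun x => x)
| sg_mul g h : subgroup_gen S g -> subgroup_gen S h -> subgroup_gen S (rmul g h)
| sg_inv g g' : subgroup_gen S g ->
    (forall x, g (g' x) = x) -> (forall x, g' (g x) = x) -> subgroup_gen S g'.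

(** Orbitals. Connected subsets of R are exactly the order-convex ones. *)
Definition moved (g : R -> R) : R -> Prop := fun x => 0 <= x <= 1 /\ g x <> x.

Definition is_interval (C : R -> Prop) : Prop :=
  forall x y z, C x -> C z -> x <= y <= z -> C y.

Definition conn_component (S A : R -> Prop) : Prop :=
  exists x, S x /\
    forall y, A y <-> exists C, is_interval C /\ (forall z, C z -> S z) /\ C x /\ C y.

Definition orbital (g : R -> R) (A : R -> Prop) : Prop := conn_component (moved g) A.

Definition set_incl (A B : R -> Prop) : Prop := forall x, A x -> B x.
Definition set_eq (A B : R -> Prop) : Prop := forall x, A x <-> B x.

Definition has_tower (H : (R -> R) -> Prop) (n : nat) : Prop :=
  exists (A : nat -> R -> Prop) (g : nat -> R -> R),
    (forall i, (i < n)%nat -> H (g i) /\ orbital (g i) (A i)) /\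
    (forall i j, (i < n)%nat -> (j < n)%nat -> i <> j ->
       ~ set_eq (A i) (A j) /\ (set_incl (A i) (A j) \/ set_incl (A j) (A i))).

Definition arbitrarily_large_towers (H : (R -> R) -> Prop) : Prop :=
  forall n : nat, exists m : nat, (n <= m)%nat /\ has_tower H m.

(** * The groups (Z wr)^infty and (wr Z)^infty as permutation groups of
    Omega = nat -> Z (coordinate 0 is the coordinate of W_1 resp. P_1). *)
Definition Omega := nat -> Z.

Definition upd (c : Omega) (j : nat) (v : Z) : Omega :=
  fun i => if Nat.eqb i j then v else c i.

(** Subgroup of Sym(Omega) generated by S (S closed under inverses below),
    with the right-action product a b = b o a. *)
Inductive gen_by (S : (Omega -> Omega) -> Prop) : (Omega -> Omega) -> Prop :=
| gb_id : gen_by S (fun c => c)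
| gb_step f s : gen_by S f -> S s -> gen_by S (fun c => s (f c)).

(** (Z wr)^infty: W_{j+1} = W_j wr Z acts on coordinates 0..j; W_j sits in
    W_{j+1} as the index-0 summand, i.e. acts only where coordinate j is 0.
    The top generator of W_{j+1} translates coordinate j, acting only where
    all coordinates > j vanish. These generate the ascending union. *)
Definition zw_gen (j : nat) (e : Z) : Omega -> Omega :=
  fun c => if excluded_middle_informative (forall i, (j < i)%nat -> c i = 0%Z)
           then upd c j (c j + e)%Z else c.

Definition ZWr_infty : (Omega -> Omega) -> Prop :=
  gen_by (fun s => exists j e, s = zw_gen j e).

(** (wr Z)^infty: P_{j+1} = Z wr P_j acts on coordinates 0..j, P_j as the top
    group on coordinates 0..j-1; the base copy of Z at fibre y translates
    coordinate j at points whose coordinates 0..j-1 equal y. *)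
Definition wz_gen (j : nat) (y : Omega) (e : Z) : Omega -> Omega :=
  fun c => if excluded_middle_informative (forall i, (i < j)%nat -> c i = y i)
           then upd c j (c j + e)%Z else c.

Definition WrZ_infty : (Omega -> Omega) -> Prop :=
  gen_by (fun s => exists j y e, s = wz_gen j y e).

Definition embeds_in (G : (Omega -> Omega) -> Prop) (H : (R -> R) -> Prop) : Prop :=
  exists psi : (Omega -> Omega) -> (R -> R),
    (forall a, G a -> H (psi a)) /\
    (forall a b, G a -> G b -> psi (fun c => b (a c)) = rmul (psi a) (psi b)) /\
    (forall a b, G a -> G b -> psi a = psi b -> a = b).

(* Main.v *)
Require Import Defs.
From Stdlib Require Import Reals ZArith List Classical ClassicalDescription.
From Stdlib Require Import ClassicalEpsilon FunctionalExtensionality Lra Lia.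
Open Scope R_scope.

(* Let K be a finitely generated subgroup of H.  It has finitely many orbitals (components of the
   set of points moved by K), and since one-sided germs at a common fixed point are linear, the
   elements of the derived group K' have compact support in each of them.

   Suppose K' has a fixed point in an orbital (a, b).  Then K acts on the set Phi of these fixed
   points through an abelian group, every element of K with a fixed point in (a, b) fixes Phi, and
   a discreteness argument on the slopes at a shows that the quotient is generated by a single
   controller c.  If this happens in every orbital of every such K, then towers descend: the
   elements of K acting inside the gaps of Phi are, on a fundamental domain of c, those of a finitely
   generated subgroup of K' which again has arbitrarily tall towers and whose support is moved off
   itself by an element of K.  Iterating gives a descending chain of supports, hence (wr Z)^infty.

   Otherwise some K has an orbital on which K' has no fixed point.  Then neither has the group M of
   those elements of K' that are trivial on all orbitals of the first kind: such an orbital splits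
   into blocks moved by its controller, and if M had a fixed point, subgroups supported on distant
   blocks would commute on Fix M and produce a fixed point of K''.  As the elements of M have
   compact supports and M moves any compact set off itself, an ascending chain of supports exists,
   hence (Z wr)^infty. *)

(** The dichotomy has to range over all finitely generated subgroups: the descent replaces a group
    by new ones, whose orbitals may be of either kind. Finite generation must survive each step,
    because it gives the finite number of orbitals and, through the controller, bounds the supports
    to be moved. But a derived group need not be finitely generated. This is why the descent cuts
    out a fundamental domain of the controller and collects the finitely many commutators that
    matter there, instead of passing to K'. Towers are used only in the descending case; their
    height keeps the chain of groups from becoming trivial. In the ascending case the elements of M
    must be trivial on the orbitals of the first kind, because there K' fixes points and cannot move
    large compact sets off themselves. Both embeddings rest on one computation with addresses in
    nested sets. Two words involve finitely many levels only, and on finitely many levels reversing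
    the coordinates exchanges the ascending and the descending situation. *)

(** * Piecewise-linear homeomorphisms described by one-sided germs *)

(** Affine one-sided germs at every point replace a global subdivision: they pass to products and
    inverses without common refinements, and the later arguments only look at germs. Finiteness
    statements are recovered from compactness of the unit interval. *)
Record PL (f : R -> R) : Prop := {
  PL_incr : forall x y, x < y -> f x < f y;
  PL_surj : forall y, exists x, f x = y;
  PL_out : forall x, x <= 0 \/ 1 <= x -> f x = x;
  PL_right : forall w, exists e k, 0 < e /\ 0 < k /\
    forall x, w <= x <= w + e -> f x = f w + k * (x - w);
  PL_left : forall w, exists e k, 0 < e /\ 0 < k /\
    forall x, w - e <= x <= w -> f x = f w + k * (x - w) }.

(** Defined for every function, so that words with inverses can be written before their letters are
    known to be bijective. *)
Definition finv (f : R -> R) (y : R) : R := epsilon (inhabits 0) (fun x => f x = y).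

Lemma PL_le f x y : PL f -> x <= y -> f x <= f y.
Proof.
  intros Hf [H | ->]; [left; now apply (PL_incr f) | lra].
Qed.

Lemma PL_lt_rev f x y : PL f -> f x < f y -> x < y.
Proof.
  intros Hf H. destruct (Rlt_le_dec x y) as [|H']; trivial.
  apply (PL_le f) in H'; trivial; lra.
Qed.

Lemma PL_le_rev f x y : PL f -> f x <= f y -> x <= y.
Proof.
  intros Hf H. destruct (Rle_lt_dec x y) as [|H']; trivial.
  apply (PL_incr f) in H'; trivial; lra.
Qed.

Lemma PL_inj f x y : PL f -> f x = f y -> x = y.
Proof.
  intros Hf H. apply Rle_antisym; apply (PL_le_rev f); trivial; lra.
Qed.

Lemma finv_r f y : PL f -> f (finv f y) = y.
Proof.
  intros Hf. unfold finv. apply epsilon_spec. now apply PL_surj.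
Qed.

Lemma finv_l f x : PL f -> finv f (f x) = x.
Proof.
  intros Hf. apply (PL_inj f); trivial. now apply finv_r.
Qed.

Lemma PL_id : PL (fun x => x).
Proof.
  split; auto.
  - intros y; now exists y.
  - intros w. exists 1, 1. repeat split; try lra. intros; lra.
  - intros w. exists 1, 1. repeat split; try lra. intros; lra.
Qed.

Lemma PL_mul f g : PL f -> PL g -> PL (rmul f g).
Proof.
  intros Hf Hg. unfold rmul. split.
  - intros x y H. apply PL_incr, PL_incr; trivial.
  - intros y. destruct (PL_surj g Hg y) as [z <-].
    destruct (PL_surj f Hf z) as [x <-]. now exists x.
  - intros x H. rewrite (PL_out f Hf x H). now apply PL_out.
  - intros w. destruct (PL_right f Hf w) as (e1 & k1 & He1 & Hk1 & H1).
    destruct (PL_right g Hg (f w)) as (e2 & k2 & He2 & Hk2 & H2).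
    exists (Rmin e1 (e2 / k1)), (k2 * k1).
    assert (Hdiv : 0 < e2 / k1) by now apply Rdiv_lt_0_compat.
    repeat split; [now apply Rmin_pos | now apply Rmult_lt_0_compat |].
    intros x Hx.
    pose proof (Rmin_l e1 (e2 / k1)). pose proof (Rmin_r e1 (e2 / k1)).
    rewrite (H1 x) by lra. rewrite H2; [ring |].
    split; [enough (0 <= k1 * (x - w)) by lra; apply Rmult_le_pos; lra |].
    enough (k1 * (x - w) <= k1 * (e2 / k1)) as H3.
    { replace (k1 * (e2 / k1)) with e2 in H3 by (field; lra). lra. }
    apply Rmult_le_compat_l; lra.
  - intros w. destruct (PL_left f Hf w) as (e1 & k1 & He1 & Hk1 & H1).
    destruct (PL_left g Hg (f w)) as (e2 & k2 & He2 & Hk2 & H2).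
    exists (Rmin e1 (e2 / k1)), (k2 * k1).
    assert (Hdiv : 0 < e2 / k1) by now apply Rdiv_lt_0_compat.
    repeat split; [now apply Rmin_pos | now apply Rmult_lt_0_compat |].
    intros x Hx.
    pose proof (Rmin_l e1 (e2 / k1)). pose proof (Rmin_r e1 (e2 / k1)).
    rewrite (H1 x) by lra. rewrite H2; [ring |].
    split; [| enough (0 <= k1 * (w - x)) by lra; apply Rmult_le_pos; lra].
    enough (k1 * (w - x) <= k1 * (e2 / k1)) as H3.
    { replace (k1 * (e2 / k1)) with e2 in H3 by (field; lra). lra. }
    apply Rmult_le_compat_l; lra.
Qed.

Lemma PL_finv f : PL f -> PL (finv f).
Proof.
  intros Hf. split.
  - intros x y H. apply (PL_lt_rev f); trivial. now rewrite !finv_r.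
  - intros y. exists (f y). now apply finv_l.
  - intros x H. apply (PL_inj f); trivial. rewrite finv_r; trivial.
    symmetry. now apply PL_out.
  - intros w. destruct (PL_right f Hf (finv f w)) as (e & k & He & Hk & H).
    exists (k * e), (/ k).
    repeat split; [now apply Rmult_lt_0_compat | now apply Rinv_0_lt_compat |].
    intros x Hx. apply (PL_inj f); trivial. rewrite finv_r; trivial.
    rewrite H; rewrite ?finv_r; trivial; [field; lra |].
    enough (0 <= / k * (x - w) <= e) by lra. split.
    + apply Rmult_le_pos; [left; now apply Rinv_0_lt_compat | lra].
    + replace e with (/ k * (k * e)) by (field; lra).
      apply Rmult_le_compat_l; [left; now apply Rinv_0_lt_compat | lra].
  - intros w. destruct (PL_left f Hf (finv f w)) as (e & k & He & Hk & H).
    exists (k * e), (/ k).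
    repeat split; [now apply Rmult_lt_0_compat | now apply Rinv_0_lt_compat |].
    intros x Hx. apply (PL_inj f); trivial. rewrite finv_r; trivial.
    rewrite H; rewrite ?finv_r; trivial; [field; lra |].
    enough (0 <= / k * (w - x) <= e) by lra. split.
    + apply Rmult_le_pos; [left; now apply Rinv_0_lt_compat | lra].
    + replace e with (/ k * (k * e)) by (field; lra).
      apply Rmult_le_compat_l; [left; now apply Rinv_0_lt_compat | lra].
Qed.

Lemma PLo_PL f : is_PLo f -> PL f.
Proof.
  intros (Hout & H0 & H1 & n & b & a & c & Hb0 & Hbn & Hb & Ha & Hf).
  assert (Hle : forall i, (i <= n)%nat -> 0 <= b i).
  { induction i as [|i IH]; intros Hi; [lra |].
    specialize (IH ltac:(lia)). specialize (Hb i ltac:(lia)). lra. }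
  assert (Hpos : forall i x y, (i < n)%nat -> x < y -> a i * x < a i * y).
  { intros i x y Hi Hxy. apply Rmult_lt_compat_l; auto. }
  assert (Hincr : forall i, (i <= n)%nat -> forall x y, 0 <= x -> x < y -> y <= b i -> f x < f y).
  { induction i as [|i IH]; intros Hi x y Hx Hxy Hy; [lra |].
    assert (Hi' : (i < n)%nat) by lia.
    specialize (IH ltac:(lia)). specialize (Hb i Hi').
    destruct (Rle_lt_dec y (b i)) as [Hyb | Hyb]; [now apply IH |].
    assert (Hq : forall x y, b i <= x -> x < y -> y <= b (S i) -> f x < f y).
    { intros x' y' ? ? ?. rewrite (Hf i x'), (Hf i y') by (trivial; lra).
      specialize (Hpos i x' y' Hi' ltac:(lra)). lra. }
    destruct (Rle_lt_dec (b i) x) as [Hxb | Hxb]; [now apply Hq |].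
    apply Rlt_trans with (f (b i)); [apply IH; lra | apply Hq; lra]. }
  assert (Hsurj : forall i, (i <= n)%nat -> forall y, 0 <= y <= f (b i) ->
            exists x, 0 <= x <= b i /\ f x = y).
  { induction i as [|i IH]; intros Hi y Hy.
    { exists 0. rewrite Hb0 in *. split; lra. }
    assert (Hi' : (i < n)%nat) by lia.
    specialize (IH ltac:(lia)). specialize (Hb i Hi'). specialize (Hle i ltac:(lia)).
    specialize (Ha i Hi').
    destruct (Rle_lt_dec y (f (b i))) as [Hyb | Hyb].
    { destruct (IH y ltac:(lra)) as (x & Hx & Hxy). exists x. split; [lra | trivial]. }
    rewrite (Hf i (b i)) in Hyb by (trivial; lra).
    rewrite (Hf i (b (S i))) in Hy by (trivial; lra).
    assert (Hx : b i <= (y - c i) / a i <= b (S i)).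
    { split; apply Rmult_le_reg_l with (a i); trivial;
        replace (a i * ((y - c i) / a i)) with (y - c i) by (field; lra); lra. }
    exists ((y - c i) / a i). split; [lra |].
    rewrite (Hf i) by trivial. field; lra. }
  (* Pieces closed on the left give the right germ at their left end; [Hn'] is the mirror image for
     left germs. *)
  assert (Hn : forall x, 0 <= x < 1 -> exists i, (i < n)%nat /\ b i <= x < b (S i)).
  { intros x Hx. rewrite <- Hbn in Hx.
    assert (Hk : forall k, (k <= n)%nat -> x < b k -> exists i, (i < n)%nat /\ b i <= x < b (S i)).
    { induction k as [|k IH]; intros Hk Hxk; [lra |].
      destruct (Rlt_le_dec x (b k)); [apply IH; trivial; lia |].
      exists k. split; [lia | lra]. }
    apply (Hk n); lra || lia. }
  assert (Hn' : forall x, 0 < x <= 1 -> exists i, (i < n)%nat /\ b i < x <= b (S i)).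
  { intros x Hx. rewrite <- Hbn in Hx.
    assert (Hk : forall k, (k <= n)%nat -> x <= b k -> exists i, (i < n)%nat /\ b i < x <= b (S i)).
    { induction k as [|k IH]; intros Hk Hxk; [lra |].
      destruct (Rle_lt_dec x (b k)); [apply IH; trivial; lia |].
      exists k. split; [lia | lra]. }
    apply (Hk n); lra || lia. }
  assert (Hout' : forall x, x <= 0 \/ 1 <= x -> f x = x).
  { intros x [Hx | Hx].
    - destruct Hx as [Hx | ->]; [apply Hout; lra | trivial].
    - destruct Hx as [Hx | <-]; [apply Hout; lra | trivial]. }
  assert (Hincr01 : forall x y, 0 <= x -> x < y -> y <= 1 -> f x < f y).
  { intros x y. rewrite <- Hbn. apply Hincr; lia. }
  split.
  - intros x y Hxy.
    destruct (Rle_lt_dec x 0) as [Hx | Hx].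
    + rewrite (Hout' x) by lra.
      destruct (Rle_lt_dec y 0) as [Hy | Hy]; [rewrite (Hout' y) by lra; lra |].
      destruct (Rle_lt_dec 1 y) as [Hy1 | Hy1]; [rewrite (Hout' y) by lra; lra |].
      specialize (Hincr01 0 y). lra.
    + destruct (Rle_lt_dec 1 x) as [Hx1 | Hx1]; [rewrite !Hout' by lra; lra |].
      destruct (Rle_lt_dec 1 y) as [Hy1 | Hy1].
      * rewrite (Hout' y) by lra. specialize (Hincr01 x 1). lra.
      * apply Hincr01; lra.
  - intros y.
    destruct (classic (0 <= y <= 1)) as [Hy | Hy].
    + destruct (Hsurj n (le_n n) y) as (x & _ & Hx); [rewrite Hbn; lra | eauto].
    + exists y. apply Hout'. lra.
  - trivial.
  - intros w.
    destruct (Rlt_le_dec w 0) as [Hw | Hw].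
    { exists (- w), 1. repeat split; try lra. intros x Hx. rewrite !Hout' by lra. ring. }
    destruct (Rlt_le_dec w 1) as [Hw1 | Hw1].
    { destruct (Hn w) as (i & Hi & Hwi); [lra |].
      exists (b (S i) - w), (a i). repeat split; [lra | auto |].
      intros x Hx. rewrite (Hf i x), (Hf i w) by (trivial; lra). ring. }
    exists 1, 1. repeat split; try lra. intros x Hx. rewrite !Hout' by lra. ring.
  - intros w.
    destruct (Rle_lt_dec w 0) as [Hw | Hw].
    { exists 1, 1. repeat split; try lra. intros x Hx. rewrite !Hout' by lra. ring. }
    destruct (Rle_lt_dec w 1) as [Hw1 | Hw1].
    { destruct (Hn' w) as (i & Hi & Hwi); [lra |].
      exists (w - b i), (a i). repeat split; [lra | auto |].
      intros x Hx. rewrite (Hf i x), (Hf i w) by (trivial; lra). ring. }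
    exists (w - 1), 1. repeat split; try lra. intros x Hx. rewrite !Hout' by lra. ring.
Qed.

(** * Groups of PL homeomorphisms *)

Record group (K : (R -> R) -> Prop) : Prop := {
  g_pl : forall g, K g -> PL g;
  g_id : K (fun x => x);
  g_mul : forall g h, K g -> K h -> K (rmul g h);
  g_inv : forall g, K g -> K (finv g) }.

Lemma finv_unique f f' : PL f -> (forall x, f (f' x) = x) -> f' = finv f.
Proof.
  intros Hf H. extensionality x. apply (PL_inj f); trivial. now rewrite H, finv_r.
Qed.

Lemma group_gen S : (forall g, S g -> PL g) -> group (subgroup_gen S).
Proof.
  intros HS.
  assert (HP : forall g, subgroup_gen S g -> PL g).
  { induction 1 as [g H | | g h _ IH1 _ IH2 | g g' _ IH H1 H2]; auto using PL_id, PL_mul.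
    rewrite (finv_unique g g'); auto using PL_finv. }
  split; auto using sg_id, sg_mul.
  intros g H. apply sg_inv with g; trivial; intros x.
  - now apply finv_r, HP.
  - now apply finv_l, HP.
Qed.

Lemma gen_incl (S K : (R -> R) -> Prop) g :
  group K -> (forall f, S f -> K f) -> subgroup_gen S g -> K g.
Proof.
  intros HK HS. induction 1 as [g H | | g h _ IH1 _ IH2 | g g' _ IH H1 H2]; auto.
  - apply HK.
  - now apply HK.
  - rewrite (finv_unique g g'); [now apply HK | now apply HK | trivial].
Qed.

Definition fixes (K : (R -> R) -> Prop) (x : R) : Prop := forall g, K g -> g x = x.

Lemma fix_finv g x : PL g -> g x = x -> finv g x = x.
Proof.
  intros Hg H. rewrite <- H at 1. now apply finv_l.
Qed.

Lemma fixes_gen S x :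
  (forall g, S g -> PL g) -> (forall g, S g -> g x = x) -> fixes (subgroup_gen S) x.
Proof.
  intros HS H g Hg.
  (* [PL g] is carried along because the inverse case must identify the given inverse with
     [finv]. *)
  enough (PL g /\ g x = x) by tauto.
  induction Hg as [g Hg | | g h _ [P1 I1] _ [P2 I2] | g g' _ [P1 I1] H1 H2].
  - auto.
  - auto using PL_id.
  - split; [now apply PL_mul |]. unfold rmul. now rewrite I1.
  - rewrite (finv_unique g g') by trivial. auto using PL_finv, fix_finv.
Qed.

(** * Conjugates, commutators and the derived group *)

(** In the right action these are h^-1 g h and g^-1 h^-1 g h. Thus [comm g h] sends [g (h z)] to
    [h (g z)], the form in which commutators are used below. *)
Definition conjg (g h : R -> R) : R -> R := fun x => h (g (finv h x)).
Definition comm (g h : R -> R) : R -> R := fun x => h (g (finv h (finv g x))).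

Lemma group_conjg K g h : group K -> K g -> K h -> K (conjg g h).
Proof.
  intros HK Hg Hh. apply (g_mul K HK (rmul (finv h) g) h); trivial.
  apply g_mul; trivial. now apply g_inv.
Qed.

Lemma group_comm K g h : group K -> K g -> K h -> K (comm g h).
Proof.
  intros HK Hg Hh.
  apply (g_mul K HK (rmul (rmul (finv g) (finv h)) g) h); trivial.
  repeat (apply g_mul; trivial); now apply g_inv.
Qed.

Definition der (K : (R -> R) -> Prop) : (R -> R) -> Prop :=
  subgroup_gen (fun w => exists g h, K g /\ K h /\ w = comm g h).

Lemma PL_conjg g h : PL g -> PL h -> PL (conjg g h).
Proof.
  intros Hg Hh. apply (PL_mul (rmul (finv h) g) h); trivial.
  apply PL_mul; trivial. now apply PL_finv.
Qed.

Lemma PL_comm g h : PL g -> PL h -> PL (comm g h).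
Proof.
  intros Hg Hh. apply (PL_mul (rmul (rmul (finv g) (finv h)) g) h); trivial.
  repeat (apply PL_mul; trivial); now apply PL_finv.
Qed.

Lemma group_der K : group K -> group (der K).
Proof.
  intros HK. apply group_gen. intros w (g & h & Hg & Hh & ->).
  apply HK. now apply group_comm.
Qed.

Lemma der_comm (K : (R -> R) -> Prop) g h : K g -> K h -> der K (comm g h).
Proof. intros. apply sg_gen. eauto. Qed.

Lemma der_sub K g : group K -> der K g -> K g.
Proof.
  intros HK. apply gen_incl; trivial.
  intros w (f & h & Hf & Hh & ->). now apply group_comm.
Qed.

Lemma conjg_mul f g h : PL h -> conjg (rmul f g) h = rmul (conjg f h) (conjg g h).
Proof.
  intros Hh. extensionality x. unfold conjg, rmul. now rewrite finv_l.
Qed.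

Lemma finv_conjg g h x : PL g -> PL h -> finv (conjg g h) x = conjg (finv g) h x.
Proof.
  intros Hg Hh. apply (PL_inj (conjg g h)); [now apply PL_conjg |].
  rewrite finv_r by now apply PL_conjg.
  unfold conjg. now rewrite finv_l, finv_r, finv_r.
Qed.

Lemma comm_conjg f g h : PL f -> PL g -> PL h -> conjg (comm f g) h = comm (conjg f h) (conjg g h).
Proof.
  intros Hf Hg Hh. extensionality x. unfold comm.
  rewrite !finv_conjg by trivial. unfold conjg, comm. now rewrite !finv_l.
Qed.

Definition normed (A K : (R -> R) -> Prop) : Prop := forall a g, A a -> K g -> A (conjg a g).

Lemma normed_gen S K : group K -> (forall g, S g -> PL g) ->
  (forall a g, S a -> K g -> subgroup_gen S (conjg a g)) -> normed (subgroup_gen S) K.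
Proof.
  intros HK HS H a g Ha Hg.
  assert (HG := group_gen S HS). assert (Hgp := g_pl K HK g Hg).
  induction Ha as [a Ha | | a b Ha IH1 Hb IH2 | a a' Ha IH H1 H2].
  - auto.
  - replace (conjg (fun x => x) g) with (fun x : R => x); [apply sg_id |].
    extensionality x. unfold conjg. now rewrite finv_r.
  - rewrite conjg_mul by trivial. now apply sg_mul.
  - assert (PL a) by now apply HG.
    rewrite (finv_unique a a') by trivial.
    replace (conjg (finv a) g) with (finv (conjg a g)); [now apply HG |].
    extensionality x. now apply finv_conjg.
Qed.

Lemma normed_der A K : group A -> group K -> normed A K -> normed (der A) K.
Proof.
  intros HA HK HN. apply normed_gen; trivial.
  - intros w (f & h & Hf & Hh & ->). now apply HA, group_comm.
  - intros w g (f & h & Hf & Hh & ->) Hg.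
    rewrite comm_conjg; [| now apply HA | now apply HA | now apply HK].
    apply der_comm; now apply HN.
Qed.

Lemma normed_self K : group K -> normed K K.
Proof. intros HK a g Ha Hg. now apply group_conjg. Qed.

(** If [a] fixes [x] for all [a] in [A], then so does the conjugate of [a] by the inverse of [g],
    which says that [a] fixes [g x]. *)
Lemma normed_fix A K g x : group K -> normed A K -> K g -> fixes A x -> fixes A (g x).
Proof.
  intros HK HN Hg Hx a Ha.
  assert (Hp := g_pl K HK g Hg). assert (Hp' := PL_finv g Hp).
  assert (H := Hx (conjg a (finv g)) (HN _ _ Ha (g_inv K HK g Hg))).
  unfold conjg in H. apply (PL_inj (finv g)); trivial.
  rewrite finv_l by trivial.
  replace (g x) with (finv (finv g) x); trivial.
  apply (PL_inj (finv g)); trivial. rewrite finv_r, finv_l; trivial.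
Qed.

(** * Suprema of orbits *)

Definition is_glb (E : R -> Prop) (m : R) : Prop :=
  (forall x, E x -> m <= x) /\ forall y, (forall x, E x -> y <= x) -> y <= m.

Lemma lub_ex (E : R -> Prop) z x : E x -> (forall y, E y -> y <= z) -> exists s, is_lub E s.
Proof.
  intros Hx Hz. destruct (completeness E) as [s Hs]; [now exists z | now exists x | now exists s].
Qed.

Lemma glb_ex (E : R -> Prop) z x : E x -> (forall y, E y -> z <= y) -> exists s, is_glb E s.
Proof.
  intros Hx Hz. destruct (lub_ex (fun y => E (- y)) (- z) (- x)) as [s [H1 H2]].
  - now rewrite Ropp_involutive.
  - intros y Hy. specialize (Hz _ Hy). lra.
  - exists (- s). split.
    + intros y Hy. enough (- y <= s) by lra. apply H1. now rewrite Ropp_involutive.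
    + intros y Hy. enough (s <= - y) by lra. apply H2. intros t Ht. specialize (Hy _ Ht). lra.
Qed.

(** An increasing bijection preserving a set preserves its supremum. This is the source of all fixed
    points constructed below. *)
Lemma lub_fixed h E s : PL h -> (forall y, E y -> E (h y)) -> (forall y, E y -> E (finv h y)) ->
  is_lub E s -> h s = s.
Proof.
  intros Hh H1 H2 [Hu Hl]. apply Rle_antisym.
  - rewrite <- (finv_r h s Hh) at 2. apply PL_le; trivial.
    apply Hl. intros y Hy. rewrite <- (finv_l h y Hh). apply PL_le; [now apply PL_finv |].
    apply Hu; auto.
  - apply Hl. intros y Hy. rewrite <- (finv_r h y Hh). apply PL_le; trivial. apply Hu; auto.
Qed.

Lemma glb_fixed h E s : PL h -> (forall y, E y -> E (h y)) -> (forall y, E y -> E (finv h y)) ->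
  is_glb E s -> h s = s.
Proof.
  intros Hh H1 H2 [Hu Hl]. apply Rle_antisym.
  - apply Hl. intros y Hy. rewrite <- (finv_r h y Hh). apply PL_le; trivial. apply Hu; auto.
  - rewrite <- (finv_r h s Hh) at 1. apply PL_le; trivial.
    apply Hl. intros y Hy. rewrite <- (finv_l h y Hh). apply PL_le; [now apply PL_finv |].
    apply Hu; auto.
Qed.

Lemma lub_fixed_pts h E s : PL h -> (forall y, E y -> h y = y) -> is_lub E s -> h s = s.
Proof.
  intros Hh H. apply lub_fixed; trivial; intros y Hy; [now rewrite H |].
  rewrite fix_finv; auto.
Qed.

Lemma glb_fixed_pts h E s : PL h -> (forall y, E y -> h y = y) -> is_glb E s -> h s = s.
Proof.
  intros Hh H. apply glb_fixed; trivial; intros y Hy; [now rewrite H |].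
  rewrite fix_finv; auto.
Qed.

Definition orb_pts (A : (R -> R) -> Prop) (x y : R) : Prop := exists g, A g /\ y = g x.

Lemma orb_pts_inv A x g y : group A -> A g -> orb_pts A x y -> orb_pts A x (g y).
Proof.
  intros HA Hg (h & Hh & ->). exists (rmul h g). split; [now apply HA | trivial].
Qed.

Lemma orbit_sup A x z : group A -> (forall g, A g -> g x <= z) ->
  exists s, x <= s <= z /\ fixes A s /\ is_lub (orb_pts A x) s.
Proof.
  intros HA Hz.
  assert (Hx : orb_pts A x x) by (exists (fun x => x); split; [apply HA | trivial]).
  assert (Hb : forall y, orb_pts A x y -> y <= z) by (intros y (g & Hg & ->); auto).
  destruct (lub_ex (orb_pts A x) z x) as [s Hs]; trivial.
  exists s. repeat split; [now apply Hs | now apply Hs | | apply Hs | apply Hs].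
  intros g Hg. apply (lub_fixed g (orb_pts A x)); trivial; [now apply HA | |];
    intros y Hy; apply orb_pts_inv; trivial. now apply HA.
Qed.

Lemma orbit_inf A x z : group A -> (forall g, A g -> z <= g x) ->
  exists s, z <= s <= x /\ fixes A s /\ is_glb (orb_pts A x) s.
Proof.
  intros HA Hz.
  assert (Hx : orb_pts A x x) by (exists (fun x => x); split; [apply HA | trivial]).
  assert (Hb : forall y, orb_pts A x y -> z <= y) by (intros y (g & Hg & ->); auto).
  destruct (glb_ex (orb_pts A x) z x) as [s Hs]; trivial.
  exists s. repeat split; [now apply Hs | now apply Hs | | apply Hs | apply Hs].
  intros g Hg. apply (glb_fixed g (orb_pts A x)); trivial; [now apply HA | |];
    intros y Hy; apply orb_pts_inv; trivial. now apply HA.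
Qed.

(** * Groups without a common fixed point in an interval *)

Definition nofix (A : (R -> R) -> Prop) (a b : R) : Prop :=
  forall x, a < x < b -> exists g, A g /\ g x <> x.

Lemma nofix_dec A a b : nofix A a b \/ exists x, a < x < b /\ fixes A x.
Proof.
  destruct (classic (exists x, a < x < b /\ fixes A x)) as [|H]; [tauto | left].
  intros x Hx. apply NNPP. intros H'. apply H. exists x. split; trivial.
  intros g Hg. apply NNPP. eauto.
Qed.

Lemma nofix_no A a b x : nofix A a b -> a < x < b -> ~ fixes A x.
Proof.
  intros H Hx Hf. destruct (H x Hx) as (g & Hg & Hgx). auto.
Qed.

(** A bounded orbit would have a common fixed point of the group as its supremum. *)
Lemma cofinal_up A a b x y : group A -> nofix A a b -> a < x < b -> y < b ->
  exists g, A g /\ y < g x.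
Proof.
  intros HA HN Hx Hy. apply NNPP. intros H.
  destruct (orbit_sup A x y) as (s & Hs & Hf & _); trivial.
  - intros g Hg. destruct (Rle_lt_dec (g x) y); trivial. exfalso; eauto.
  - apply (nofix_no A a b s); trivial. lra.
Qed.

Lemma cofinal_down A a b x y : group A -> nofix A a b -> a < x < b -> a < y ->
  exists g, A g /\ g x < y.
Proof.
  intros HA HN Hx Hy. apply NNPP. intros H.
  destruct (orbit_inf A x y) as (s & Hs & Hf & _); trivial.
  - intros g Hg. destruct (Rle_lt_dec y (g x)); trivial. exfalso; eauto.
  - apply (nofix_no A a b s); trivial. lra.
Qed.

Lemma PL_between g a b x : PL g -> g a = a -> g b = b -> a < x < b -> a < g x < b.
Proof.
  intros Hg Ha Hb Hx.
  assert (g a < g x) by (apply PL_incr; trivial; lra).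
  assert (g x < g b) by (apply PL_incr; trivial; lra). lra.
Qed.

Lemma PL_between_le g a b x : PL g -> g a = a -> g b = b -> a <= x <= b -> a <= g x <= b.
Proof.
  intros Hg Ha Hb Hx.
  assert (g a <= g x) by (apply PL_le; trivial; lra).
  assert (g x <= g b) by (apply PL_le; trivial; lra). lra.
Qed.

(** * Integer powers *)

Definition pw (g : R -> R) (n : Z) (x : R) : R :=
  if (0 <=? n)%Z then Nat.iter (Z.to_nat n) g x else Nat.iter (Z.to_nat (- n)) (finv g) x.

Lemma pw_0 g x : pw g 0 x = x.
Proof. reflexivity. Qed.

Lemma pw_succ g n x : PL g -> pw g (Z.succ n) x = g (pw g n x).
Proof.
  intros Hg. unfold pw. destruct (Z.leb_spec 0 n).
  - rewrite (proj2 (Z.leb_le 0 (Z.succ n))) by lia.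
    rewrite Z2Nat.inj_succ by trivial. reflexivity.
  - destruct (Z.leb_spec 0 (Z.succ n)).
    + replace n with (-1)%Z by lia. simpl. now rewrite finv_r.
    + replace (- n)%Z with (Z.succ (- Z.succ n)) by lia.
      rewrite Z2Nat.inj_succ by lia. simpl. now rewrite finv_r.
Qed.

Lemma pw_pred g n x : PL g -> pw g (Z.pred n) x = finv g (pw g n x).
Proof.
  intros Hg. replace n with (Z.succ (Z.pred n)) at 2 by lia.
  rewrite pw_succ by trivial. now rewrite finv_l.
Qed.

Lemma pw_1 g x : PL g -> pw g 1 x = g x.
Proof. intros Hg. now rewrite (pw_succ g 0). Qed.

Lemma pw_add g m n x : PL g -> pw g (m + n) x = pw g m (pw g n x).
Proof.
  intros Hg. revert m. apply Z.bi_induction.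
  - now intros ? ? ->.
  - reflexivity.
  - intros m. rewrite Z.add_succ_l, !pw_succ by trivial.
    split; [now intros -> | apply PL_inj; trivial].
Qed.

Lemma pw_K K g n : group K -> K g -> K (pw g n).
Proof.
  intros HK Hg. assert (Hp := g_pl K HK g Hg).
  assert (H : forall m : nat, K (Nat.iter m g)).
  { induction m as [|m IH]; [now apply (g_id K) |].
    now apply (g_mul K HK (Nat.iter m g) g). }
  assert (H' : forall m : nat, K (Nat.iter m (finv g))).
  { induction m as [|m IH]; [now apply (g_id K) |].
    apply (g_mul K HK (Nat.iter m (finv g)) (finv g)); trivial. now apply HK. }
  unfold pw. destruct (0 <=? n)%Z; [apply H | apply H'].
Qed.

Lemma group_PL : group PL.
Proof. split; auto using PL_id, PL_mul, PL_finv. Qed.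

Lemma PL_pw g n : PL g -> PL (pw g n).
Proof. apply (pw_K PL), group_PL. Qed.

Lemma pw_cancel g m n x : PL g -> (m + n = 0)%Z -> pw g m (pw g n x) = x.
Proof. intros Hg H. now rewrite <- pw_add, H. Qed.

Lemma finv_pw g n x : PL g -> finv (pw g n) x = pw g (- n) x.
Proof.
  intros Hg. apply (PL_inj (pw g n)); [now apply PL_pw |].
  rewrite finv_r, pw_cancel; trivial; [lia | now apply PL_pw].
Qed.

Lemma pw_mul g m n x : PL g -> pw (pw g m) n x = pw g (m * n) x.
Proof.
  intros Hg. assert (PL (pw g m)) by now apply PL_pw.
  revert n. apply Z.bi_induction.
  - now intros ? ? ->.
  - now rewrite Z.mul_0_r.
  - intros n. rewrite pw_succ by trivial. rewrite Z.mul_succ_r, Z.add_comm, pw_add by trivial.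
    split; [now intros -> | apply PL_inj; trivial].
Qed.

Lemma pw_fix g n x : PL g -> g x = x -> pw g n x = x.
Proof.
  intros Hg H. revert n. apply Z.bi_induction.
  - now intros ? ? ->.
  - reflexivity.
  - intros n. rewrite pw_succ by trivial. rewrite <- H at 4.
    split; [now intros -> | apply PL_inj; trivial].
Qed.

Definition cyc (g : R -> R) (f : R -> R) : Prop := exists n, f = pw g n.

Lemma group_cyc g : PL g -> group (cyc g).
Proof.
  intros Hg. split.
  - intros f [n ->]. now apply PL_pw.
  - now exists 0%Z.
  - intros f h [n ->] [m ->]. exists (m + n)%Z. extensionality x. now rewrite pw_add.
  - intros f [n ->]. exists (- n)%Z. extensionality x. now apply finv_pw.
Qed.

Lemma cyc_self g : PL g -> cyc g g.
Proof. intros Hg. exists 1%Z. extensionality x. now rewrite pw_1. Qed.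

(** * Elements without fixed points on an interval *)

Lemma pw_nonneg_ge c n x : PL c -> (0 <= n)%Z -> x <= c x -> x <= pw c n x.
Proof.
  intros Hc Hn Hx. revert n Hn. apply natlike_ind; [rewrite pw_0; lra |].
  intros n _ IH. rewrite pw_succ by trivial. apply (PL_le c) in IH; trivial. lra.
Qed.

Lemma pw_nonneg_le c n x : PL c -> (0 <= n)%Z -> c x <= x -> pw c n x <= x.
Proof.
  intros Hc Hn Hx. revert n Hn. apply natlike_ind; [rewrite pw_0; lra |].
  intros n _ IH. rewrite pw_succ by trivial. apply (PL_le c) in IH; trivial. lra.
Qed.

Lemma pw_neg_le c n x : PL c -> (n <= 0)%Z -> x <= c x -> pw c n x <= x.
Proof.
  intros Hc Hn Hx. apply (PL_le_rev (pw c (- n))); [now apply PL_pw |].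
  rewrite pw_cancel by (trivial; lia). apply pw_nonneg_ge; trivial; lia.
Qed.

Definition free_on (c : R -> R) (a b : R) : Prop :=
  PL c /\ c a = a /\ c b = b /\ forall x, a < x < b -> c x <> x.

Lemma free_nofix c a b : free_on c a b -> nofix (cyc c) a b.
Proof.
  intros (Hc & _ & _ & H) x Hx. exists c. split; [now apply cyc_self | auto].
Qed.

Lemma free_up c a b x y : free_on c a b -> a < x < b -> x < c x -> a < y < b -> y < c y.
Proof.
  intros Hf Hx Hcx Hy. assert (HN := free_nofix c a b Hf).
  destruct Hf as (Hc & Ha & Hb & Hf).
  destruct (Rlt_le_dec y (c y)) as [|H]; trivial.
  assert (c y < y) by (specialize (Hf y Hy); lra). exfalso.
  destruct (Rtotal_order x y) as [Hxy | [-> | Hxy]]; [| lra |].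
  - destruct (cofinal_up (cyc c) a b x y) as (g & [n ->] & Hn); trivial; [now apply group_cyc | lra |].
    destruct (Z.le_gt_cases 0 n).
    + assert (pw c n x < pw c n y) by (apply PL_incr; trivial; now apply PL_pw).
      assert (pw c n y <= y) by (apply pw_nonneg_le; trivial). lra.
    + assert (pw c n x <= x) by (apply pw_neg_le; trivial; lia || lra). lra.
  - destruct (cofinal_up (cyc c) a b y x) as (g & [n ->] & Hn); trivial; [now apply group_cyc | lra |].
    destruct (Z.le_gt_cases 0 n).
    + assert (pw c n y <= y) by (apply pw_nonneg_le; trivial). lra.
    + assert (pw c n y < pw c n x) by (apply PL_incr; trivial; now apply PL_pw).
      assert (pw c n x <= x) by (apply pw_neg_le; trivial; lia || lra). lra.
Qed.

Lemma free_pw c a b n x : free_on c a b -> a < x < b -> a < pw c n x < b.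
Proof.
  intros (Hc & Ha & Hb & Hf) Hx.
  apply PL_between; trivial; [now apply PL_pw | |]; now apply pw_fix.
Qed.

Lemma free_finv c a b : free_on c a b -> free_on (finv c) a b.
Proof.
  intros (Hc & Ha & Hb & Hf). split; [now apply PL_finv | split; [now apply fix_finv | split; [now apply fix_finv |]]].
  intros x Hx H. apply (Hf x Hx). rewrite <- H at 1. now apply finv_r.
Qed.

Lemma pw_incr c a b m n x : free_on c a b -> a < x < b -> x < c x ->
  (m < n)%Z -> pw c m x < pw c n x.
Proof.
  intros Hf Hx Hcx Hmn. assert (Hc := proj1 Hf).
  replace n with (n - m - 1 + (1 + m))%Z by lia. rewrite pw_add, (pw_add c 1), pw_1 by trivial.
  assert (Hm := free_pw c a b m x Hf Hx).
  assert (pw c m x < c (pw c m x)) by now apply (free_up c a b x).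
  assert (Hm' : a < c (pw c m x) < b) by (apply PL_between; trivial; apply Hf).
  apply Rlt_le_trans with (c (pw c m x)); trivial.
  apply pw_nonneg_ge; trivial; [lia |].
  left. now apply (free_up c a b x).
Qed.

Lemma pw_incr_le c a b m n x : free_on c a b -> a < x < b -> x < c x ->
  (m <= n)%Z -> pw c m x <= pw c n x.
Proof.
  intros Hf Hx Hcx Hmn. destruct (Z.le_lteq m n) as [[H | ->] _]; trivial; [left | right; trivial].
  now apply (pw_incr c a b).
Qed.

Lemma escape_up c a b x y : free_on c a b -> a < x < b -> x < c x -> y < b ->
  exists N, (0 <= N)%Z /\ forall n, (N <= n)%Z -> y < pw c n x.
Proof.
  intros Hf Hx Hcx Hy. assert (HN := free_nofix c a b Hf). assert (Hc := proj1 Hf).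
  destruct (cofinal_up (cyc c) a b x y) as (g & [n ->] & Hn); trivial; [now apply group_cyc |].
  exists (Z.max 0 n). split; [lia |]. intros m Hm. apply Rlt_le_trans with (pw c n x); trivial.
  apply (pw_incr_le c a b); trivial; lia.
Qed.

Lemma escape_down c a b x y : free_on c a b -> a < x < b -> x < c x -> a < y ->
  exists N, (0 <= N)%Z /\ forall n, (n <= - N)%Z -> pw c n x < y.
Proof.
  intros Hf Hx Hcx Hy. assert (HN := free_nofix c a b Hf). assert (Hc := proj1 Hf).
  destruct (cofinal_down (cyc c) a b x y) as (g & [n ->] & Hn); trivial; [now apply group_cyc |].
  exists (Z.max 0 (- n)). split; [lia |]. intros m Hm. apply Rle_lt_trans with (pw c n x); trivial.
  apply (pw_incr_le c a b); trivial; lia.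
Qed.

Lemma pw_floor c a b p x : free_on c a b -> a < p < b -> p < c p -> a < x < b ->
  exists n, pw c n p <= x < pw c (n + 1) p.
Proof.
  intros Hf Hp Hcp Hx. assert (Hc := proj1 Hf).
  destruct (escape_up c a b p x) as (N & HN0 & HN); trivial; [lra |].
  destruct (escape_down c a b p x) as (M & HM0 & HM); trivial; [lra |].
  assert (H : forall k : nat, x < pw c (- M + Z.of_nat k) p -> exists n, pw c n p <= x < pw c (n + 1) p).
  { induction k as [|k IH]; intros Hk.
    - specialize (HM (- M + 0)%Z ltac:(lia)). simpl in Hk. lra.
    - destruct (Rlt_le_dec x (pw c (- M + Z.of_nat k) p)) as [H | H]; [now apply IH |].
      exists (- M + Z.of_nat k)%Z. split; trivial.
      replace (- M + Z.of_nat k + 1)%Z with (- M + Z.of_nat (S k))%Z by lia. trivial. }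
  apply (H (Z.to_nat (N + M))). apply HN. lia.
Qed.

(** * Elements trivial near the ends of an interval *)

Definition cs (g : R -> R) (a b : R) : Prop :=
  exists s t, a < s /\ s <= t /\ t < b /\ forall x, a <= x <= b -> x <= s \/ t <= x -> g x = x.

Lemma cs_intro g a b s t : a < b -> a < s -> t < b -> (forall x, a <= x <= s -> g x = x) ->
  (forall x, t <= x <= b -> g x = x) -> cs g a b.
Proof.
  intros Hab Hs Ht H1 H2.
  assert (a < Rmin s ((a + b) / 2)) by (apply Rmin_glb_lt; lra).
  assert (Rmax t ((a + b) / 2) < b) by (apply Rmax_lub_lt; lra).
  assert (L1 := Rmin_l s ((a + b) / 2)). assert (L2 := Rmin_r s ((a + b) / 2)).
  assert (L3 := Rmax_l t ((a + b) / 2)). assert (L4 := Rmax_r t ((a + b) / 2)).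
  exists (Rmin s ((a + b) / 2)), (Rmax t ((a + b) / 2)).
  repeat split; trivial; [lra |].
  intros x Hx [Hx' | Hx']; [apply H1 | apply H2]; lra.
Qed.

Lemma cs_id a b : a < b -> cs (fun x => x) a b.
Proof. intros H. apply (cs_intro _ a b b a); trivial; lra. Qed.

Lemma cs_mul g h a b : cs g a b -> cs h a b -> cs (rmul g h) a b.
Proof.
  intros (s & t & Hs & Hst & Ht & H) (s' & t' & Hs' & Hst' & Ht' & H').
  unfold rmul. apply (cs_intro _ a b (Rmin s s') (Rmax t t')).
  - lra.
  - now apply Rmin_glb_lt.
  - now apply Rmax_lub_lt.
  - intros x Hx. assert (L1 := Rmin_l s s'). assert (L2 := Rmin_r s s').
    rewrite H by lra. apply H'; lra.
  - intros x Hx. assert (L1 := Rmax_l t t'). assert (L2 := Rmax_r t t').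
    rewrite H by lra. apply H'; lra.
Qed.

Lemma cs_finv g a b : PL g -> cs g a b -> cs (finv g) a b.
Proof.
  intros Hg (s & t & Hs & Hst & Ht & H). exists s, t. repeat split; trivial.
  intros x Hx Hx'. apply fix_finv; auto.
Qed.

(** At a common fixed point the one-sided germs are homotheties, and these commute. *)
Lemma cs_comm g h a b : PL g -> PL h -> g a = a -> h a = a -> g b = b -> h b = b -> a < b ->
  cs (comm g h) a b.
Proof.
  intros Hg Hh Ga Ha Gb Hb Hab.
  assert (Hgh : forall x, exists z, x = g (h z)).
  { intros x. exists (finv h (finv g x)). now rewrite !finv_r. }
  assert (Hc : forall z, comm g h (g (h z)) = h (g z)).
  { intros z. unfold comm. now rewrite !finv_l. }
  destruct (PL_right g Hg a) as (e1 & k1 & He1 & Hk1 & H1).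
  destruct (PL_right h Hh a) as (e2 & k2 & He2 & Hk2 & H2).
  destruct (PL_left g Hg b) as (e3 & k3 & He3 & Hk3 & H3).
  destruct (PL_left h Hh b) as (e4 & k4 & He4 & Hk4 & H4).
  rewrite Ga in H1. rewrite Ha in H2. rewrite Gb in H3. rewrite Hb in H4.
  (* [d] is so small that both composites, in either order, stay within the affine ranges next to
     [a]. *)
  assert (Hx : exists d, 0 < d /\ d <= e1 /\ d <= e2 /\ k2 * d <= e1 /\ k1 * d <= e2).
  { assert (D1 : 0 < e1 / k2) by now apply Rdiv_lt_0_compat.
    assert (D2 : 0 < e2 / k1) by now apply Rdiv_lt_0_compat.
    exists (Rmin (Rmin e1 e2) (Rmin (e1 / k2) (e2 / k1))).
    assert (L1 := Rmin_l (Rmin e1 e2) (Rmin (e1 / k2) (e2 / k1))).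
    assert (L2 := Rmin_r (Rmin e1 e2) (Rmin (e1 / k2) (e2 / k1))).
    assert (L3 := Rmin_l e1 e2). assert (L4 := Rmin_r e1 e2).
    assert (L5 := Rmin_l (e1 / k2) (e2 / k1)). assert (L6 := Rmin_r (e1 / k2) (e2 / k1)).
    set (d := Rmin (Rmin e1 e2) (Rmin (e1 / k2) (e2 / k1))) in *.
    repeat split; try lra.
    - unfold d. repeat apply Rmin_glb_lt; trivial.
    - replace e1 with (k2 * (e1 / k2)) by (field; lra). apply Rmult_le_compat_l; lra.
    - replace e2 with (k1 * (e2 / k1)) by (field; lra). apply Rmult_le_compat_l; lra. }
  assert (Hy : exists d, 0 < d /\ d <= e3 /\ d <= e4 /\ k4 * d <= e3 /\ k3 * d <= e4).
  { assert (D1 : 0 < e3 / k4) by now apply Rdiv_lt_0_compat.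
    assert (D2 : 0 < e4 / k3) by now apply Rdiv_lt_0_compat.
    exists (Rmin (Rmin e3 e4) (Rmin (e3 / k4) (e4 / k3))).
    assert (L1 := Rmin_l (Rmin e3 e4) (Rmin (e3 / k4) (e4 / k3))).
    assert (L2 := Rmin_r (Rmin e3 e4) (Rmin (e3 / k4) (e4 / k3))).
    assert (L3 := Rmin_l e3 e4). assert (L4 := Rmin_r e3 e4).
    assert (L5 := Rmin_l (e3 / k4) (e4 / k3)). assert (L6 := Rmin_r (e3 / k4) (e4 / k3)).
    set (d := Rmin (Rmin e3 e4) (Rmin (e3 / k4) (e4 / k3))) in *.
    repeat split; try lra.
    - unfold d. repeat apply Rmin_glb_lt; trivial.
    - replace e3 with (k4 * (e3 / k4)) by (field; lra). apply Rmult_le_compat_l; lra.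
    - replace e4 with (k3 * (e4 / k3)) by (field; lra). apply Rmult_le_compat_l; lra. }
  destruct Hx as (d & Hd & D1 & D2 & D3 & D4).
  destruct Hy as (d' & Hd' & D5 & D6 & D7 & D8).
  (* The commutator is known at points of the form [g (h z)], so the neighbourhoods of the ends are
     taken as images under this composite. *)
  apply (cs_intro _ a b (g (h (a + d))) (g (h (b - d')))); trivial.
  - assert (H : g (h a) < g (h (a + d))) by (apply PL_incr, PL_incr; trivial; lra).
    now rewrite Ha, Ga in H.
  - assert (H : g (h (b - d')) < g (h b)) by (apply PL_incr, PL_incr; trivial; lra).
    now rewrite Hb, Gb in H.
  - intros x Hx. destruct (Hgh x) as [z ->].
    assert (Hz : a <= z <= a + d).
    { assert (H : g (h a) = a) by now rewrite Ha.
      split; apply (PL_le_rev h); trivial; apply (PL_le_rev g); trivial; lra. }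
    rewrite Hc. assert (0 <= k2 * (z - a) <= k2 * d).
    { split; [apply Rmult_le_pos | apply Rmult_le_compat_l]; lra. }
    assert (0 <= k1 * (z - a) <= k1 * d).
    { split; [apply Rmult_le_pos | apply Rmult_le_compat_l]; lra. }
    rewrite (H1 z), (H2 z) by lra. rewrite H1, H2 by lra. ring.
  - intros x Hx. destruct (Hgh x) as [z ->].
    assert (Hz : b - d' <= z <= b).
    { assert (H : g (h b) = b) by now rewrite Hb.
      split; apply (PL_le_rev h); trivial; apply (PL_le_rev g); trivial; lra. }
    rewrite Hc. assert (0 <= k4 * (b - z) <= k4 * d').
    { split; [apply Rmult_le_pos | apply Rmult_le_compat_l]; lra. }
    assert (0 <= k3 * (b - z) <= k3 * d').
    { split; [apply Rmult_le_pos | apply Rmult_le_compat_l]; lra. }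
    rewrite (H3 z), (H4 z) by lra. rewrite H3, H4 by lra. ring.
Qed.

Lemma cs_der K a b g : group K -> fixes K a -> fixes K b -> a < b -> der K g -> cs g a b.
Proof.
  intros HK Ha Hb Hab Hg.
  enough (PL g /\ cs g a b) by tauto.
  induction Hg as [w (f & h & Hf & Hh & ->) | | g h _ [P1 I1] _ [P2 I2] | g g' _ [P1 I1] H1 H2].
  - split; [apply PL_comm; now apply HK |]. apply cs_comm; auto; now apply HK.
  - auto using PL_id, cs_id.
  - auto using PL_mul, cs_mul.
  - rewrite (finv_unique g g') by trivial. auto using PL_finv, cs_finv.
Qed.

(** * Commuting with an element that is trivial near both ends *)

Lemma affine_two_fix e l r c k d x1 x2 :
  (forall x, l <= x <= r -> e x = c + k * (x - d)) ->
  l <= x1 -> x1 < x2 -> x2 <= r -> e x1 = x1 -> e x2 = x2 ->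
  forall x, l <= x <= r -> e x = x.
Proof.
  intros H L1 L2 L3 E1 E2 x Hx.
  rewrite H in E1, E2 by lra. rewrite H by lra.
  assert (Hk : (k - 1) * (x2 - x1) = 0) by lra.
  apply Rmult_integral in Hk. destruct Hk as [Hk | Hk]; [| lra].
  replace k with 1 in * by lra. lra.
Qed.

(* If [g] moved [u], the translates of [u] by the powers of [g] would be fixed points of [e]
   interlaced with moved points of [e], which a one-sided affine germ at their limit forbids. *)
Lemma commuting_fixes_orbital_end K M a b e q :
  group K -> fixes K a -> fixes K b -> (forall m, M m -> PL m) -> normed M K ->
  K e -> cs e a b -> a < q < b -> fixes M q -> e q <> q ->
  exists u, a < u < b /\ fixes M u /\
    forall g, K g -> (forall x, a < x < b -> fixes M x -> g (e x) = e (g x)) -> g u = u.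
Proof.
  intros HK Ha Hb HM HN He (s & t & Hs & Hst & Ht & Hcs) Hq Hqf Hqe.
  assert (Hpe : PL e) by now apply HK.
  assert (Hsq : s < q). { destruct (Rle_lt_dec q s); trivial. destruct Hqe. apply Hcs; lra. }
  destruct (orbit_inf (cyc e) q s) as (u & Hu & Hfu & Hglb); [now apply group_cyc | |].
  { intros g [n ->]. rewrite <- (pw_fix e n s) by (trivial; apply Hcs; lra).
    apply PL_le; [now apply PL_pw | lra]. }
  assert (Heu : e u = u) by (apply Hfu; now apply cyc_self).
  assert (Huq : u < q). { destruct (proj2 Hu) as [| ->]; trivial. now destruct Hqe. }
  assert (HMK : forall g x, K g -> a < x < b -> fixes M x -> a < g x < b /\ fixes M (g x)).
  { intros g x Hg Hx Hf. split; [apply PL_between; auto; now apply HK |].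
    now apply (normed_fix M K). }
  assert (HMu : fixes M u).
  { intros m Hm. apply (glb_fixed_pts m (orb_pts (cyc e) q)); auto.
    intros y (f & [n ->] & ->). assert (Hn : K (pw e n)) by now apply pw_K.
    now apply (HMK (pw e n) q). }
  exists u. split; [lra | split; [trivial |]].
  assert (Hup : forall g, K g ->
    (forall x, a < x < b -> fixes M x -> g (e x) = e (g x)) -> ~ u < g u).
  { intros g Hg Hcom Hgu. assert (Hpg : PL g) by now apply HK.
    assert (Hegu : e (g u) = g u) by (rewrite <- Hcom, Heu; trivial; lra).
    (* [u] is the infimum of the orbit of [q] under the powers of [e], so no fixed point of [e] lies
       above [u] and below [q]. *)
    assert (Hqgu : q < g u).
    { destruct (Rlt_le_dec q (g u)) as [|Hle]; trivial. exfalso.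
      assert (g u <> q) by (intros E; rewrite E in Hegu; tauto).
      assert (~ (forall y, orb_pts (cyc e) q y -> g u <= y)) as Hn.
      { intros Hn. apply Hglb in Hn. lra. }
      apply Hn. intros y (f & [n ->] & ->).
      rewrite <- (pw_fix e n (g u)) by trivial. apply PL_le; trivial. now apply PL_pw. }
    set (w := fun n => Nat.iter n g u). set (r := fun n => Nat.iter n g q).
    assert (Hw : forall n, a < w n < b /\ fixes M (w n) /\ e (w n) = w n).
    { induction n as [|n (I1 & I2 & I3)]; [repeat split; trivial; unfold w; simpl; lra |].
      destruct (HMK g (w n)) as [J1 J2]; trivial.
      change (w (S n)) with (g (w n)). repeat split; trivial; try lra.
      rewrite <- Hcom, I3; trivial. }
    assert (Hr : forall n, a < r n < b /\ fixes M (r n) /\ e (r n) <> r n).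
    { induction n as [|n (I1 & I2 & I3)]; [now repeat split |].
      destruct (HMK g (r n)) as [J1 J2]; trivial.
      change (r (S n)) with (g (r n)). repeat split; trivial; try lra.
      rewrite <- Hcom by trivial. intros E. apply I3. now apply (PL_inj g). }
    assert (Hwr : forall n, w n < r n < w (S n)).
    { induction n as [|n [I1 I2]]; [unfold w, r; simpl; lra |].
      change (g (w n) < g (r n) < g (w (S n))). split; apply PL_incr; trivial. }
    destruct (lub_ex (fun y => exists n, y = w n) b (w O)) as [l [Hl1 Hl2]]; [eauto | |].
    { intros y [n ->]. destruct (Hw n). lra. }
    destruct (PL_left e Hpe l) as (d & k & Hd & Hk & Haff).
    assert (exists n, l - d < w n) as [n Hn].
    { apply NNPP. intros H. assert (l <= l - d); [| lra].
      apply Hl2. intros y [n ->]. destruct (Rle_lt_dec (w n) (l - d)); trivial.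
      exfalso. apply H. now exists n. }
    assert (H1 : w n <= l) by eauto. assert (H2 : w (S n) <= l) by eauto.
    assert (L := Hwr n).
    apply (proj2 (proj2 (Hr n))).
    apply (affine_two_fix e (l - d) l (e l) k l (w n) (w (S n))); trivial; try lra; apply Hw. }
  intros g Hg Hcom. assert (Hpg : PL g) by now apply HK.
  assert (H1 := Hup g Hg Hcom).
  assert (H2 : ~ u < finv g u).
  { apply Hup; [now apply HK |]. intros x Hx Hf.
    destruct (HMK (finv g) x) as [J1 J2]; trivial; [now apply HK |].
    apply (PL_inj g); trivial. rewrite Hcom by trivial. now rewrite !finv_r. }
  destruct (Rlt_le_dec (g u) u) as [H3 | H3]; [| lra].
  exfalso. apply H2. apply (PL_lt_rev g); trivial. rewrite finv_r; trivial.
Qed.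

(** The fixed set of [M] is invariant under [K], so it contains [g (h x)], and the commutator sends
    this point to [h (g x)]. *)
Lemma comm_fix_commute K M g h a b x : group K -> fixes K a -> fixes K b -> normed M K ->
  K g -> K h -> M (comm g h) -> a < x < b -> fixes M x -> h (g x) = g (h x).
Proof.
  intros HK Ha Hb HN Hg Hh Hc Hx Hf.
  assert (Hgp : PL g) by now apply HK. assert (Hhp : PL h) by now apply HK.
  assert (H : fixes M (g (h x))).
  { apply (normed_fix M K); trivial. now apply (normed_fix M K). }
  specialize (H _ Hc). unfold comm in H. now rewrite !finv_l in H.
Qed.

(** On fixed points of [C] the groups [A] and [B] commute. If [C] had one, some [e] in [A] would
    move it, and an end of the orbital of [e] would be fixed by all of [B]. This carries the absence
    of fixed points over to second derived groups and to intersections of kernels. *)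
Lemma comm_nofix K A B C a b : group K -> a < b -> fixes K a -> fixes K b ->
  group A -> group B ->
  (forall g, A g -> K g) -> (forall g, B g -> K g) -> (forall g, C g -> PL g) -> normed C K ->
  (forall g h, A g -> B h -> C (comm g h)) ->
  (forall g, A g -> cs g a b) -> nofix A a b -> nofix B a b -> nofix C a b.
Proof.
  intros HK Hab Ha Hb HA HB AK BK HC HN Hcomm Hcs NA NB.
  destruct (nofix_dec C a b) as [|(q & Hq & Hfq)]; trivial. exfalso.
  destruct (NA q Hq) as (e & He & Heq).
  destruct (commuting_fixes_orbital_end K C a b e q) as (u & Hu & _ & Hfix); auto.
  apply (nofix_no B a b u); trivial. intros g Hg.
  apply Hfix; auto. intros x Hx Hfx.
  now apply (comm_fix_commute K C e g a b x); auto.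
Qed.

(** * Moving compact sets off themselves simultaneously *)

(* Given [g] for the first interval and [f] for the hulls of the other intervals and their images
   under [g], one of [g f] and [g f^-1] works: at least one of [f], [f^-1] does not push back
   the first interval. *)
Lemma move_off (M : (R -> R) -> Prop) (os : list (R * R)) : group M ->
  (forall o, In o os -> fixes M (fst o) /\ fixes M (snd o) /\ nofix M (fst o) (snd o)) ->
  forall s t : R * R -> R,
  (forall o, In o os -> fst o < s o /\ s o <= t o /\ t o < snd o) ->
  exists h, M h /\ forall o, In o os -> t o < h (s o) \/ h (t o) < s o.
Proof.
  intros HM. induction os as [|o os IH]; intros Hos s t Hst.
  { exists (fun x => x). split; [apply HM | intros o []]. }
  destruct (Hos o (or_introl eq_refl)) as (Ho1 & Ho2 & HN).
  destruct (Hst o (or_introl eq_refl)) as (Hs1 & Hs2 & Hs3).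
  destruct (cofinal_up M (fst o) (snd o) (s o) (t o)) as (g & Hg & Hgo); trivial; [lra |].
  assert (Hgp : PL g) by now apply HM.
  destruct (IH (fun o Ho => Hos o (or_intror Ho))
    (fun o => Rmin (s o) (g (s o))) (fun o => Rmax (t o) (g (t o)))) as (f & Hf & Hfo).
  { intros o' Ho'. destruct (Hos o' (or_intror Ho')) as (H1 & H2 & _).
    destruct (Hst o' (or_intror Ho')) as (T1 & T2 & T3).
    assert (fst o' < g (s o') < snd o') by (apply PL_between; auto; lra).
    assert (fst o' < g (t o') < snd o') by (apply PL_between; auto; lra).
    repeat split.
    - apply Rmin_glb_lt; lra.
    - apply Rle_trans with (s o'); [apply Rmin_l |].
      apply Rle_trans with (t o'); [lra | apply Rmax_l].
    - apply Rmax_lub_lt; lra. }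
  assert (Hfp : PL f) by now apply HM. assert (Hfi := PL_finv f Hfp).
  destruct (Rle_lt_dec (g (s o)) (f (g (s o)))) as [Hle | Hlt].
  - exists (rmul g f). split; [now apply HM |]. unfold rmul.
    intros o' [<- | Ho']; [left; lra |].
    assert (L1 := Rmin_l (s o') (g (s o'))). assert (L2 := Rmin_r (s o') (g (s o'))).
    assert (L3 := Rmax_l (t o') (g (t o'))). assert (L4 := Rmax_r (t o') (g (t o'))).
    specialize (Hfo o' Ho'). simpl in Hfo.
    apply (PL_le f) in L2, L4; trivial. destruct Hfo; [left | right]; lra.
  - exists (rmul g (finv f)). split; [apply HM; trivial; now apply HM |]. unfold rmul.
    intros o' [<- | Ho'].
    { left. apply Rlt_trans with (g (s o)); trivial.
      apply (PL_lt_rev f); trivial. now rewrite finv_r. }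
    assert (L1 := Rmin_l (s o') (g (s o'))). assert (L2 := Rmin_r (s o') (g (s o'))).
    assert (L3 := Rmax_l (t o') (g (t o'))). assert (L4 := Rmax_r (t o') (g (t o'))).
    specialize (Hfo o' Ho'). simpl in Hfo.
    apply (PL_le (finv f)) in L2, L4; trivial.
    destruct Hfo as [H | H]; apply (PL_incr (finv f)) in H; trivial;
      rewrite finv_l in H by trivial; [right | left]; lra.
Qed.

(** * Orbitals on which the derived group has a fixed point *)

Definition orbital_of (K : (R -> R) -> Prop) (a b : R) : Prop :=
  a < b /\ fixes K a /\ fixes K b /\ nofix K a b.

(** The fixed point [p] is part of the data: it is the origin of the blocks between [p] and its
    images under the powers of the controller. *)
Record typeII (K : (R -> R) -> Prop) (a b p : R) : Prop := {
  t_group : group K;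
  t_orb : orbital_of K a b;
  t_p : a < p < b;
  t_fix : fixes (der K) p }.

Definition Phi (K : (R -> R) -> Prop) (a b x : R) : Prop := a < x < b /\ fixes (der K) x.

Definition Stab (K : (R -> R) -> Prop) (p : R) (g : R -> R) : Prop := K g /\ g p = p.

Lemma group_Stab K p : group K -> group (Stab K p).
Proof.
  intros HK. split.
  - intros g [Hg _]. now apply HK.
  - split; [apply HK | trivial].
  - intros g h [Hg Gp] [Hh Hp]. split; [now apply HK |]. unfold rmul. now rewrite Gp.
  - intros g [Hg Gp]. split; [now apply HK | apply fix_finv; trivial; now apply HK].
Qed.

Lemma Phi_inv K a b p g x : typeII K a b p -> K g -> Phi K a b x -> Phi K a b (g x).
Proof.
  intros [HK (Hab & Ha & Hb & HN) Hp Hf] Hg [Hx Hfx]. split.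
  - apply PL_between; auto. now apply HK.
  - apply (normed_fix (der K) K); trivial. apply normed_der; trivial. now apply normed_self.
Qed.

Lemma Phi_pw K a b p g n x : typeII K a b p -> K g -> Phi K a b x -> Phi K a b (pw g n x).
Proof.
  intros HT Hg. apply (Phi_inv K a b p); trivial. apply pw_K; trivial. apply HT.
Qed.

Lemma Phi_comm K a b p g h x : typeII K a b p -> K g -> K h -> Phi K a b x ->
  h (g x) = g (h x).
Proof.
  intros [HK (Hab & Ha & Hb & HN) Hp Hf] Hg Hh [Hx Hfx].
  apply (comm_fix_commute K (der K) g h a b); trivial.
  - apply normed_der; trivial. now apply normed_self.
  - now apply der_comm.
Qed.

Lemma Phi_p K a b p : typeII K a b p -> Phi K a b p.
Proof. intros HT. split; apply HT. Qed.

Lemma Phi_lub K a b p E s : typeII K a b p -> a < s < b -> (forall x, E x -> Phi K a b x) ->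
  is_lub E s -> Phi K a b s.
Proof.
  intros HT Hs HE Hlub. split; trivial. intros g Hg.
  apply (lub_fixed_pts g E); trivial.
  - now apply (g_pl (der K)); [apply group_der, HT |].
  - intros y Hy. now apply HE.
Qed.

Lemma Phi_glb K a b p E s : typeII K a b p -> a < s < b -> (forall x, E x -> Phi K a b x) ->
  is_glb E s -> Phi K a b s.
Proof.
  intros HT Hs HE Hglb. split; trivial. intros g Hg.
  apply (glb_fixed_pts g E); trivial.
  - now apply (g_pl (der K)); [apply group_der, HT |].
  - intros y Hy. now apply HE.
Qed.

Lemma Phi_up K a b p y : typeII K a b p -> y < b -> exists x, Phi K a b x /\ y < x.
Proof.
  intros HT Hy. destruct (t_orb _ _ _ _ HT) as (Hab & Ha & Hb & HN).
  destruct (cofinal_up K a b p y) as (g & Hg & Hlt); trivial; [apply HT.. |].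
  exists (g p). split; trivial. apply (Phi_inv K a b p); trivial. now apply Phi_p.
Qed.

Lemma Phi_down K a b p y : typeII K a b p -> a < y -> exists x, Phi K a b x /\ x < y.
Proof.
  intros HT Hy. destruct (t_orb _ _ _ _ HT) as (Hab & Ha & Hb & HN).
  destruct (cofinal_down K a b p y) as (g & Hg & Hlt); trivial; [apply HT.. |].
  exists (g p). split; trivial. apply (Phi_inv K a b p); trivial. now apply Phi_p.
Qed.

Lemma Phi_below K a b p y : typeII K a b p -> a < y < b ->
  exists s, Phi K a b s /\ s <= y /\ is_lub (fun x => Phi K a b x /\ x <= y) s.
Proof.
  intros HT Hy. destruct (Phi_down K a b p y) as (x0 & Hx0 & Hlt); trivial; [lra |].
  destruct (lub_ex (fun x => Phi K a b x /\ x <= y) y x0) as [s Hs]; [split; trivial; lra | tauto |].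
  assert (s <= y) by (apply Hs; intros z [_ Hz]; trivial).
  assert (x0 <= s) by (apply Hs; split; trivial; lra).
  assert (HP : Phi K a b s).
  { destruct Hx0 as [Hx0 _]. apply (Phi_lub K a b p (fun x => Phi K a b x /\ x <= y)); trivial; [lra | tauto]. }
  now exists s.
Qed.

Lemma Phi_above K a b p y : typeII K a b p -> a < y < b ->
  exists s, Phi K a b s /\ y <= s /\ is_glb (fun x => Phi K a b x /\ y <= x) s.
Proof.
  intros HT Hy. destruct (Phi_up K a b p y) as (x0 & Hx0 & Hlt); trivial; [lra |].
  destruct (glb_ex (fun x => Phi K a b x /\ y <= x) y x0) as [s Hs]; [split; trivial; lra | tauto |].
  assert (y <= s) by (apply Hs; intros z [_ Hz]; trivial).
  assert (s <= x0) by (apply Hs; split; trivial; lra).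
  assert (HP : Phi K a b s).
  { destruct Hx0 as [Hx0 _]. apply (Phi_glb K a b p (fun x => Phi K a b x /\ y <= x)); trivial; [lra | tauto]. }
  now exists s.
Qed.

(* [g] fixes the [K]-orbit of [x0], which accumulates at both ends, so its germs there are trivial;
   conjugating any point of [Phi] close to [a] then shows that it is fixed as well. *)
Lemma Phi_fix_cs K a b p g x0 : typeII K a b p -> K g -> Phi K a b x0 -> g x0 = x0 ->
  cs g a b /\ forall x, Phi K a b x -> g x = x.
Proof.
  intros HT Hg Hx0 Hgx0. assert (HK := t_group _ _ _ _ HT). assert (Hpg : PL g) by now apply HK.
  destruct (t_orb _ _ _ _ HT) as (Hab & Ha & Hb & HN).
  assert (Horb : forall h, K h -> g (h x0) = h x0).
  { intros h Hh. rewrite (Phi_comm K a b p h g x0) by trivial. now rewrite Hgx0. }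
  assert (Hcs : cs g a b).
  { destruct (PL_right g Hpg a) as (e & k & He & Hk & Haff).
    destruct (PL_left g Hpg b) as (e' & k' & He' & Hk' & Haff').
    destruct (cofinal_down K a b x0 (a + e)) as (h & Hh & Hhx); trivial; [apply Hx0 | lra |].
    destruct (cofinal_up K a b x0 (b - e')) as (h' & Hh' & Hhx'); trivial; [apply Hx0 | lra |].
    assert (a < h x0 < b) by (apply PL_between; auto; [now apply HK | apply Hx0]).
    assert (a < h' x0 < b) by (apply PL_between; auto; [now apply HK | apply Hx0]).
    apply (cs_intro _ a b (a + e) (b - e')); trivial; try lra; intros x Hx.
    - apply (affine_two_fix g a (a + e) (g a) k a a (h x0)); auto; lra.
    - apply (affine_two_fix g (b - e') b (g b) k' b (h' x0) b); auto; lra. }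
  split; trivial. intros x Hx. destruct Hcs as (s & t & Hs & _ & _ & Hcs).
  destruct (cofinal_down K a b x s) as (h & Hh & Hhx); trivial; [apply Hx |].
  assert (a < h x < b) by (apply PL_between; auto; [now apply HK | apply Hx]).
  apply (PL_inj h); [now apply HK |].
  rewrite (Phi_comm K a b p g h x) by trivial. apply Hcs; lra.
Qed.

(** The largest point of [Phi] not above [y] is fixed as well, because [g] preserves the set of
    points of [Phi] below its fixed point [y]. *)
Lemma fix_Phi K a b p g y : typeII K a b p -> K g -> a < y < b -> g y = y ->
  cs g a b /\ forall x, Phi K a b x -> g x = x.
Proof.
  intros HT Hg Hy Hgy. assert (HK := t_group _ _ _ _ HT). assert (Hpg : PL g) by now apply HK.
  destruct (Phi_below K a b p y) as (s & Hs & Hsy & Hlub); trivial.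
  apply (Phi_fix_cs K a b p g s); trivial.
  apply (lub_fixed g (fun x => Phi K a b x /\ x <= y)); trivial; intros z [Hz Hzy]; split.
  - now apply (Phi_inv K a b p).
  - rewrite <- Hgy. now apply PL_le.
  - apply (Phi_inv K a b p); trivial. now apply HK.
  - apply (PL_le_rev g); trivial. rewrite finv_r by trivial. lra.
Qed.

Lemma Stab_cs K a b p g : typeII K a b p -> Stab K p g -> cs g a b.
Proof. intros HT [Hg Hgp]. apply (fix_Phi K a b p g p); trivial. apply HT. Qed.

Lemma Stab_Phi K a b p g x : typeII K a b p -> Stab K p g -> Phi K a b x -> g x = x.
Proof. intros HT [Hg Hgp]. apply (fix_Phi K a b p g p); trivial. apply HT. Qed.

Lemma der_Stab K a b p g : typeII K a b p -> der K g -> Stab K p g.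
Proof.
  intros HT Hg. split; [| now apply (t_fix _ _ _ _ HT)].
  apply der_sub; trivial. apply HT.
Qed.

(** Together with [Stab_cs] and [Stab_Phi] this is a dichotomy: an element either has compact
    support and fixes [Phi] pointwise, or has no fixed point in the orbital. *)
Lemma moved_free K a b p g : typeII K a b p -> K g -> g p <> p -> free_on g a b.
Proof.
  intros HT Hg Hgp. destruct (t_orb _ _ _ _ HT) as (Hab & Ha & Hb & HN).
  assert (HK := t_group _ _ _ _ HT).
  split; [now apply HK | split; [now apply Ha | split; [now apply Hb |]]].
  intros x Hx Hgx. apply Hgp. apply (fix_Phi K a b p g x); trivial. now apply Phi_p.
Qed.

(** * Slopes at the left end, and the controller *)

(** The slope at [a] is multiplicative, and it is above, below or equal to 1 according to whether
    [g p] is above, below or equal to [p]. Hence it embeds [K] modulo the stabiliser of [p] into the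
    positive reals. *)
Definition slope (g : R -> R) (a k : R) : Prop :=
  0 < k /\ exists e, 0 < e /\ forall x, a <= x <= a + e -> g x = a + k * (x - a).

Lemma slope_ex g a : PL g -> g a = a -> exists k, slope g a k.
Proof.
  intros Hg Ha. destruct (PL_right g Hg a) as (e & k & He & Hk & H).
  rewrite Ha in H. exists k. split; eauto.
Qed.

Lemma slope_mul g h a k l : slope g a k -> slope h a l -> slope (rmul g h) a (l * k).
Proof.
  intros (Hk & e1 & He1 & H1) (Hl & e2 & He2 & H2). split; [now apply Rmult_lt_0_compat |].
  assert (Hdiv : 0 < e2 / k) by now apply Rdiv_lt_0_compat.
  exists (Rmin e1 (e2 / k)). split; [now apply Rmin_pos |].
  intros x Hx. assert (L1 := Rmin_l e1 (e2 / k)). assert (L2 := Rmin_r e1 (e2 / k)).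
  unfold rmul. rewrite (H1 x) by lra. rewrite H2; [ring |].
  assert (0 <= k * (x - a)) by (apply Rmult_le_pos; lra).
  assert (k * (x - a) <= k * (e2 / k)) by (apply Rmult_le_compat_l; lra).
  replace (k * (e2 / k)) with e2 in * by (field; lra). lra.
Qed.

Lemma slope_finv g a k : PL g -> slope g a k -> slope (finv g) a (/ k).
Proof.
  intros Hg (Hk & e & He & H). assert (Hk' := Rinv_0_lt_compat k Hk). split; trivial.
  exists (k * e). split; [now apply Rmult_lt_0_compat |].
  intros x Hx. apply (PL_inj g); trivial. rewrite finv_r by trivial.
  assert (0 <= / k * (x - a)) by (apply Rmult_le_pos; lra).
  assert (/ k * (x - a) <= / k * (k * e)) by (apply Rmult_le_compat_l; lra).
  replace (/ k * (k * e)) with e in * by (field; lra).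
  rewrite H by lra. field; lra.
Qed.

Lemma slope_near g a b k : a < b -> slope g a k -> exists x, a < x < b /\ g x = a + k * (x - a).
Proof.
  intros Hab (_ & e & He & H). assert (L1 := Rmin_l e ((b - a) / 2)). assert (L2 := Rmin_r e ((b - a) / 2)).
  assert (0 < Rmin e ((b - a) / 2)) by (apply Rmin_glb_lt; lra).
  exists (a + Rmin e ((b - a) / 2)). split; [lra |]. apply H. lra.
Qed.

Lemma slope_gt K a b p g k : typeII K a b p -> K g -> slope g a k -> p < g p -> 1 < k.
Proof.
  intros HT Hg Hk Hgp. assert (Hab : a < b) by apply HT.
  assert (Hfree := moved_free K a b p g HT Hg ltac:(lra)).
  destruct (slope_near g a b k Hab Hk) as (x & Hx & Hgx).
  assert (x < g x) by (apply (free_up g a b p); trivial; apply HT).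
  apply Rmult_lt_reg_r with (x - a); lra.
Qed.

Lemma slope_lt K a b p g k : typeII K a b p -> K g -> slope g a k -> g p < p -> k < 1.
Proof.
  intros HT Hg Hk Hgp. assert (Hab : a < b) by apply HT. assert (Hp := t_p _ _ _ _ HT).
  assert (Hfree := moved_free K a b p g HT Hg ltac:(lra)).
  destruct (slope_near g a b k Hab Hk) as (x & Hx & Hgx).
  assert (g x < x).
  { destruct (Rtotal_order x (g x)) as [H | [H | H]]; trivial; exfalso.
    - assert (p < g p) by now apply (free_up g a b x). lra.
    - now apply (proj2 (proj2 (proj2 Hfree)) x Hx). }
  apply Rmult_lt_reg_r with (x - a); lra.
Qed.

Lemma slope_eq K a b p g k : typeII K a b p -> K g -> slope g a k -> g p = p -> k = 1.
Proof.
  intros HT Hg Hk Hgp. assert (Hab : a < b) by apply HT.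
  destruct (Stab_cs K a b p g HT (conj Hg Hgp)) as (s & t & Hs & Hst & Ht & Hcs).
  destruct (slope_near g a s k Hs Hk) as (x & Hx & Hgx).
  rewrite Hcs in Hgx by lra.
  apply Rmult_eq_reg_r with (x - a); lra.
Qed.

Lemma slope_gt_rev K a b p g k : typeII K a b p -> K g -> slope g a k -> 1 < k -> p < g p.
Proof.
  intros HT Hg Hk H. destruct (Rtotal_order p (g p)) as [E | [E | E]]; trivial; exfalso.
  - symmetry in E. apply (slope_eq K a b p g k) in E; auto; lra.
  - apply (slope_lt K a b p g k) in E; auto; lra.
Qed.

(* Near [a] the powers of [d] act as homotheties, so they bring a gap [(p0, q0)] of [Phi]
   into the affine range of any [g] without changing its ratio [r]; a slope in [(1, r)]
   would put an image of an end of the gap inside it. *)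
Lemma slope_discrete K a b p p0 q0 : typeII K a b p -> Phi K a b p0 -> Phi K a b q0 -> p0 < q0 ->
  (forall x, p0 < x < q0 -> ~ Phi K a b x) ->
  exists r, 1 < r /\ forall g k, K g -> slope g a k -> 1 < k -> r <= k.
Proof.
  intros HT Hp0 Hq0 Hlt Hgap. assert (HK := t_group _ _ _ _ HT). assert (Hp := t_p _ _ _ _ HT).
  destruct (t_orb _ _ _ _ HT) as (Hab & Ha & Hb & HN).
  destruct (cofinal_up K a b p p) as (c & Hc & Hcp); trivial; [lra |].
  assert (Hpc : PL c) by now apply HK.
  assert (Hfree := moved_free K a b p c HT Hc ltac:(lra)).
  assert (Hup : forall x, a < x < b -> x < c x) by (intros x Hx; now apply (free_up c a b p)).
  set (d := finv c). assert (Hd : PL d) by now apply PL_finv.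
  destruct (slope_ex d a) as (l & Hl & e & He & Hdaff); trivial; [apply fix_finv; auto |].
  assert (Hpd : forall n x, Nat.iter n d x = pw c (- Z.of_nat n) x).
  { intros n x. induction n as [|n IH]; [reflexivity |].
    replace (- Z.of_nat (S n))%Z with (Z.pred (- Z.of_nat n)) by lia.
    rewrite pw_pred by trivial. simpl. now rewrite IH. }
  assert (Hq0' : a < q0 < b) by apply Hq0. assert (Hp0' : a < p0 < b) by apply Hp0.
  destruct (escape_down c a b q0 (a + e)) as (N & HN0 & HNd); trivial; [auto | lra |].
  assert (Hgap' : forall n x, pw c n p0 < x < pw c n q0 -> ~ Phi K a b x).
  { intros n x Hx HP. apply (Hgap (pw c (- n) x)).
    - split; apply (PL_lt_rev (pw c n)); try (now apply PL_pw);
        rewrite (pw_cancel c n (- n) x) by (trivial; lia); lra.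
    - now apply (Phi_pw K a b p). }
  set (p1 := pw c (- N) p0). set (q1 := pw c (- N) q0).
  assert (Hpq1 : p1 < q1) by (apply PL_incr; trivial; now apply PL_pw).
  assert (Hp1 : a < p1 < b) by now apply free_pw.
  assert (Hq1 : a < q1 < b) by now apply free_pw.
  assert (Hq1e : q1 < a + e) by (apply HNd; lia).
  assert (Hpow : forall n x, a <= x <= q1 -> Nat.iter n d x = a + l ^ n * (x - a) /\
    a <= Nat.iter n d x <= q1).
  { intros n x Hx. induction n as [|n [IH1 IH2]]; [simpl; lra |].
    change (Nat.iter (S n) d x) with (d (Nat.iter n d x)). split.
    - rewrite Hdaff by lra. rewrite IH1. simpl. ring.
    - assert (Hda : d a = a) by (apply fix_finv; auto).
      split; [rewrite <- Hda at 1; apply PL_le; trivial; lra |].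
      apply (PL_le_rev c); trivial. rewrite (finv_r c : forall y, PL c -> c (d y) = y) by trivial.
      specialize (Hup q1 Hq1). lra. }
  exists ((q1 - a) / (p1 - a)). split.
  { apply Rmult_lt_reg_r with (p1 - a); [lra |].
    replace ((q1 - a) / (p1 - a) * (p1 - a)) with (q1 - a) by (field; lra). lra. }
  intros g k Hg (Hk0 & e' & He' & Hgaff) Hk.
  destruct (Rle_lt_dec ((q1 - a) / (p1 - a)) k) as [|Hbad]; trivial. exfalso.
  destruct (escape_down c a b q1 (a + e')) as (M & HM0 & HMd); trivial; [auto | lra |].
  set (m := Z.to_nat M).
  assert (Hm : (- Z.of_nat m)%Z = (- M)%Z) by (unfold m; lia).
  assert (Hqm : Nat.iter m d q1 < a + e') by (rewrite Hpd, Hm; apply HMd; lia).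
  destruct (Hpow m p1) as [P1 P2]; [lra |].
  destruct (Hpow m q1) as [Q1 Q2]; [lra |].
  assert (Hlm : 0 < l ^ m) by now apply pow_lt.
  assert (Hkpq : k * (p1 - a) < q1 - a).
  { apply Rmult_lt_compat_r with (r := p1 - a) in Hbad; [| lra].
    replace ((q1 - a) / (p1 - a) * (p1 - a)) with (q1 - a) in Hbad by (field; lra). trivial. }
  assert (Hlt1 : l ^ m * (p1 - a) < l ^ m * (q1 - a)) by (apply Rmult_lt_compat_l; lra).
  assert (Hlt2 : l ^ m * (k * (p1 - a)) < l ^ m * (q1 - a)) by (apply Rmult_lt_compat_l; lra).
  assert (Hlt3 : 0 < l ^ m * (p1 - a)) by (apply Rmult_lt_0_compat; lra).
  assert (Hlt4 : 1 * (l ^ m * (p1 - a)) < k * (l ^ m * (p1 - a))) by (apply Rmult_lt_compat_r; lra).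
  assert (Hpp : forall x, Nat.iter m d (pw c (- N) x) = pw c (- M - N) x).
  { intros x. rewrite Hpd, Hm, <- pw_add by trivial. f_equal. }
  apply (Hgap' (- M - N)%Z (g (Nat.iter m d p1))).
  - unfold p1, q1 in *. rewrite <- !Hpp. rewrite Hgaff by lra. rewrite P1, Q1. lra.
  - apply (Phi_inv K a b p); trivial. unfold p1. rewrite Hpp. now apply (Phi_pw K a b p).
Qed.

(** The stabiliser fixes [Phi], so the moved point [y] lies in a gap of [Phi]. The gap makes the
    group of slopes discrete, hence cyclic. *)
Lemma controller K a b p s y : typeII K a b p -> Stab K p s -> a < y < b -> s y <> y ->
  exists c, K c /\ p < c p /\ forall g, K g -> exists n, g p = pw c n p.
Proof.
  intros HT Hs Hy Hsy. assert (HK := t_group _ _ _ _ HT). assert (Hp := t_p _ _ _ _ HT).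
  destruct (t_orb _ _ _ _ HT) as (Hab & Ha & Hb & HN).
  destruct (Phi_below K a b p y) as (p0 & Hp0 & Hp0y & Hlub); trivial.
  destruct (Phi_above K a b p y) as (q0 & Hq0 & Hq0y & Hglb); trivial.
  assert (HyP : ~ Phi K a b y) by (intros HP; now apply Hsy, (Stab_Phi K a b p)).
  assert (p0 <> y) by (intros ->; tauto). assert (q0 <> y) by (intros ->; tauto).
  destruct (slope_discrete K a b p p0 q0) as (r & Hr & Hdisc); trivial; [lra | |].
  { intros x Hx HP. destruct (Rle_lt_dec x y) as [H' | H'].
    - assert (x <= p0) by (apply Hlub; split; trivial). lra.
    - assert (q0 <= x) by (apply Hglb; split; trivial; lra). lra. }
  destruct (cofinal_up K a b p p) as (c0 & Hc0 & Hcp0); trivial; [lra |].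
  set (E := fun k => 1 < k /\ exists g, K g /\ slope g a k).
  assert (HE : exists k, E k).
  { destruct (slope_ex c0 a) as (k & Hk); [now apply HK | auto |].
    exists k. split; [now apply (slope_gt K a b p c0) | eauto]. }
  destruct HE as [k0 Hk0].
  assert (HEr : forall k, E k -> r <= k) by (intros k (H1 & g & Hg & Hk); eauto).
  destruct (glb_ex E r k0) as [L [HL1 HL2]]; trivial.
  assert (r <= L) by auto.
  (* The infimum [L] need not be attained yet; a slope within the factor [r] of it will do. *)
  assert (exists k, E k /\ k < L * r) as (k & (Hk1 & c & Hc & Hk) & HkL).
  { apply NNPP. intros Hno. assert (L * r <= L).
    { apply HL2. intros k Hk. destruct (Rle_lt_dec (L * r) k); trivial. exfalso; eauto. }
    assert (L * 1 < L * r) by (apply Rmult_lt_compat_l; lra). lra. }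
  assert (Hpc : PL c) by now apply HK.
  assert (Hcp : p < c p) by now apply (slope_gt_rev K a b p c k).
  exists c. split; [trivial | split; [trivial |]]. intros g Hg.
  assert (Hfree := moved_free K a b p c HT Hc ltac:(lra)).
  destruct (pw_floor c a b p (g p)) as (n & Hn1 & Hn2); trivial.
  { apply PL_between; auto. now apply HK. }
  (* [h] is the remainder of [g] on division by [c]: it carries [p] into the first block, and it has
     to fix [p]. *)
  exists n. set (h := rmul g (pw c (- n))).
  assert (Hh : K h) by (apply HK; trivial; now apply pw_K).
  assert (Hhp : h p = pw c (- n) (g p)) by reflexivity.
  assert (Hpn : PL (pw c (- n))) by now apply PL_pw.
  assert (J1 : p <= h p).
  { apply (PL_le (pw c (- n))) in Hn1; trivial. rewrite pw_cancel in Hn1 by (trivial; lia). lra. }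
  assert (J2 : h p < c p).
  { apply (PL_incr (pw c (- n))) in Hn2; trivial. rewrite <- pw_add in Hn2 by trivial.
    replace (- n + (n + 1))%Z with 1%Z in Hn2 by lia. rewrite pw_1 in Hn2 by trivial. lra. }
  assert (J3 : h p = p).
  { destruct J1 as [J1 | ]; [| lra]. exfalso. assert (Hph : PL h) by now apply HK.
    destruct (slope_ex h a) as (k1 & Hk1'); auto.
    assert (1 < k1) by now apply (slope_gt K a b p h).
    assert (L <= k1) by (apply HL1; split; eauto).
    (* If [h] moved [p] up, both [h] and this quotient would have slopes above 1, namely at least
       [L] and at least [r], so that the slope of [c] would be at least [L * r]. *)
    set (f := rmul (finv h) c).
    assert (Hf : K f) by (apply HK; trivial; now apply HK).
    assert (Hfk : slope f a (k * / k1)) by (apply slope_mul; trivial; now apply slope_finv).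
    assert (Hfp : p < f p).
    { unfold f, rmul. rewrite <- (finv_r h p) at 1 by trivial.
      assert (Hq : a < finv h p < b) by (apply PL_between; trivial; [now apply PL_finv | |]; apply fix_finv; auto).
      apply (PL_lt_rev (finv c)); [now apply PL_finv |].
      rewrite finv_l by trivial. rewrite finv_r by trivial.
      rewrite <- (finv_l h (finv c p)) by trivial. apply PL_incr; [now apply PL_finv |].
      set (z := finv c p). assert (Hcz : c z = p) by now apply finv_r.
      assert (HPz : Phi K a b z).
      { apply (Phi_inv K a b p); [trivial | now apply HK | now apply Phi_p]. }
      apply (PL_lt_rev c); trivial. rewrite <- (Phi_comm K a b p c h z) by trivial.
      now rewrite Hcz. }
    assert (J5 := slope_gt K a b p f _ HT Hf Hfk Hfp).
    assert (J6 := Hdisc f _ Hf Hfk J5).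
    assert (J7 : r * k1 <= k).
    { apply Rmult_le_compat_r with (r := k1) in J6; [| lra].
      replace (k * / k1 * k1) with k in J6 by (field; lra). trivial. }
    assert (L * r <= r * k1) by (rewrite Rmult_comm; apply Rmult_le_compat_l; lra). lra. }
  rewrite <- J3 at 2. rewrite Hhp. rewrite pw_cancel; trivial; lia.
Qed.

(** * Finite generation of the stabiliser over the controller *)

Definition fgen (l : list (R -> R)) : (R -> R) -> Prop := subgroup_gen (fun g => In g l).

Definition conjugates (fs : list (R -> R)) (c : R -> R) : (R -> R) -> Prop :=
  fun g => exists f k, In f fs /\ g = conjg f (pw c k).

Lemma conjg_pw f c k n : PL c -> conjg (conjg f (pw c k)) (pw c n) = conjg f (pw c (k + n)).
Proof.
  intros Hc. extensionality x. unfold conjg. rewrite !finv_pw by trivial.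
  rewrite <- (pw_add c n k), <- (pw_add c (- k) (- n)) by trivial.
  now replace (- (k + n))%Z with (- k + - n)%Z by lia; rewrite (Z.add_comm n k).
Qed.

Lemma normed_conjugates fs c : PL c -> (forall f, In f fs -> PL f) ->
  normed (subgroup_gen (conjugates fs c)) (cyc c).
Proof.
  intros Hc Hfs. apply normed_gen.
  - now apply group_cyc.
  - intros g (f & k & Hf & ->). apply PL_conjg; auto. now apply PL_pw.
  - intros g h (f & k & Hf & ->) [n ->]. apply sg_gen. exists f, (k + n)%Z.
    split; trivial. now apply conjg_pw.
Qed.

Lemma normed_Stab K a b p : typeII K a b p -> normed (Stab K p) K.
Proof.
  intros HT g h Hg Hh. assert (HK := t_group _ _ _ _ HT). split.
  - apply group_conjg; trivial. apply Hg.
  - assert (HP : Phi K a b (finv h p)).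
    { apply (Phi_inv K a b p); trivial; [now apply HK | now apply Phi_p]. }
    unfold conjg. rewrite (Stab_Phi K a b p g) by trivial.
    apply finv_r. now apply HK.
Qed.

(** Each generator is an element of the stabiliser times a power of [c]; the conjugates of these
    finitely many elements under the powers of [c] generate the stabiliser. *)
Lemma controller_gen l a b p s y :
  typeII (fgen l) a b p -> Stab (fgen l) p s -> a < y < b -> s y <> y ->
  exists c fs, fgen l c /\ p < c p /\ (forall f, In f fs -> Stab (fgen l) p f) /\
    forall g, Stab (fgen l) p g -> subgroup_gen (conjugates fs c) g.
Proof.
  intros HT Hs Hy Hsy. set (K := fgen l) in *. assert (HK := t_group _ _ _ _ HT).
  destruct (controller K a b p s y) as (c & Hc & Hcp & Hctl); trivial.
  assert (Hpc : PL c) by now apply HK.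
  assert (Hdec : forall l', (forall x, In x l' -> K x) -> exists fs,
    (forall f, In f fs -> Stab K p f) /\
    forall x, In x l' -> exists f n, In f fs /\ x = rmul f (pw c n)).
  { induction l' as [|x l' IH]; intros Hl'.
    - exists nil. split; intros ? [].
    - destruct IH as (fs & H1 & H2); [intros; apply Hl'; now right |].
      assert (Hx : K x) by (apply Hl'; now left).
      destruct (Hctl x Hx) as [n Hn].
      exists (rmul x (pw c (- n)) :: fs). split.
      + intros f [<- | Hf]; [| auto]. split.
        * apply HK; trivial. now apply pw_K.
        * unfold rmul. rewrite Hn. apply pw_cancel; trivial; lia.
      + intros x' [<- | Hx'].
        * exists (rmul x (pw c (- n))), n. split; [now left |].
          extensionality z. unfold rmul. rewrite pw_cancel; trivial; lia.
        * destruct (H2 x' Hx') as (f & m & Hf & E). exists f, m. split; [now right | trivial]. }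
  destruct (Hdec l) as (fs & Hfs & Hl); [intros x Hx; now apply sg_gen |].
  assert (Hfp : forall f, In f fs -> PL f) by (intros f Hf; apply HK; now apply Hfs).
  set (F := subgroup_gen (conjugates fs c)).
  assert (HF : group F).
  { apply group_gen. intros g (f & k & Hf & ->). apply PL_conjg; auto. now apply PL_pw. }
  assert (HFN : normed F (cyc c)) by now apply normed_conjugates.
  assert (HFS : forall w, F w -> Stab K p w).
  { intros w. apply gen_incl; [now apply group_Stab |].
    intros g (f & k & Hf & ->). apply (normed_Stab K a b p HT); auto. now apply pw_K. }
  exists c, fs. split; [trivial | split; [trivial | split; [trivial |]]].
  (* Normal form: [F] is normalised by [c], so products of an element of [F] and a power of [c] are
     closed under multiplication and inversion. *)
  assert (Hall : forall g, K g -> PL g /\ exists w n, F w /\ g = rmul w (pw c n)).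
  { intros g Hg. split; [now apply HK |].
    induction Hg as [g Hg | | g h Hg IH1 Hh IH2 | g g' Hg IH E1 E2].
    - destruct (Hl g Hg) as (f & n & Hf & ->). exists f, n. split; trivial.
      apply sg_gen. exists f, 0%Z. split; trivial.
      extensionality x. unfold conjg. now rewrite finv_pw.
    - exists (fun x => x), 0%Z. split; [apply HF | reflexivity].
    - destruct IH1 as (w & n & Hw & ->), IH2 as (w' & m & Hw' & ->).
      exists (rmul w (conjg w' (pw c (- n)))), (m + n)%Z. split.
      + apply HF; trivial. apply HFN; trivial. now eexists.
      + extensionality x. unfold rmul, conjg. rewrite finv_pw, Z.opp_involutive by trivial.
        rewrite pw_add by trivial. rewrite (pw_cancel c n (- n)); trivial; lia.
    - destruct IH as (w & n & Hw & ->). assert (Hwp : PL w) by now apply HF.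
      exists (conjg (finv w) (pw c n)), (- n)%Z. split.
      + apply HFN; [now apply HF | now eexists].
      + extensionality x. unfold rmul, conjg.
        rewrite (pw_cancel c (- n) n) by (trivial; lia).
        apply (PL_inj (rmul w (pw c n))); [apply PL_mul; trivial; now apply PL_pw |].
        rewrite E1. unfold rmul. now rewrite !finv_r by (trivial; now apply PL_pw). }
  intros g [Hg Hgp]. destruct (Hall g Hg) as (_ & w & n & Hw & ->).
  assert (Hfree := moved_free K a b p c HT Hc ltac:(lra)).
  unfold rmul in Hgp. rewrite (proj2 (HFS w Hw)) in Hgp.
  (* [g] and the factor from [F] fix [p], whereas nonzero powers of [c] move it. *)
  assert (n = 0%Z) as ->.
  { destruct (Z.lt_total n 0) as [H | [H | H]]; trivial; exfalso;
      apply (pw_incr c a b _ _ p) in H; trivial; try apply HT; rewrite pw_0 in H; lra. }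
  exact Hw.
Qed.

Lemma supp_bound c a b p fs : free_on c a b -> a < p < b -> p < c p ->
  (forall f, In f fs -> cs f a b) ->
  exists L, (0 < L)%Z /\ forall f x, In f fs -> a < x < b ->
    x <= pw c (- L) p \/ pw c L p <= x -> f x = x.
Proof.
  intros Hfree Hp Hcp. induction fs as [|f fs IH]; intros Hfs.
  { exists 1%Z. split; [lia | intros f x []]. }
  destruct IH as (L & HL & H); [intros; apply Hfs; now right |].
  destruct (Hfs f (or_introl eq_refl)) as (s & t & Hs & _ & Ht & Hf).
  destruct (escape_up c a b p t) as (N & HN0 & HN); trivial.
  destruct (escape_down c a b p s) as (M & HM0 & HM); trivial.
  exists (Z.max L (Z.max N M)). split; [lia |].
  assert (H1 : pw c (- Z.max L (Z.max N M)) p <= pw c (- L) p) by (apply (pw_incr_le c a b); trivial; lia).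
  assert (H2 : pw c L p <= pw c (Z.max L (Z.max N M)) p) by (apply (pw_incr_le c a b); trivial; lia).
  specialize (HN (Z.max L (Z.max N M)) ltac:(lia)).
  specialize (HM (- Z.max L (Z.max N M))%Z ltac:(lia)).
  intros g x [<- | Hg] Hx Hx'; [apply Hf | apply (H g x)]; trivial; lra.
Qed.

Lemma supp_conjg c a b p L f k x : free_on c a b ->
  (forall x, a < x < b -> x <= pw c (- L) p \/ pw c L p <= x -> f x = x) ->
  a < x < b -> x <= pw c (k - L) p \/ pw c (k + L) p <= x -> conjg f (pw c k) x = x.
Proof.
  intros Hfree Hf Hx Hx'. assert (Hc := proj1 Hfree).
  assert (Hk : PL (pw c (- k))) by now apply PL_pw.
  unfold conjg. rewrite finv_pw by trivial. rewrite Hf.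
  - apply pw_cancel; trivial; lia.
  - now apply free_pw.
  - destruct Hx' as [H | H]; apply (PL_le (pw c (- k))) in H; trivial;
      rewrite <- pw_add in H by trivial; [left | right].
    + now replace (- k + (k - L))%Z with (- L)%Z in H by lia.
    + now replace (- k + (k + L))%Z with L in H by lia.
Qed.

(** * Towers through a point *)

Definition bump (g : R -> R) (u v x : R) : Prop :=
  g u = u /\ g v = v /\ (forall y, u < y < v -> g y <> y) /\ u < x < v.

(* A finite chain of orbitals is a family of distinct orbitals through a common point, and
   comparability is not needed beyond that. *)
Definition tower (A : (R -> R) -> Prop) (n : nat) (x : R) : Prop :=
  exists (g : nat -> R -> R) (u v : nat -> R),
    (forall i, (i < n)%nat -> A (g i) /\ bump (g i) (u i) (v i) x) /\
    forall i j, (i < n)%nat -> (j < n)%nat -> i <> j -> u i <> u j \/ v i <> v j.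

Definition tall (A : (R -> R) -> Prop) : Prop := forall n, exists x, tower A n x.

Lemma bump_in g u v x y : bump g u v x -> g y = y -> (x <= y -> v <= y) /\ (y <= x -> y <= u).
Proof.
  intros (_ & _ & H & Hx) Hy. split; intros Hxy.
  - destruct (Rle_lt_dec v y); trivial. exfalso. apply (H y); trivial. lra.
  - destruct (Rle_lt_dec y u); trivial. exfalso. apply (H y); trivial. lra.
Qed.

Lemma bump_conjg g u v x h : PL h -> bump g u v x -> bump (conjg g h) (h u) (h v) (h x).
Proof.
  intros Hh (Hu & Hv & H & Hx). unfold conjg. repeat split.
  - now rewrite finv_l, Hu.
  - now rewrite finv_l, Hv.
  - intros y Hy E. apply (H (finv h y)).
    + split; apply (PL_lt_rev h); trivial; rewrite finv_r; trivial; apply Hy.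
    + apply (PL_inj h); trivial. now rewrite E, finv_r.
  - apply PL_incr; trivial; lra.
  - apply PL_incr; trivial; lra.
Qed.

Lemma tower_drop A n x a b : tower A (S n) x ->
  exists (g : nat -> R -> R) (u v : nat -> R),
    (forall i, (i < n)%nat -> A (g i) /\ bump (g i) (u i) (v i) x /\ (u i <> a \/ v i <> b)) /\
    forall i j, (i < n)%nat -> (j < n)%nat -> i <> j -> u i <> u j \/ v i <> v j.
Proof.
  intros (g & u & v & H1 & H2).
  assert (Hs : exists s : nat -> nat, (forall i, (i < n)%nat -> (s i < S n)%nat) /\
    (forall i j, s i = s j -> i = j) /\
    forall i, (i < n)%nat -> u (s i) <> a \/ v (s i) <> b).
  { destruct (classic (exists i, (i < S n)%nat /\ u i = a /\ v i = b)) as [(i0 & Hi0 & Ua & Vb) | Hno].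
    (* The intervals are distinct, so at most one index has to be skipped. *)
    - exists (fun i => if (i <? i0)%nat then i else S i). repeat split.
      + intros i Hi. destruct (Nat.ltb_spec i i0); lia.
      + intros i j. destruct (Nat.ltb_spec i i0), (Nat.ltb_spec j i0); lia.
      + intros i Hi. rewrite <- Ua, <- Vb.
        apply H2; destruct (Nat.ltb_spec i i0); lia.
    - exists (fun i => i). repeat split; trivial; try lia.
      intros i Hi. destruct (classic (u i = a)) as [Ua|]; [| tauto].
      destruct (classic (v i = b)); [| tauto]. exfalso. apply Hno. exists i. split; [lia | tauto]. }
  destruct Hs as (s & Hs1 & Hs2 & Hs3).
  exists (fun i => g (s i)), (fun i => u (s i)), (fun i => v (s i)). split.
  - intros i Hi. destruct (H1 (s i) (Hs1 i Hi)) as [Hg Hbump].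
    split; [trivial | split; [trivial | auto]].
  - intros i j Hi Hj Hij. apply H2; auto.
Qed.

(** An orbital other than the whole interval has an end inside it, which its element fixes; by
    [fix_Phi] the element then fixes [p]. The whole interval costs one level. *)
Lemma tower_Stab K a b p n x : typeII K a b p -> a < x < b -> tower K (S n) x ->
  tower (Stab K p) n x.
Proof.
  intros HT Hx Ht. destruct (t_orb _ _ _ _ HT) as (Hab & Ha & Hb & HN).
  destruct (tower_drop K n x a b Ht) as (g & u & v & H1 & H2).
  exists g, u, v. split; trivial. intros i Hi.
  destruct (H1 i Hi) as (Hg & Hbump & Hne). split; trivial.
  assert (Hau : a <= u i) by (apply (bump_in (g i) _ (v i) x a); auto; lra).
  assert (Hvb : v i <= b) by (apply (bump_in (g i) (u i) _ x b); auto; lra).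
  assert (Hxi : u i < x < v i) by apply Hbump.
  split; trivial.
  destruct Hne as [Hne | Hne]; [apply (fix_Phi K a b p (g i) (u i)) | apply (fix_Phi K a b p (g i) (v i))];
    trivial; try lra; try apply Hbump; now apply Phi_p.
Qed.

Definition Zrange (L : Z) : list Z := map (fun i => (Z.of_nat i - L)%Z) (seq 0 (Z.to_nat (2 * L + 1))).

Lemma Zrange_in L k : (- L <= k <= L)%Z -> In k (Zrange L).
Proof.
  intros H. apply in_map_iff. exists (Z.to_nat (k + L)). split; [lia |].
  apply in_seq. lia.
Qed.

(* Up to translation by the controller [c] the tower lies in the block [[p, c p]], on which
   only finitely many of the conjugates [f^(c^k)] act; there [f^(c^k)] coincides with the
   inverse of its commutator with a large power of [c]. *)
Lemma tower_descend l a b p : typeII (fgen l) a b p ->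
  exists ls, (forall g, In g ls -> der (fgen l) g) /\
    forall n x, a < x < b -> tower (fgen l) (S n) x -> exists x', tower (fgen ls) n x'.
Proof.
  intros HT. set (K := fgen l) in *. assert (HK := t_group _ _ _ _ HT).
  assert (Hp := t_p _ _ _ _ HT).
  destruct (t_orb _ _ _ _ HT) as (Hab & Ha & Hb & HN).
  destruct (classic (exists s y, Stab K p s /\ a < y < b /\ s y <> y)) as [(s & y & Hs & Hy & Hsy) | Htriv].
  (* A stabiliser acting trivially carries no tower of positive height, so only [n = 0] remains. *)
  2: { exists nil. split; [intros g [] |].
    intros n x Hx Ht. apply (tower_Stab K a b p) in Ht; trivial.
    destruct n as [|n]; [exists x; exists (fun _ y => y), (fun _ => 0), (fun _ => 0); split; lia |].
    exfalso. destruct Ht as (g & u & v & H & _). destruct (H O ltac:(lia)) as (Hg & _ & _ & Hg' & Hxi).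
    apply Htriv. exists (g O), x. auto. }
  destruct (controller_gen l a b p s y) as (c & fs & Hc & Hcp & Hfs & Hgen); trivial.
  fold K in Hc, Hfs, Hgen.
  assert (Hfree := moved_free K a b p c HT Hc ltac:(lra)).
  assert (Hpc : PL c) by now apply HK.
  destruct (supp_bound c a b p fs) as (L & HL & Hsupp); trivial.
  { intros f Hf. apply (Stab_cs K a b p); auto. }
  (* Only the exponents above [- L] and up to [L] act on the block; adding [2 * L + 1] makes each of
     them exceed [L]. *)
  set (N := (2 * L + 1)%Z).
  set (ls := flat_map (fun f => map (fun k => comm (conjg f (pw c k)) (pw c N)) (Zrange L)) fs).
  assert (Hconj : forall f k, In f fs -> Stab K p (conjg f (pw c k))).
  { intros f k Hf. apply (normed_Stab K a b p HT); auto. now apply pw_K. }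
  assert (Hls : forall g, In g ls -> der K g).
  { intros g Hg. apply in_flat_map in Hg. destruct Hg as (f & Hf & Hg).
    apply in_map_iff in Hg. destruct Hg as (k & <- & Hk).
    apply der_comm; [now apply Hconj | now apply pw_K]. }
  assert (HGls : group (fgen ls)).
  { apply group_gen. intros g Hg. apply (g_pl (der K)); [now apply group_der | auto]. }
  exists ls. split; trivial.
  assert (Hcp' : a < c p < b) by (apply PL_between; auto).
  assert (HPcp : Phi K a b (c p)) by (apply (Phi_inv K a b p); trivial; now apply Phi_p).
  assert (Hblock : forall g x, Stab K p g -> p <= x <= c p -> p <= g x <= c p).
  { intros g x Hg Hx. apply PL_between_le; trivial.
    - apply HK, Hg.
    - apply Hg.
    - now apply (Stab_Phi K a b p). }
  (* Agreement on the block passes to products and inverses because the stabiliser fixes both ends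
     of the block. *)
  assert (Hagree : forall g, subgroup_gen (conjugates fs c) g -> Stab K p g /\
    exists k, fgen ls k /\ forall x, p <= x <= c p -> k x = g x).
  { intros g Hg. split.
    { revert Hg. apply gen_incl; [now apply group_Stab |]. intros h (f & k & Hf & ->). auto. }
    induction Hg as [g (f & k & Hf & ->) | | g h Hg IH1 Hh IH2 | g g' Hg IH E1 E2].
    - assert (Hsk : forall j x, p <= x <= c p -> (L + 1 <= j)%Z \/ (j <= - L)%Z -> conjg f (pw c j) x = x).
      { intros j x Hx Hj. apply (supp_conjg c a b p L); auto; [lra |].
        destruct Hj as [Hj | Hj]; [left | right].
        - apply Rle_trans with (pw c 1 p); [rewrite pw_1; trivial; lra |].
          apply (pw_incr_le c a b); trivial; lia.
        - apply Rle_trans with (pw c 0 p); [| rewrite pw_0; lra].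
          apply (pw_incr_le c a b); trivial; lia. }
      destruct (Z.le_gt_cases (L + 1) k) as [Hk | Hk].
      { exists (fun x => x). split; [apply HGls | intros x Hx; now rewrite Hsk; auto]. }
      destruct (Z.le_gt_cases k (- L)) as [Hk' | Hk'].
      { exists (fun x => x). split; [apply HGls | intros x Hx; now rewrite Hsk; auto]. }
      set (g := conjg f (pw c k)). assert (Hg : Stab K p g) by now apply Hconj.
      assert (Hpg : PL g) by apply HK, Hg.
      assert (HpN : PL (pw c N)) by now apply PL_pw.
      assert (Hpcm : PL (comm g (pw c N))) by now apply PL_comm.
      exists (finv (comm g (pw c N))). split.
      + apply HGls, sg_gen. apply in_flat_map. exists f. split; trivial.
        apply in_map_iff. exists k. split; trivial. apply Zrange_in. lia.
      + intros x Hx. apply (PL_inj (comm g (pw c N))); trivial. rewrite finv_r by trivial.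
        change (x = conjg g (pw c N) (finv g (g x))). rewrite finv_l by trivial.
        unfold g. rewrite conjg_pw by trivial. symmetry. apply Hsk; trivial. left. lia.
    - exists (fun x => x). split; [apply HGls | trivial].
    - destruct IH1 as (k1 & Hk1 & A1), IH2 as (k2 & Hk2 & A2).
      exists (rmul k1 k2). split; [now apply HGls |]. intros x Hx. unfold rmul.
      rewrite A1 by trivial. apply A2. apply Hblock; trivial.
      revert Hg. apply gen_incl; [now apply group_Stab |]. intros g' (f & k & Hf & ->). auto.
    - destruct IH as (k1 & Hk1 & A1). exists (finv k1). split; [now apply HGls |].
      intros x Hx. assert (Hpk : PL k1) by now apply HGls.
      assert (HSg : Stab K p g).
      { revert Hg. apply gen_incl; [now apply group_Stab |]. intros h (f & k & Hf & ->). auto. }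
      assert (Hpg : PL g) by apply HK, HSg.
      apply (PL_inj k1); trivial. rewrite finv_r by trivial. rewrite A1; [now rewrite E1 |].
      rewrite (finv_unique g g') by trivial. apply Hblock; trivial. now apply group_Stab. }
  intros n x Hx Ht. apply (tower_Stab K a b p) in Ht; trivial.
  destruct Ht as (g & u & v & H1 & H2).
  destruct (pw_floor c a b p x) as (m & Hm); trivial.
  set (h := pw c (- m)). assert (Hh : K h) by now apply pw_K.
  assert (Hph : PL h) by now apply HK.
  assert (Hhx : p <= h x <= c p).
  { unfold h. rewrite <- (pw_1 c p) by trivial.
    split; [apply (PL_le_rev (pw c m)); [now apply PL_pw |] | apply (PL_le_rev (pw c m)); [now apply PL_pw |]].
    - rewrite pw_cancel by (trivial; lia). lra.
    - rewrite pw_cancel by (trivial; lia). rewrite <- pw_add by trivial. lra. }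
  set (k := fun i => epsilon (inhabits (fun x : R => x))
    (fun k => fgen ls k /\ forall z, p <= z <= c p -> k z = conjg (g i) h z)).
  assert (Hk : forall i, (i < n)%nat -> fgen ls (k i) /\ forall z, p <= z <= c p -> k i z = conjg (g i) h z).
  { intros i Hi. unfold k. apply epsilon_spec. apply Hagree, Hgen.
    apply (normed_Stab K a b p HT); trivial. now apply H1. }
  exists (h x), k, (fun i => h (u i)), (fun i => h (v i)). split.
  - intros i Hi. destruct (Hk i Hi) as [Hk1 Hk2]. destruct (H1 i Hi) as [Hg Hbump].
    split; trivial.
    assert (Hg' : Stab K p (conjg (g i) h)) by (apply (normed_Stab K a b p HT); trivial).
    apply (bump_conjg _ _ _ _ h) in Hbump; trivial.
    assert (Hup : p <= h (u i)) by (apply (bump_in _ _ _ _ p Hbump); [apply Hg' | lra]).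
    assert (Hvp : h (v i) <= c p).
    { apply (bump_in _ _ _ _ (c p) Hbump); [now apply (Stab_Phi K a b p) | lra]. }
    destruct Hbump as (B1 & B2 & B3 & B4).
    repeat split; try apply B4.
    + rewrite Hk2 by lra. trivial.
    + rewrite Hk2 by lra. trivial.
    + intros z Hz. rewrite Hk2 by lra. auto.
  - intros i j Hi Hj Hij. destruct (H2 i j Hi Hj Hij) as [E | E]; [left | right];
      intros E'; apply E; now apply (PL_inj h).
Qed.

(** * Separating the two kinds of orbitals *)

Lemma disjoint_commute f g a b m x : PL f -> PL g -> a < m < b ->
  (forall y, a < y < b -> m <= y -> f y = y) -> (forall y, a < y < b -> y <= m -> g y = y) ->
  f a = a -> g b = b -> a < x < b -> g (f x) = f (g x).
Proof.
  intros Hf Hg Hm Ef Eg Ea Eb Hx. destruct (Rle_lt_dec x m) as [H | H].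
  - rewrite (Eg x) by trivial. apply Eg.
    + assert (f a < f x) by (apply PL_incr; trivial; lra).
      assert (f x <= f m) by (apply PL_le; trivial).
      assert (f m = m) by (apply Ef; lra). lra.
    + rewrite <- (Ef m) by lra. now apply PL_le.
  - assert (g x < g b) by (apply PL_incr; trivial; lra).
    assert (g m < g x) by (apply PL_incr; trivial; lra).
    assert (g m = m) by (apply Eg; lra).
    rewrite (Ef x) by (trivial; lra). symmetry. apply Ef; lra.
Qed.

Definition der_kernel (K : (R -> R) -> Prop) (a b : R) (g : R -> R) : Prop :=
  der K g /\ forall x, a < x < b -> g x = x.

Lemma group_der_kernel K a b : group K -> group (der_kernel K a b).
Proof.
  intros HK. assert (HD := group_der K HK). split.
  - intros g [Hg _]. now apply HD.
  - split; [apply HD | trivial].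
  - intros g h [Hg Eg] [Hh Eh]. split; [now apply HD |]. intros x Hx. unfold rmul. now rewrite Eg, Eh.
  - intros g [Hg Eg]. split; [now apply HD |]. intros x Hx. apply fix_finv; auto. now apply HD.
Qed.

Lemma normed_der_kernel K a b : group K -> fixes K a -> fixes K b -> normed (der_kernel K a b) K.
Proof.
  intros HK Ha Hb g h [Hg Eg] Hh. assert (Hph : PL h) by now apply HK. split.
  - apply (normed_der K K); trivial. now apply normed_self.
  - intros x Hx. unfold conjg. rewrite Eg; [now apply finv_r |].
    apply PL_between; trivial; [now apply PL_finv | |]; apply fix_finv; auto.
Qed.

(* On [(a2, b2)] the elements of [T i] live in the [i]-th block of the controller, so that [T i]
   and [T j] commute modulo [der_kernel] for distant [i] and [j], and the [T i] generate a group
   containing the second derived group.  If [der_kernel] fixed a point of [(a, b)], all the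
   [T i] would have a common fixed point there. *)
Lemma der_kernel_nofix l a b a2 b2 : group (fgen l) ->
  orbital_of (fgen l) a b -> orbital_of (fgen l) a2 b2 ->
  nofix (der (fgen l)) a b -> ~ nofix (der (fgen l)) a2 b2 ->
  nofix (der_kernel (fgen l) a2 b2) a b.
Proof.
  set (K := fgen l). intros HK (Hab & Ha & Hb & HN) HO2 HND HND2.
  assert (HD := group_der K HK).
  assert (HDab : forall g, der K g -> cs g a b) by (intros g; now apply cs_der).
  assert (HDK : forall g, der K g -> K g) by (intros g; now apply der_sub).
  (* This is what the common fixed point found at the end contradicts. *)
  assert (HDDab : nofix (der (der K)) a b).
  { apply (comm_nofix K (der K) (der K) (der (der K)) a b); trivial.
    - intros g. apply (group_der _ HD).
    - apply normed_der; trivial. apply normed_der; trivial. now apply normed_self.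
    - intros g h. apply der_comm. }
  destruct (nofix_dec (der K) a2 b2) as [| (p & Hp & Hfp)]; [tauto |].
  assert (HT : typeII K a2 b2 p) by now split.
  destruct HO2 as (Hab2 & Ha2 & Hb2 & HN2).
  set (M := der_kernel K a2 b2).
  assert (HM : group M) by now apply group_der_kernel.
  assert (HMN : normed M K) by now apply normed_der_kernel.
  destruct (nofix_dec M a b) as [| (q & Hq & Hfq)]; trivial. exfalso.
  destruct (classic (exists s y, Stab K p s /\ a2 < y < b2 /\ s y <> y)) as [(s & y & Hs & Hy & Hsy) | Htriv].
  (* If the stabiliser is trivial on the second orbital, so is all of K', which then coincides with
     [M] and fixes [q]. *)
  2: { destruct (HND q Hq) as (g & Hg & Hgq). apply Hgq, Hfq. split; trivial.
    intros x Hx. apply NNPP. intros Hgx. apply Htriv. exists g, x.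
    split; [now apply (der_Stab K a2 b2) | auto]. }
  destruct (controller_gen l a2 b2 p s y) as (c & fs & Hc & Hcp & Hfs & Hgen); trivial.
  fold K in Hc, Hfs, Hgen.
  assert (Hfree := moved_free K a2 b2 p c HT Hc ltac:(lra)).
  assert (Hpc : PL c) by now apply HK.
  destruct (supp_bound c a2 b2 p fs) as (L & HL & Hsupp); trivial.
  { intros f Hf. apply (Stab_cs K a2 b2 p); auto. }
  (* A conjugate by the k-th power of [c] lives between the exponents [k - L] and [k + L]. So it
     fits into a window of two consecutive blocks of length [2 * L], and windows whose indices
     differ by at least 2 do not overlap. *)
  set (N := (2 * L)%Z).
  set (T := fun (i : Z) (g : R -> R) => der K g /\ forall x, a2 < x < b2 ->
    x <= pw c (N * i) p \/ pw c (N * (i + 2)) p <= x -> g x = x).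
  assert (HTG : forall i, group (T i)).
  { intros i. split.
    - intros g [Hg _]. now apply HD.
    - split; [apply HD | trivial].
    - intros g h [Hg Eg] [Hh Eh]. split; [now apply HD |].
      intros x Hx Hx'. unfold rmul. now rewrite Eg, Eh.
    - intros g [Hg Eg]. split; [now apply HD |]. intros x Hx Hx'. apply fix_finv; auto. now apply HD. }
  assert (HTD : forall i t, T i t -> der K t) by (intros i t [Ht _]; trivial).
  assert (HderN : normed (der K) K) by (apply normed_der; trivial; now apply normed_self).
  assert (HSK : group (Stab K p)) by now apply group_Stab.
  assert (HSpw : forall g n, Stab K p g -> g (pw c n p) = pw c n p).
  { intros g n Hg. apply (Stab_Phi K a2 b2 p); trivial.
    apply (Phi_pw K a2 b2 p); trivial. now apply Phi_p. }
  assert (HTS : forall i, normed (T i) (Stab K p)).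
  { intros i t g [Ht Et] Hg. split; [apply HderN; trivial; apply Hg |].
    intros x Hx Hx'. assert (Hpg : PL g) by apply HK, Hg. assert (Hpg' := PL_finv g Hpg).
    assert (Hg' : Stab K p (finv g)) by now apply HSK.
    unfold conjg. rewrite Et; [now apply finv_r | |].
    - apply PL_between; trivial; apply fix_finv; trivial; [apply Ha2 | apply Hb2]; apply Hg.
    - destruct Hx' as [Hx' | Hx']; apply (PL_le (finv g)) in Hx'; trivial; rewrite HSpw in Hx'; auto. }
  assert (HTsh : forall i j t, T i t -> T (i + j)%Z (conjg t (pw c (N * j)))).
  { intros i j t [Ht Et]. split; [apply HderN; trivial; now apply pw_K |].
    intros x Hx Hx'. assert (Hpj : PL (pw c (- (N * j)))) by now apply PL_pw.
    unfold conjg. rewrite finv_pw by trivial. rewrite Et.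
    - apply pw_cancel; trivial; lia.
    - now apply free_pw.
    - destruct Hx' as [H | H]; apply (PL_le (pw c (- (N * j)))) in H; trivial;
        rewrite <- pw_add in H by trivial; [left | right].
      + now replace (- (N * j) + N * (i + j))%Z with (N * i)%Z in H by lia.
      + now replace (- (N * j) + N * (i + j + 2))%Z with (N * (i + 2))%Z in H by lia. }
  assert (HDS : forall g, der K g -> Stab K p g) by (intros g; now apply (der_Stab K a2 b2)).
  assert (Hfar : forall i j t t', (i + 2 <= j)%Z -> T i t -> T j t' ->
    forall x, a2 < x < b2 -> t' (t x) = t (t' x)).
  { intros i j t t' Hij [Ht Et] [Ht' Et'] x Hx.
    apply (disjoint_commute t t' a2 b2 (pw c (N * (i + 2)) p)); auto.
    - now apply HD.
    - now apply HD.
    - now apply free_pw.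
    - intros z Hz Hz'. apply Et'; trivial. left. apply Rle_trans with (pw c (N * (i + 2)) p); trivial.
      apply (pw_incr_le c a2 b2); trivial. unfold N. nia. }
  assert (HMc : forall t t', der K t -> der K t' ->
    (forall x, a2 < x < b2 -> t' (t x) = t (t' x)) -> M (comm t t')).
  { intros t t' Ht Ht' E. assert (Hpt : PL t) by now apply HD. assert (Hpt' : PL t') by now apply HD.
    split; [apply group_comm; trivial |].
    intros x Hx. unfold comm. rewrite E; [now rewrite !finv_r |].
    assert (Hx1 : a2 < finv t x < b2).
    { apply PL_between; trivial; [now apply PL_finv | |]; apply fix_finv; auto. }
    apply PL_between; trivial; [now apply PL_finv | |]; apply fix_finv; auto. }
  assert (Hcom : forall i j t t', (i + 2 <= j \/ j + 2 <= i)%Z -> T i t -> T j t' ->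
    forall x, a < x < b -> fixes M x -> t' (t x) = t (t' x)).
  { intros i j t t' Hij Ht Ht' x Hx Hfx. apply (comm_fix_commute K M t t' a b x); eauto.
    apply HMc; eauto. destruct Hij as [Hij | Hij]; [now apply (Hfar i j) |].
    intros z Hz. symmetry. now apply (Hfar j i). }
  assert (Hup : forall v u, a < v < b -> a < u < b -> exists g, der K g /\ u < g v < b).
  { intros v u Hv Hu. destruct (cofinal_up (der K) a b v u) as (g & Hg & Hgv); trivial; [lra |].
    exists g. split; trivial. assert (a < g v < b) by (apply PL_between; auto; now apply HD). lra. }
  assert (HTg : forall i g v, Stab K p g -> fixes (T i) v -> fixes (T i) (g v)).
  { intros i g v Hg Hv. now apply (normed_fix (T i) (Stab K p)). }
  assert (Hshift : forall i j v, fixes (T i) v -> fixes (T (i + j)%Z) (pw c (N * j) v)).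
  { intros i j v Hv t Ht.
    assert (Hv' : conjg t (pw c (N * - j)) v = v).
    { apply Hv. replace i with (i + j + - j)%Z by lia. now apply HTsh. }
    unfold conjg in Hv'. rewrite finv_pw in Hv' by trivial.
    replace (- (N * - j))%Z with (N * j)%Z in Hv' by lia.
    rewrite <- Hv' at 2. rewrite pw_cancel; trivial; lia. }
  assert (Hpwab : forall n v, a < v < b -> a < pw c n v < b).
  { intros n v Hv. apply PL_between; trivial; [now apply PL_pw | |];
      [apply Ha | apply Hb]; now apply pw_K. }
  (* The groups with even index commute pairwise on fixed points of [M]. If one of them moves [q],
     all others fix an end [u] of an orbital, and they fix the whole orbit of [u] under the
     exceptional group; its supremum is the point sought, once the orbit is bounded. *)
  assert (Hev : exists v, a < v < b /\ forall i, fixes (T (2 * i)%Z) v).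
  { destruct (classic (forall i, fixes (T (2 * i)%Z) q)) as [|Hno]; [eauto |].
    apply not_all_ex_not in Hno. destruct Hno as [i Hi].
    assert (exists e, T (2 * i)%Z e /\ e q <> q) as (e & He & Heq).
    { apply NNPP. intros H. apply Hi. intros e He. apply NNPP. eauto. }
    destruct (commuting_fixes_orbital_end K M a b e q) as (u & Hu & HMu & Hfix); eauto.
    { intros m Hm. now apply HM. }
    assert (Hfixu : forall j, j <> i -> fixes (T (2 * j)%Z) u).
    { intros j Hj t Ht. apply Hfix; eauto. intros x Hx Hfx.
      apply (Hcom (2 * i)%Z (2 * j)%Z); trivial. lia. }
    (* The bound: the group of index [2 * i - 2] fixes [u], so the exceptional one fixes a translate
       of [u]. K' normalises that group and can push this fixed point above [u]. *)
    assert (Hu' : fixes (T (2 * i)%Z) (pw c (N * 2) u)).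
    { replace (2 * i)%Z with (2 * (i - 1) + 2)%Z by lia. apply Hshift, Hfixu. lia. }
    destruct (Hup (pw c (N * 2) u) u) as (g & Hg & Hgu); auto.
    assert (Hz : fixes (T (2 * i)%Z) (g (pw c (N * 2) u))) by auto.
    destruct (orbit_sup (T (2 * i)%Z) u (g (pw c (N * 2) u))) as (v & Hv & Hfv & Hlub); trivial.
    { intros t Ht. rewrite <- (Hz t Ht). apply PL_le; [now apply (HTG (2 * i)%Z) | lra]. }
    exists v. split; [lra |]. intros j. destruct (Z.eq_dec j i) as [-> | Hj]; trivial.
    intros t Ht. apply (lub_fixed_pts t (orb_pts (T (2 * i)%Z) u)); trivial.
    { now apply (HTG (2 * j)%Z). }
    intros z (t' & Ht' & ->).
    rewrite (Hcom (2 * i)%Z (2 * j)%Z t' t) by (trivial; lia). f_equal. now apply (Hfixu j). }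
  destruct Hev as (v & Hv & Hfv).
  assert (Hodd : forall i, fixes (T (2 * i + 1)%Z) (pw c (N * 1) v)) by (intros i; apply Hshift, Hfv).
  set (A := subgroup_gen (fun g => exists i, T (2 * i)%Z g)).
  assert (HA : group A).
  { apply group_gen. intros g [i Hg]. now apply (HTG (2 * i)%Z). }
  assert (HAS : forall g, A g -> Stab K p g).
  { intros g. apply gen_incl; trivial. intros f [i Hf]. eauto. }
  assert (Hv1 := Hpwab (N * 1)%Z v Hv).
  (* The groups of odd index fix a translate of [v], and hence its orbit under the group generated
     by those of even index, which normalises them. A fixed point of the latter above the translate
     bounds the orbit, so its supremum [w] is fixed by all windows. *)
  destruct (Hup v (pw c (N * 1) v)) as (g0 & Hg0 & Hg0v); trivial.
  assert (Hz : fixes A (g0 v)).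
  { apply fixes_gen; [intros g [i Hg]; now apply (HTG (2 * i)%Z) |].
    intros g [i Hg]. now apply (HTg (2 * i)%Z); auto. }
  destruct (orbit_sup A (pw c (N * 1) v) (g0 v)) as (w & Hw & Hfw & Hlub); trivial.
  { intros g Hg. rewrite <- (Hz g Hg). apply PL_le; [now apply HA | lra]. }
  assert (Hall : forall i, fixes (T i) w).
  { intros i t Ht. destruct (Z.Even_or_Odd i) as [[j ->] | [j ->]].
    - apply Hfw. apply sg_gen. eauto.
    - apply (lub_fixed_pts t (orb_pts A (pw c (N * 1) v))); trivial.
      { now apply (HTG (2 * j + 1)%Z). }
      intros z (g & Hg & ->). now apply (HTg (2 * j + 1)%Z g); auto. }
  (* A conjugate of a generator lives in one window, hence so does its commutator with any element
     of the stabiliser; at points fixed by all windows the two commute. *)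
  assert (Hcomw : forall g, subgroup_gen (conjugates fs c) g ->
    Stab K p g /\ forall h z, Stab K p h -> a < z < b -> (forall i, fixes (T i) z) -> h (g z) = g (h z)).
  { assert (Hconj : forall f k, In f fs -> Stab K p (conjg f (pw c k))).
    { intros f k Hf. apply (normed_Stab K a2 b2 p HT); auto. now apply pw_K. }
    assert (HSz : forall g z, Stab K p g -> a < z < b -> (forall i, fixes (T i) z) ->
      a < g z < b /\ forall i, fixes (T i) (g z)).
    { intros g z Hg Hz0 Hfz. split; [| auto].
      apply PL_between; trivial; [apply HK | apply Ha | apply Hb]; apply Hg. }
    intros g Hg. induction Hg as [g (f & k & Hf & ->) | | g h Hg [S1 IH1] Hh [S2 IH2] | g g' Hg [S1 IH] E1 E2].
    - set (g := conjg f (pw c k)). assert (Hg : Stab K p g) by now apply Hconj.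
      split; trivial. intros h z Hh Hz0 Hfz.
      assert (Hpg : PL g) by apply HK, Hg. assert (Hph : PL h) by apply HK, Hh.
      set (i := ((k - L) / N)%Z).
      assert (Hi : (N * i <= k - L < N * i + N)%Z).
      { assert (HN0 : (0 < N)%Z) by (unfold N; lia).
        assert (D1 := Z.div_mod (k - L) N ltac:(lia)). assert (D2 := Z.mod_pos_bound (k - L) N HN0).
        fold i in D1. lia. }
      assert (Hgs : forall x, a2 < x < b2 ->
        x <= pw c (N * i) p \/ pw c (N * (i + 2)) p <= x -> g x = x).
      { intros x Hx Hx'. apply (supp_conjg c a2 b2 p L); auto. destruct Hx' as [H | H]; [left | right].
        - apply Rle_trans with (pw c (N * i) p); trivial. apply (pw_incr_le c a2 b2); trivial. lia.
        - apply Rle_trans with (pw c (N * (i + 2)) p); trivial. apply (pw_incr_le c a2 b2); trivial.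
          unfold N in *. lia. }
      assert (Hc0 : T i (comm g h)).
      { split; [apply der_comm; [apply Hg | apply Hh] |].
        intros x Hx Hx'.
        assert (Hgx : finv g x = x) by (apply fix_finv; auto).
        unfold comm. rewrite Hgx.
        assert (Hh' : Stab K p (finv h)) by now apply HSK.
        rewrite Hgs; [now apply finv_r | |].
        - apply PL_between; trivial; [now apply PL_finv | |]; apply fix_finv; trivial;
            [apply Ha2 | apply Hb2]; apply Hh.
        - destruct Hx' as [Hx' | Hx']; apply (PL_le (finv h)) in Hx'; try (now apply PL_finv);
            rewrite HSpw in Hx'; auto. }
      assert (Hfgh : fixes (T i) (g (h z))) by (apply HTg; trivial; now apply HTg).
      specialize (Hfgh _ Hc0). unfold comm in Hfgh. now rewrite !finv_l in Hfgh.
    - split; [apply HSK | trivial].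
    - split; [now apply HSK |]. intros k z Hk Hz0 Hfz. unfold rmul.
      destruct (HSz g z) as [J1 J2]; trivial. rewrite IH2 by trivial. f_equal. now apply IH1.
    - assert (Hpg : PL g) by apply HK, S1. rewrite (finv_unique g g') by trivial.
      assert (S1' : Stab K p (finv g)) by now apply HSK.
      split; trivial. intros h z Hh Hz0 Hfz.
      destruct (HSz (finv g) z) as [J1 J2]; trivial.
      apply (PL_inj g); trivial. rewrite finv_r by trivial.
      rewrite <- IH by trivial. now rewrite finv_r. }
  assert (Hwab : a < w < b) by lra.
  apply (nofix_no (der (der K)) a b w); trivial.
  apply fixes_gen.
  { intros t (g & h & Hg & Hh & ->). apply PL_comm; now apply HD. }
  intros t (g & h & Hg & Hh & ->).
  assert (Hpg : PL g) by now apply HD. assert (Hph : PL h) by now apply HD.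
  unfold comm. rewrite (proj2 (Hcomw g (Hgen g (HDS g Hg)))); auto.
  - now rewrite !finv_r.
  - apply PL_between; [now apply PL_finv | | |];
      [apply fix_finv; trivial; apply Ha; auto | apply fix_finv; trivial; apply Hb; auto |].
    apply PL_between; [now apply PL_finv | | | trivial];
      [apply fix_finv; trivial; apply Ha; auto | apply fix_finv; trivial; apply Hb; auto].
  - intros i. apply HTg; [now apply HSK, HDS |]. apply HTg; [now apply HSK, HDS | trivial].
Qed.

(** * Finitely many orbitals *)

Definition allfix (l : list (R -> R)) (y : R) : Prop := forall g, In g l -> g y = y.

(** If the fixed points of [g] accumulate at [w] from the left, the affine germ there has two fixed
    points and is trivial. *)
Lemma left_dichotomy l w : (forall g, In g l -> PL g) -> exists e, 0 < e /\
  ((forall y, w - e < y < w -> allfix l y) \/ (forall y, w - e < y < w -> ~ allfix l y)).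
Proof.
  induction l as [|g l IH]; intros Hl.
  { exists 1. split; [lra | left; intros y _ g []]. }
  destruct IH as (e & He & IH); [intros; apply Hl; now right |].
  assert (Hg : PL g) by (apply Hl; now left).
  assert (Hone : exists e', 0 < e' /\
    ((forall y, w - e' < y < w -> g y = y) \/ (forall y, w - e' < y < w -> g y <> y))).
  { destruct (PL_left g Hg w) as (d & k & Hd & Hk & Haff).
    destruct (classic (exists e', 0 < e' /\ forall y, w - e' < y < w -> g y <> y)) as [(e' & He' & H) | Hno];
      [eauto |].
    exists d. split; [trivial | left].
    assert (Hex : forall e', 0 < e' -> exists y, w - e' < y < w /\ g y = y).
    { intros e' He'. apply NNPP. intros H. apply Hno. exists e'. split; trivial.
      intros y Hy E. apply H. eauto. }
    destruct (Hex d Hd) as (y1 & Hy1 & E1). destruct (Hex (w - y1)) as (y2 & Hy2 & E2); [lra |].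
    intros y Hy. apply (affine_two_fix g (w - d) w (g w) k w y1 y2); trivial; lra. }
  destruct Hone as (e' & He' & Hone).
  assert (L1 := Rmin_l e e'). assert (L2 := Rmin_r e e').
  exists (Rmin e e'). split; [now apply Rmin_pos |].
  destruct Hone as [Hone | Hone]; [destruct IH as [IH | IH] |].
  - left. intros y Hy f [<- | Hf]; [apply Hone; lra | apply IH; trivial; lra].
  - right. intros y Hy H. apply (IH y); [lra |]. intros f Hf. apply H. now right.
  - right. intros y Hy H. apply (Hone y); [lra |]. apply H. now left.
Qed.

Lemma right_dichotomy l w : (forall g, In g l -> PL g) -> exists e, 0 < e /\
  ((forall y, w <= y < w + e -> allfix l y) \/ (forall y, w < y < w + e -> ~ allfix l y)).
Proof.
  induction l as [|g l IH]; intros Hl.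
  { exists 1. split; [lra | left; intros y _ g []]. }
  destruct IH as (e & He & IH); [intros; apply Hl; now right |].
  assert (Hg : PL g) by (apply Hl; now left).
  assert (Hone : exists e', 0 < e' /\
    ((forall y, w <= y < w + e' -> g y = y) \/ (forall y, w < y < w + e' -> g y <> y))).
  { destruct (PL_right g Hg w) as (d & k & Hd & Hk & Haff).
    destruct (classic (exists e', 0 < e' /\ forall y, w < y < w + e' -> g y <> y)) as [(e' & He' & H) | Hno];
      [eauto |].
    exists d. split; [trivial | left].
    assert (Hex : forall e', 0 < e' -> exists y, w < y < w + e' /\ g y = y).
    { intros e' He'. apply NNPP. intros H. apply Hno. exists e'. split; trivial.
      intros y Hy E. apply H. eauto. }
    destruct (Hex d Hd) as (y1 & Hy1 & E1). destruct (Hex (y1 - w)) as (y2 & Hy2 & E2); [lra |].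
    intros y Hy. apply (affine_two_fix g w (w + d) (g w) k w y2 y1); trivial; lra. }
  destruct Hone as (e' & He' & Hone).
  assert (L1 := Rmin_l e e'). assert (L2 := Rmin_r e e').
  exists (Rmin e e'). split; [now apply Rmin_pos |].
  destruct Hone as [Hone | Hone]; [destruct IH as [IH | IH] |].
  - left. intros y Hy f [<- | Hf]; [apply Hone; lra | apply IH; trivial; lra].
  - right. intros y Hy H. apply (IH y); [lra |]. intros f Hf. apply H. now right.
  - right. intros y Hy H. apply (Hone y); [lra |]. apply H. now left.
Qed.

(** Compactness in the form of an induction: the supremum of the good points up to a bound is itself
    crossed by the local hypothesis. *)
Lemma real_induction (P : R -> Prop) : P 0 ->
  (forall w, 0 <= w -> exists e, 0 < e /\
    forall t t', w - e < t <= w -> 0 <= t -> w <= t' < w + e -> P t -> P t') ->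
  forall t, 0 <= t -> P t.
Proof.
  intros P0 Hloc T HT.
  destruct (lub_ex (fun t => 0 <= t <= T /\ P t) T 0) as (w & Hw1 & Hw2); [split; [lra | trivial] | tauto |].
  assert (H0w : 0 <= w) by (apply Hw1; split; [lra | trivial]).
  assert (HwT : w <= T) by (apply Hw2; intros t Ht; apply Ht).
  destruct (Hloc w H0w) as (e & He & Hstep).
  assert (exists t, 0 <= t <= T /\ P t /\ w - e < t) as (t & Ht & HPt & Hwt).
  { apply NNPP. intros H. assert (w <= w - e); [| lra]. apply Hw2. intros t [Ht HPt].
    destruct (Rle_lt_dec t (w - e)); trivial. exfalso. apply H. now exists t. }
  assert (t <= w) by (apply Hw1; now split).
  destruct (Rlt_le_dec w T) as [HlT | HlT]; [| apply (Hstep t); trivial; lra].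
  exfalso. assert (L1 := Rmin_l T (w + e / 2)). assert (L2 := Rmin_r T (w + e / 2)).
  assert (L3 : w < Rmin T (w + e / 2)) by (apply Rmin_glb_lt; lra).
  assert (Rmin T (w + e / 2) <= w); [| lra].
  apply Hw1. split; [lra |]. apply (Hstep t); trivial; lra.
Qed.

Lemma group_fgen l : (forall g, In g l -> PL g) -> group (fgen l).
Proof. apply group_gen. Qed.

Lemma allfix_fgen l y : (forall g, In g l -> PL g) -> allfix l y -> fixes (fgen l) y.
Proof. intros Hl Hy. now apply fixes_gen. Qed.

Lemma orbital_cover l : (forall g, In g l -> PL g) ->
  exists os, (forall o, In o os -> orbital_of (fgen l) (fst o) (snd o)) /\
    forall x g, fgen l g -> g x <> x -> exists o, In o os /\ fst o < x < snd o.
Proof.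
  intros Hl.
  assert (Hlow : forall x, x <= 0 \/ 1 <= x -> allfix l x) by (intros x Hx g Hg; apply PL_out; auto).
  (* A sweep from left to right: a moved point below [t] lies in a listed orbital or in one that is
     still open at [t]. *)
  set (P := fun t => exists os, (forall o, In o os -> orbital_of (fgen l) (fst o) (snd o)) /\
    forall x, x < t -> ~ allfix l x ->
      (exists o, In o os /\ fst o < x < snd o) \/ forall y, x <= y < t -> ~ allfix l y).
  (* Everything from 1 on is fixed, so no orbital is still open at 2. *)
  assert (HP : P 2).
  { apply (real_induction P); [| | lra].
    { exists nil. split; [intros o [] |]. intros x Hx H. exfalso. apply H, Hlow. lra. }
    intros w Hw0.
    destruct (left_dichotomy l w Hl) as (e & He & HL).
    destruct (right_dichotomy l w Hl) as (e' & He' & HR).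
    assert (L1 := Rmin_l e e'). assert (L2 := Rmin_r e e').
    exists (Rmin e e'). split; [now apply Rmin_pos |].
    intros t t' Ht Ht0 Ht' (os & Hos & Hcov).
    assert (Hw : P w).
    { destruct (proj2 Ht) as [Htw | <-]; [| now exists os].
      exists os. split; trivial. intros x Hxw Hx. destruct HL as [HL | HL].
      - destruct (Rlt_le_dec x t) as [Hxt | Hxt]; [| exfalso; apply Hx, HL; lra].
        destruct (Hcov x Hxt Hx) as [| Hno]; [now left |].
        assert (M1 := Rmax_l x (w - e)). assert (M2 := Rmax_r x (w - e)).
        assert (M3 : Rmax x (w - e) < t) by (apply Rmax_lub_lt; lra).
        exfalso. apply (Hno ((Rmax x (w - e) + t) / 2)); [lra |]. apply HL. lra.
      - destruct (Rlt_le_dec x t) as [Hxt | Hxt]; [| right; intros y Hy; apply HL; lra].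
        destruct (Hcov x Hxt Hx) as [| Hno]; [now left |]. right. intros y Hy.
        destruct (Rlt_le_dec y t); [apply Hno; lra | apply HL; lra]. }
    clear os Hos Hcov. destruct Hw as (os & Hos & Hcov).
    assert (Hright : forall os', (forall o, In o os' -> orbital_of (fgen l) (fst o) (snd o)) ->
      (forall x, x < w -> ~ allfix l x -> exists o, In o os' /\ fst o < x < snd o) ->
      allfix l w -> P t').
    { intros os' Hos' Hcov' Hw. exists os'. split; trivial. intros x Hxt Hx.
      destruct (Rtotal_order x w) as [Hxw | [-> | Hxw]]; [left; auto | tauto |].
      right. intros y Hy. destruct HR as [HR | HR]; [exfalso; apply Hx, HR; lra | apply HR; lra]. }
    destruct (classic (allfix l w)) as [Hw | Hw].
    - destruct HL as [HL | HL].
      + apply (Hright os); trivial. intros x Hxw Hx.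
        destruct (Hcov x Hxw Hx) as [| Hno]; [trivial | exfalso].
        assert (M1 := Rmax_l x (w - e)). assert (M2 := Rmax_r x (w - e)).
        assert (M3 : Rmax x (w - e) < w) by (apply Rmax_lub_lt; lra).
        apply (Hno ((Rmax x (w - e) + w) / 2)); [lra |]. apply HL. lra.
      (* An orbital closes at [w]. There are no common fixed points just below [w], so its left end
         is the last one up to [x0]. *)
      + set (x0 := w - e / 2). assert (Hx0 : w - e < x0 < w) by (unfold x0; lra).
        assert (Hx0' : 0 < x0).
        { destruct (Rlt_le_dec 0 x0); trivial. exfalso. apply (HL x0 Hx0), Hlow. lra. }
        destruct (lub_ex (fun y => y <= x0 /\ allfix l y) x0 0) as [a Ha]; [split; [lra | apply Hlow; lra] | tauto |].
        assert (Hfa : allfix l a).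
        { intros g Hg. apply (lub_fixed_pts g (fun y => y <= x0 /\ allfix l y)); auto.
          intros y [_ Hy]. auto. }
        assert (Hax : a <= x0) by (apply Ha; intros y Hy; apply Hy).
        apply (Hright ((a, w) :: os)); trivial.
        * intros o [<- | Ho]; [| auto]. simpl. split; [lra |].
          split; [now apply allfix_fgen | split; [now apply allfix_fgen |]].
          intros y Hy. assert (Hny : ~ allfix l y).
          { intros Hfy. destruct (Rle_lt_dec y x0) as [Hyx | Hyx].
            - assert (y <= a) by (apply Ha; now split). lra.
            - apply (HL y); trivial. lra. }
          apply not_all_ex_not in Hny. destruct Hny as [g Hg]. apply imply_to_and in Hg.
          exists g. split; [now apply sg_gen | apply Hg].
        * intros x Hxw Hx. destruct (Hcov x Hxw Hx) as [(o & Ho & Hxo) | Hno].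
          { exists o. split; [now right | trivial]. }
          exists (a, w). split; [now left | simpl]. split; trivial.
          destruct (Rlt_le_dec a x); trivial. exfalso. apply (Hno a); trivial. lra.
    - destruct HR as [HR | HR]; [exfalso; apply Hw, HR; lra |].
      exists os. split; trivial. intros x Hxt Hx.
      destruct (Rtotal_order x w) as [Hxw | [-> | Hxw]].
      + destruct (Hcov x Hxw Hx) as [| Hno]; [now left |]. right. intros y Hy.
        destruct (Rtotal_order y w) as [Hyw | [-> | Hyw]]; trivial; [apply Hno; lra | apply HR; lra].
      + right. intros y Hy. destruct (Req_dec y w) as [-> | Hyw]; trivial. apply HR; lra.
      + right. intros y Hy. apply HR; lra. }
  destruct HP as (os & Hos & Hcov). exists os. split; trivial.
  intros x g Hg Hgx.
  assert (Hx : ~ allfix l x) by (intros H; apply Hgx; now apply (allfix_fgen l)).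
  assert (Hx1 : 0 < x < 1).
  { split; [destruct (Rlt_le_dec 0 x) | destruct (Rlt_le_dec x 1)]; trivial;
      exfalso; apply Hx, Hlow; lra. }
  destruct (Hcov x) as [| Hno]; [lra | trivial | trivial |].
  exfalso. apply (Hno (3 / 2)); [lra | apply Hlow; lra].
Qed.

Lemma orbital_unique K a b a' b' x : orbital_of K a b -> orbital_of K a' b' ->
  a < x < b -> a' < x < b' -> a = a' /\ b = b'.
Proof.
  intros (Hab & Ha & Hb & HN) (Hab' & Ha' & Hb' & HN') Hx Hx'.
  split.
  - destruct (Rtotal_order a a') as [H | [H | H]]; trivial; exfalso.
    + apply (nofix_no K a b a'); trivial; lra.
    + apply (nofix_no K a' b' a); trivial; lra.
  - destruct (Rtotal_order b b') as [H | [H | H]]; trivial; exfalso.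
    + apply (nofix_no K a' b' b); trivial; lra.
    + apply (nofix_no K a b b'); trivial; lra.
Qed.

(** * Towers of signed orbitals *)

Lemma orbital_interval g A : PL g -> orbital g A -> exists u v, u < v /\ g u = u /\ g v = v /\
  (forall y, u < y < v -> g y <> y) /\ forall y, A y <-> u < y < v.
Proof.
  intros Hg (x & [Hx Hgx] & HA).
  assert (Hg0 : g 0 = 0) by (apply PL_out; trivial; lra).
  assert (Hg1 : g 1 = 1) by (apply PL_out; trivial; lra).
  destruct (lub_ex (fun y => y <= x /\ g y = y) x 0) as [u Hu]; [split; lra | tauto |].
  destruct (glb_ex (fun y => x <= y /\ g y = y) x 1) as [v Hv]; [split; lra | tauto |].
  assert (Hux : u <= x) by (apply Hu; intros y Hy; apply Hy).
  assert (Hvx : x <= v) by (apply Hv; intros y Hy; apply Hy).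
  assert (H0u : 0 <= u) by (apply Hu; split; lra).
  assert (Hv1 : v <= 1) by (apply Hv; split; lra).
  assert (Hgu : g u = u) by (apply (lub_fixed_pts g (fun y => y <= x /\ g y = y)); tauto).
  assert (Hgv : g v = v) by (apply (glb_fixed_pts g (fun y => x <= y /\ g y = y)); tauto).
  assert (u <> x) by (intros ->; tauto). assert (v <> x) by (intros ->; tauto).
  assert (Hno : forall y, u < y < v -> g y <> y).
  { intros y Hy E. destruct (Rle_lt_dec y x).
    - assert (y <= u) by (apply Hu; now split). lra.
    - assert (v <= y) by (apply Hv; split; lra). lra. }
  exists u, v. split; [lra | split; [trivial | split; [trivial | split; [trivial |]]]].
  intros y. rewrite HA. split.
  - intros (C & HC & Hmov & HCx & HCy). split.
    + destruct (Rlt_le_dec u y); trivial. exfalso.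
      apply (Hmov u); trivial. apply (HC y u x); trivial. lra.
    + destruct (Rlt_le_dec y v); trivial. exfalso.
      apply (Hmov v); trivial. apply (HC x v y); trivial. lra.
  - intros Hy. exists (fun z => u < z < v). split; [| split; [| split; lra]].
    + intros z1 z2 z3 H1 H3 H2. lra.
    + intros z Hz. split; [lra | auto].
Qed.

Lemma innermost (A : nat -> R -> Prop) n : (0 < n)%nat ->
  (forall i j, (i < n)%nat -> (j < n)%nat -> i <> j -> set_incl (A i) (A j) \/ set_incl (A j) (A i)) ->
  exists i0, (i0 < n)%nat /\ forall j, (j < n)%nat -> set_incl (A i0) (A j).
Proof.
  induction n as [|n IH]; intros Hn H; [lia |].
  destruct (Nat.eq_dec n 0) as [-> | Hn0].
  { exists O. split; [lia |]. intros j Hj. replace j with O by lia. intros x; trivial. }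
  destruct IH as (i0 & Hi0 & Hmin); [lia | intros; apply H; lia |].
  destruct (H i0 n) as [Hi | Hi]; try lia.
  - exists i0. split; [lia |]. intros j Hj. destruct (Nat.eq_dec j n) as [-> |]; trivial. apply Hmin. lia.
  - exists n. split; [lia |]. intros j Hj. destruct (Nat.eq_dec j n) as [-> |]; [intros x; trivial |].
    intros x Hx. apply Hmin; [lia | now apply Hi].
Qed.

(** All orbitals of a finite chain contain the smallest one, whose midpoint serves as the common
    point. *)
Lemma has_tower_tower H n : group H -> has_tower H n -> exists x, tower H n x.
Proof.
  intros HH (A & g & H1 & H2).
  destruct n as [|n].
  { exists 0, (fun _ x => x), (fun _ => 0), (fun _ => 0). split; lia. }
  assert (Huv : forall i, exists uv : R * R, (i < S n)%nat ->
    let (u, v) := uv in u < v /\ g i u = u /\ g i v = v /\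
    (forall y, u < y < v -> g i y <> y) /\ forall y, A i y <-> u < y < v).
  { intros i. destruct (classic (i < S n)%nat) as [Hi | Hi]; [| exists (0, 0); tauto].
    destruct (H1 i Hi) as [Hg Ho]. apply orbital_interval in Ho; [| now apply HH].
    destruct Ho as (u & v & Ho). now exists (u, v). }
  set (uv := fun i => proj1_sig (constructive_indefinite_description _ (Huv i))).
  assert (Hspec : forall i, (i < S n)%nat -> fst (uv i) < snd (uv i) /\ g i (fst (uv i)) = fst (uv i) /\
    g i (snd (uv i)) = snd (uv i) /\ (forall y, fst (uv i) < y < snd (uv i) -> g i y <> y) /\
    forall y, A i y <-> fst (uv i) < y < snd (uv i)).
  { intros i Hi. unfold uv.
    destruct (constructive_indefinite_description _ (Huv i)) as [[u v] Hp]. simpl. now apply Hp. }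
  destruct (innermost A (S n)) as (i0 & Hi0 & Hmin); [lia | intros; now apply H2 |].
  destruct (Hspec i0 Hi0) as (Hlt & _ & _ & _ & HA).
  set (x := (fst (uv i0) + snd (uv i0)) / 2).
  assert (Hx : A i0 x) by (apply HA; unfold x; lra).
  exists x, g, (fun i => fst (uv i)), (fun i => snd (uv i)). split.
  - intros i Hi. destruct (Hspec i Hi) as (S1 & S2 & S3 & S4 & S5).
    split; [now apply H1 |]. split; [trivial | split; [trivial | split; [trivial |]]].
    apply S5. now apply (Hmin i).
  - intros i j Hi Hj Hij. destruct (classic (fst (uv i) = fst (uv j))) as [E1 |]; [| now left].
    destruct (classic (snd (uv i) = snd (uv j))) as [E2 |]; [| now right].
    exfalso. apply (proj1 (H2 i j Hi Hj Hij)). intros y.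
    destruct (Hspec i Hi) as (_ & _ & _ & _ & Si). destruct (Hspec j Hj) as (_ & _ & _ & _ & Sj).
    rewrite Si, Sj, E1, E2. reflexivity.
Qed.

Lemma tower_le A n m x : (n <= m)%nat -> tower A m x -> tower A n x.
Proof.
  intros Hnm (g & u & v & H1 & H2). exists g, u, v. split; intros; [apply H1 | apply H2]; lia.
Qed.

Lemma tower_incl (A B : (R -> R) -> Prop) n x : (forall g, A g -> B g) -> tower A n x -> tower B n x.
Proof.
  intros HAB (g & u & v & H1 & H2). exists g, u, v. split; trivial.
  intros i Hi. destruct (H1 i Hi). auto.
Qed.

Lemma towers_tall H : group H -> arbitrarily_large_towers H -> tall H.
Proof.
  intros HH Ht n. destruct (Ht n) as (m & Hnm & Hm).
  apply has_tower_tower in Hm; trivial. destruct Hm as [x Hx].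
  exists x. now apply (tower_le _ n m).
Qed.

(** * One step of the descent and of the ascent *)

(** Once the interval is moved off itself, further positive powers move it on in the same direction.
    For negative powers exchange the point and its image. *)
Lemma pw_off g s t x n : PL g -> t < g s \/ g t < s -> s <= x <= t -> n <> 0%Z ->
  ~ s <= pw g n x <= t.
Proof.
  intros Hg Hst.
  assert (Hpos : forall m x, (0 < m)%Z -> s <= x <= t -> ~ s <= pw g m x <= t).
  { intros m z Hm Hz. replace m with (m - 1 + 1)%Z by lia. rewrite pw_add, pw_1 by trivial.
    assert (Hgz : g s <= g z <= g t) by (split; apply PL_le; trivial; lra).
    destruct Hst as [Hst | Hst].
    - assert (g s <= g (g s)) by (apply PL_le; trivial; lra).
      assert (g s <= pw g (m - 1) (g s)) by (apply pw_nonneg_ge; trivial; lia).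
      assert (pw g (m - 1) (g s) <= pw g (m - 1) (g z)) by (apply PL_le; [now apply PL_pw | lra]). lra.
    - assert (g (g t) <= g t) by (apply PL_le; trivial; lra).
      assert (pw g (m - 1) (g t) <= g t) by (apply pw_nonneg_le; trivial; lia).
      assert (pw g (m - 1) (g z) <= pw g (m - 1) (g t)) by (apply PL_le; [now apply PL_pw | lra]). lra. }
  intros Hx Hn Hx'. destruct (Z.lt_total 0 n) as [H | [H | H]].
  - now apply (Hpos n x).
  - lia.
  - apply (Hpos (- n)%Z (pw g n x)); trivial; [lia |]. rewrite pw_cancel; trivial. lia.
Qed.

Definition supp (A : (R -> R) -> Prop) (x : R) : Prop := exists g, A g /\ g x <> x.

(** All nonzero powers are required: the translates of [D] have to be pairwise disjoint to carry the
    summands of the base of a wreath product. *)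
Definition moves_off (g : R -> R) (D : R -> Prop) : Prop :=
  forall x n, D x -> n <> 0%Z -> ~ D (pw g n x).

(** [c] may push up on some orbitals and down on others, whence the two alternatives. The statement
    for all large [n] lets finitely many orbitals share one exponent. *)
Lemma escape_block c a b p fs : free_on c a b -> a < p < b -> (forall f, In f fs -> cs f a b) ->
  exists s t N, (forall f x, In f fs -> a < x < b -> x <= s \/ t <= x -> f x = x) /\
    forall n, (N <= n)%Z -> t < pw c n s \/ pw c n t < s.
Proof.
  intros Hfree Hp Hfs.
  assert (Hup : forall c, free_on c a b -> p < c p -> exists s t N,
    (forall f x, In f fs -> a < x < b -> x <= s \/ t <= x -> f x = x) /\
    forall n, (N <= n)%Z -> t < pw c n s).
  { clear c Hfree. intros c Hfree Hcp. assert (Hc := proj1 Hfree).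
    destruct (supp_bound c a b p fs) as (L & HL & H); trivial.
    exists (pw c (- L) p), (pw c L p), (2 * L + 1)%Z. split; trivial.
    intros n Hn. rewrite <- pw_add by trivial. apply (pw_incr c a b); trivial. lia. }
  destruct (Rtotal_order p (c p)) as [H | [H | H]].
  - destruct (Hup c) as (s & t & N & H1 & H2); trivial. exists s, t, N. auto.
  - exfalso. symmetry in H. now apply (proj2 (proj2 (proj2 Hfree)) p).
  - assert (Hc := proj1 Hfree).
    assert (Hcp : p < finv c p) by (apply (PL_lt_rev c); trivial; now rewrite finv_r).
    destruct (Hup (finv c)) as (s & t & N & H1 & H2); trivial; [now apply free_finv |].
    exists s, t, N. split; trivial. intros n Hn. right.
    assert (E : finv c = pw c (-1)).
    { extensionality x. rewrite <- (finv_r c x) at 2 by trivial.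
      now rewrite <- (pw_1 c), pw_cancel. }
    specialize (H2 n Hn). rewrite E, pw_mul in H2 by trivial.
    apply (PL_incr (pw c n)) in H2; [| now apply PL_pw].
    rewrite pw_cancel in H2 by (trivial; lia). trivial.
Qed.

(** The new generators may act on several orbitals at once, so one element must move their supports
    off in all of them. They lie in K', hence have compact support in every orbital. *)
Lemma descent_step l : (forall g, In g l -> PL g) ->
  (forall a b, orbital_of (fgen l) a b -> ~ nofix (der (fgen l)) a b) -> tall (fgen l) ->
  exists l' g, (forall f, In f l' -> fgen l f) /\ tall (fgen l') /\ fgen l g /\
    moves_off g (supp (fgen l')).
Proof.
  intros Hl HII Htall. set (K := fgen l) in *.
  assert (HK : group K) by now apply group_fgen.
  destruct (orbital_cover l Hl) as (os & Hos & Hcov). fold K in Hos, Hcov.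
  assert (Hp : forall o, exists p, In o os -> typeII K (fst o) (snd o) p).
  { intros o. destruct (classic (In o os)) as [Ho |]; [| exists 0; tauto].
    destruct (nofix_dec (der K) (fst o) (snd o)) as [H | (p & Hp & Hfp)].
    - exfalso. apply (HII (fst o) (snd o)); auto.
    - exists p. intros _. split; auto. }
  set (p := fun o => proj1_sig (constructive_indefinite_description _ (Hp o))).
  assert (HT : forall o, In o os -> typeII K (fst o) (snd o) (p o)).
  { intros o Ho. unfold p. destruct (constructive_indefinite_description _ (Hp o)). simpl. auto. }
  (* Moving only the base points is enough: by [moved_free], [c] then has no fixed point in any
     orbital. *)
  destruct (move_off K os HK) with (s := p) (t := p) as (c & Hc & Hoff).
  { intros o Ho. split; [| split]; apply Hos; trivial. }
  { intros o Ho. assert (H := t_p _ _ _ _ (HT o Ho)). lra. }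
  assert (Hpc : PL c) by now apply HK.
  assert (Hfree : forall o, In o os -> free_on c (fst o) (snd o)).
  { intros o Ho. apply (moved_free K _ _ (p o)); auto. destruct (Hoff o Ho); lra. }
  assert (Hls : forall os', (forall o, In o os' -> In o os) -> exists l',
    (forall f, In f l' -> der K f) /\
    forall o n x, In o os' -> fst o < x < snd o -> tower K (S n) x -> exists x', tower (fgen l') n x').
  { induction os' as [|o os' IH]; intros Hin.
    - exists nil. split; [intros f [] | intros o n x []].
    - destruct IH as (l1 & H1 & H1'); [intros; apply Hin; now right |].
      destruct (tower_descend l (fst o) (snd o) (p o)) as (l2 & H2 & H2'); [apply HT, Hin; now left |].
      exists (l2 ++ l1). split.
      + intros f Hf. apply in_app_or in Hf. destruct Hf; auto.
      + assert (HI1 : forall f, fgen l1 f -> fgen (l2 ++ l1) f).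
        { intros f. apply gen_incl.
          - apply group_fgen. intros h Hh. apply HK, der_sub; trivial.
            apply in_app_or in Hh. destruct Hh; auto.
          - intros h Hh. apply sg_gen, in_or_app. now right. }
        assert (HI2 : forall f, fgen l2 f -> fgen (l2 ++ l1) f).
        { intros f. apply gen_incl.
          - apply group_fgen. intros h Hh. apply HK, der_sub; trivial.
            apply in_app_or in Hh. destruct Hh; auto.
          - intros h Hh. apply sg_gen, in_or_app. now left. }
        intros o' n x [<- | Ho'] Hx Ht.
        * destruct (H2' n x Hx Ht) as [x' Hx']. exists x'. now apply (tower_incl (fgen l2)).
        * destruct (H1' o' n x Ho' Hx Ht) as [x' Hx']. exists x'. now apply (tower_incl (fgen l1)). }
  destruct (Hls os (fun o Ho => Ho)) as (l' & Hl' & Hdesc). clear Hls.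
  assert (Hl'K : forall f, In f l' -> K f) by (intros f Hf; apply der_sub; auto).
  assert (HGl' : group (fgen l')) by (apply group_fgen; intros f Hf; apply HK; auto).
  assert (Hl'K' : forall f, fgen l' f -> K f) by (intros f; now apply gen_incl).
  assert (HN : forall os', (forall o, In o os' -> In o os) -> exists N, forall o, In o os' -> exists s t,
    (forall f x, In f l' -> fst o < x < snd o -> x <= s \/ t <= x -> f x = x) /\
    forall n, (N <= n)%Z -> t < pw c n s \/ pw c n t < s).
  { induction os' as [|o os' IH]; intros Hin; [exists 0%Z; intros o [] |].
    destruct IH as (N & HN); [intros; apply Hin; now right |].
    assert (Ho : In o os) by (apply Hin; now left).
    destruct (escape_block c (fst o) (snd o) (p o) l') as (s & t & N' & H1 & H2); auto.
    { apply (HT o Ho). }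
    { intros f Hf. apply (cs_der K); auto; now apply Hos. }
    exists (Z.max N N'). intros o' [<- | Ho'].
    - exists s, t. split; trivial. intros n Hn. apply H2. lia.
    - destruct (HN o' Ho') as (s' & t' & H1' & H2'). exists s', t'. split; trivial.
      intros n Hn. apply H2'. lia. }
  destruct (HN os (fun o Ho => Ho)) as (N & HNo). clear HN.
  exists l', (pw c N). split; [trivial | split; [| split; [now apply pw_K |]]].
  - intros n. destruct (Htall (S n)) as [x Hx].
    assert (exists g, K g /\ g x <> x) as (g & Hg & Hgx).
    { destruct Hx as (g & u & v & H & _). destruct (H O ltac:(lia)) as (Hg & _ & _ & Hm & Hxi). eauto. }
    destruct (Hcov x g Hg Hgx) as (o & Ho & Hxo). now apply (Hdesc o n x).
  - assert (Hpos : forall o s t x, In o os ->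
      (forall f x, In f l' -> fst o < x < snd o -> x <= s \/ t <= x -> f x = x) ->
      fst o < x < snd o -> supp (fgen l') x -> s <= x <= t).
    { intros o s t x Ho Hst Hxo (f & Hf & Hfx).
      assert (~ (x <= s \/ t <= x)); [| lra]. intros Hx. apply Hfx.
      apply (allfix_fgen l'); trivial; [intros h Hh; apply HK; auto |]. intros h Hh. auto. }
    intros x n (f & Hf & Hfx) Hn Hx'.
    destruct (Hcov x f (Hl'K' f Hf) Hfx) as (o & Ho & Hxo).
    destruct (HNo o Ho) as (s & t & H1 & H2).
    apply (pw_off (pw c N) s t x n); trivial.
    + now apply PL_pw.
    + apply H2. lia.
    + apply (Hpos o); trivial. now exists f.
    + apply (Hpos o); trivial. rewrite pw_mul by trivial. apply free_pw; auto.
Qed.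

Definition der_kernels (K : (R -> R) -> Prop) (os : list (R * R)) (g : R -> R) : Prop :=
  der K g /\ forall o x, In o os -> fst o < x < snd o -> g x = x.

Lemma group_der_kernels K os : group K -> group (der_kernels K os).
Proof.
  intros HK. assert (HD := group_der K HK). split.
  - intros g [Hg _]. now apply HD.
  - split; [apply HD | trivial].
  - intros g h [Hg Eg] [Hh Eh]. split; [now apply HD |].
    intros o x Ho Hx. unfold rmul. now rewrite (Eg o), (Eh o).
  - intros g [Hg Eg]. split; [now apply HD |]. intros o x Ho Hx.
    apply fix_finv; eauto. now apply HD.
Qed.

Lemma normed_der_kernels K os : group K ->
  (forall o, In o os -> orbital_of K (fst o) (snd o)) -> normed (der_kernels K os) K.
Proof.
  intros HK Hos g h [Hg Eg] Hh. split.
  - apply (normed_der K K); trivial. now apply normed_self.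
  - intros o x Ho Hx. destruct (Hos o Ho) as (_ & Ha & Hb & _).
    apply (normed_der_kernel K (fst o) (snd o)); trivial. split; eauto.
Qed.

(** The orbitals are added one at a time: a commutator of an element trivial on [o] with one trivial
    on [os] is trivial on both, and [comm_nofix] applies. *)
Lemma der_kernels_nofix l os a b : (forall g, In g l -> PL g) ->
  (forall o, In o os -> orbital_of (fgen l) (fst o) (snd o) /\
     ~ nofix (der (fgen l)) (fst o) (snd o)) ->
  orbital_of (fgen l) a b -> nofix (der (fgen l)) a b ->
  nofix (der_kernels (fgen l) os) a b.
Proof.
  intros Hl Hos HO HND. assert (HK := group_fgen l Hl). assert (HD := group_der _ HK).
  induction os as [|o os IH].
  { intros x Hx. destruct (HND x Hx) as (g & Hg & Hgx). exists g. split; trivial.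
    split; trivial. intros o y []. }
  destruct (Hos o (or_introl eq_refl)) as [Ho HNo].
  assert (IH' := IH (fun o Ho => Hos o (or_intror Ho))). clear IH.
  assert (Hker := der_kernel_nofix l a b (fst o) (snd o) HK HO Ho HND HNo).
  destruct HO as (Hab & Ha & Hb & _).
  apply (comm_nofix (fgen l) (der_kernel (fgen l) (fst o) (snd o)) (der_kernels (fgen l) os) _ a b);
    trivial.
  - now apply group_der_kernel.
  - now apply group_der_kernels.
  - intros g [Hg _]. now apply der_sub.
  - intros g [Hg _]. now apply der_sub.
  - intros g [Hg _]. now apply HD.
  - apply normed_der_kernels; trivial. intros o' Ho'. now apply Hos.
  - intros g h [Hg Eg] [Hh Eh].
    assert (Hpg : PL g) by now apply HD. assert (Hph : PL h) by now apply HD.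
    split; [now apply group_comm |]. intros o' x Ho' Hx. unfold comm.
    destruct (Hos o' Ho') as [(_ & Ha' & Hb' & _) _].
    assert (Hgab : forall f, fgen l f -> finv f (fst o') = fst o' /\ finv f (snd o') = snd o').
    { intros f Hf. split; apply fix_finv; auto; now apply HK. }
    destruct Ho' as [<- | Ho'].
    + rewrite (fix_finv g x) by auto. rewrite Eg; [now apply finv_r |].
      apply PL_between; trivial; [now apply PL_finv | |]; apply Hgab; now apply der_sub.
    + assert (Hx' : fst o' < finv g x < snd o').
      { apply PL_between; trivial; [now apply PL_finv | |]; apply Hgab; now apply der_sub. }
      rewrite (fix_finv h (finv g x)) by eauto. rewrite finv_r by trivial. eauto.
  - intros g [Hg _]. now apply (cs_der (fgen l)).
Qed.

Definition confined (os : list (R * R)) (D : R -> Prop) : Prop :=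
  exists s t : R * R -> R, (forall o, In o os -> fst o < s o /\ s o <= t o /\ t o < snd o) /\
    forall x, D x -> exists o, In o os /\ s o <= x <= t o.

(** [g] has compact support in each orbital, so enlarging [D] by the support of [g] gives a confined
    set again and the step can be repeated. *)
Lemma ascent_step K M os D : group K -> group M -> (forall g, M g -> K g) ->
  (forall o, In o os -> orbital_of K (fst o) (snd o) /\ nofix M (fst o) (snd o)) ->
  (forall g x, M g -> g x <> x -> exists o, In o os /\ fst o < x < snd o) ->
  (forall g o, M g -> In o os -> cs g (fst o) (snd o)) ->
  confined os D ->
  exists g, M g /\ moves_off g D /\ confined os (fun x => D x \/ g x <> x).
Proof.
  intros HK HM HMK Hos Hcov Hcs (s & t & Hst & HD).
  destruct (move_off M os HM) with (s := s) (t := t) as (g & Hg & Hoff); trivial.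
  { intros o Ho. destruct (Hos o Ho) as [(Hab & Ha & Hb & _) HN].
    split; [intros h Hh; auto | split; [intros h Hh; auto | trivial]]. }
  assert (Hpg : PL g) by now apply HM.
  exists g. split; [trivial | split].
  - intros x n Hx Hn Hx'.
    destruct (HD x Hx) as (o & Ho & Hxo). destruct (HD _ Hx') as (o' & Ho' & Hxo').
    destruct (Hst o Ho) as (S1 & S2 & S3). destruct (Hst o' Ho') as (S1' & S2' & S3').
    destruct (Hos o Ho) as [HO _]. destruct (Hos o' Ho') as [HO' _].
    (* Powers of [g] preserve each orbital, so a point and its image are compared within the same
       one. *)
    assert (Hin : fst o < pw g n x < snd o).
    { destruct HO as (_ & Ha & Hb & _).
      apply PL_between; [now apply PL_pw | apply Ha | apply Hb | lra]; apply pw_K; auto. }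
    destruct (orbital_unique K _ _ _ _ (pw g n x) HO HO') as [E1 E2]; [lra | lra |].
    assert (o = o') as <- by now apply injective_projections.
    apply (pw_off g (s o) (t o) x n); auto.
  - assert (Hex : forall o, exists st : R * R, In o os -> fst o < fst st /\ fst st <= snd st /\ snd st < snd o /\
      forall x, fst o < x < snd o -> g x <> x -> fst st <= x <= snd st).
    { intros o. destruct (classic (In o os)) as [Ho |]; [| exists (0, 0); tauto].
      destruct (Hcs g o Hg Ho) as (s' & t' & H1 & H2 & H3 & H4). exists (s', t'). intros _. simpl.
      repeat split; trivial.
      - destruct (Rle_lt_dec s' x); trivial. exfalso. apply H0, H4; lra.
      - destruct (Rle_lt_dec x t'); trivial. exfalso. apply H0, H4; lra. }
    set (st := fun o => proj1_sig (constructive_indefinite_description _ (Hex o))).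
    assert (Hspec : forall o, In o os -> fst o < fst (st o) /\ fst (st o) <= snd (st o) /\
      snd (st o) < snd o /\ forall x, fst o < x < snd o -> g x <> x -> fst (st o) <= x <= snd (st o)).
    { intros o Ho. unfold st. destruct (constructive_indefinite_description _ (Hex o)). simpl. auto. }
    exists (fun o => Rmin (s o) (fst (st o))), (fun o => Rmax (t o) (snd (st o))). split.
    + intros o Ho. destruct (Hst o Ho) as (S1 & S2 & S3). destruct (Hspec o Ho) as (T1 & T2 & T3 & _).
      repeat split; [now apply Rmin_glb_lt | | now apply Rmax_lub_lt].
      apply Rle_trans with (s o); [apply Rmin_l |]. apply Rle_trans with (t o); [lra | apply Rmax_l].
    + intros x [Hx | Hx].
      * destruct (HD x Hx) as (o & Ho & Hxo). exists o. split; trivial.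
        assert (L1 := Rmin_l (s o) (fst (st o))). assert (L2 := Rmax_l (t o) (snd (st o))). lra.
      * destruct (Hcov g x Hg Hx) as (o & Ho & Hxo). exists o. split; trivial.
        assert (L1 := Rmin_r (s o) (fst (st o))). assert (L2 := Rmax_r (t o) (snd (st o))).
        destruct (Hspec o Ho) as (_ & _ & _ & T). specialize (T x Hxo Hx). lra.
Qed.

(** * Nested supports generate iterated wreath products *)

(* The sets [shift g c n (D n)] are the translates of [D n], with address
   [c 0, ..., c (n - 1)]. *)
Fixpoint shift (g : nat -> R -> R) (c : Omega) (n : nat) (x : R) : R :=
  match n with O => x | S m => shift g c m (pw (g m) (c m) x) end.

Definition letter : Type := nat * Omega * Z.

Definition level (s : letter) : nat := fst (fst s).

Definition actO (s : letter) : Omega -> Omega := let '(j, y, e) := s in wz_gen j y e.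

(** The counterpart of [wz_gen j y e]: a power of [g j], carried over to the translate of [D j] with
    address [y]. *)
Definition actR (g : nat -> R -> R) (s : letter) : R -> R :=
  let '(j, y, e) := s in conjg (pw (g j) e) (shift g y j).

Definition evO (w : list letter) (c : Omega) : Omega := fold_left (fun c s => actO s c) w c.

Definition evR (g : nat -> R -> R) (w : list letter) (x : R) : R :=
  fold_left (fun x s => actR g s x) w x.

Lemma evO_cons s w c : evO (s :: w) c = evO w (actO s c).
Proof. reflexivity. Qed.

Lemma evR_cons g s w x : evR g (s :: w) x = evR g w (actR g s x).
Proof. reflexivity. Qed.

Lemma shift_ext g c y n x : (forall i, (i < n)%nat -> c i = y i) -> shift g c n x = shift g y n x.
Proof.
  revert x. induction n as [|n IH]; intros x H; simpl; trivial.
  rewrite (H n) by lia. apply IH. intros i Hi. apply H. lia.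
Qed.

Lemma shift_K K g c n : group K -> (forall i, K (g i)) -> K (shift g c n).
Proof.
  intros HK Hg. induction n as [|n IH]; [apply (g_id K HK) |].
  apply (g_mul K HK (pw (g n) (c n))); trivial. now apply pw_K.
Qed.

Lemma actR_K K g s : group K -> (forall i, K (g i)) -> K (actR g s).
Proof.
  intros HK Hg. destruct s as [[j y] e]. simpl. apply (group_conjg K); trivial.
  - now apply pw_K.
  - now apply shift_K.
Qed.

Lemma evR_K K g w : group K -> (forall i, K (g i)) -> K (evR g w).
Proof.
  intros HK Hg. induction w as [|s w IH] using rev_ind; [apply (g_id K HK) |].
  replace (evR g (w ++ s :: nil)) with (rmul (evR g w) (actR g s)).
  - apply HK; trivial. now apply actR_K.
  - extensionality x. unfold evR, rmul. now rewrite fold_left_app.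
Qed.

Lemma pw_supp (g : R -> R) (D : R -> Prop) n x : PL g -> (forall z, g z <> z -> D z) ->
  D x -> D (pw g n x).
Proof.
  intros Hg HD Hx. revert n. apply Z.bi_induction.
  - now intros ? ? ->.
  - trivial.
  - intros n. rewrite pw_succ by trivial. set (z := pw g n x).
    destruct (classic (g z = z)) as [-> | Hz]; [reflexivity |]. split; intros _.
    + apply HD. intros E. now apply PL_inj in E.
    + now apply HD.
Qed.

Lemma pw_moved g n x : PL g -> pw g n x <> x -> g x <> x.
Proof. intros Hg H E. apply H. now apply pw_fix. Qed.

Lemma conjg_fix f h x : PL h -> f (finv h x) = finv h x -> conjg f h x = x.
Proof. intros Hh E. unfold conjg. now rewrite E, finv_r. Qed.

Lemma wz_gen_in j y e c : (forall i, (i < j)%nat -> c i = y i) ->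
  wz_gen j y e c = upd c j (c j + e).
Proof.
  intros H. unfold wz_gen.
  destruct (ClassicalDescription.excluded_middle_informative
    (forall i, (i < j)%nat -> c i = y i)); [reflexivity | contradiction].
Qed.

Lemma wz_gen_out j y e c : ~ (forall i, (i < j)%nat -> c i = y i) -> wz_gen j y e c = c.
Proof.
  intros H. unfold wz_gen.
  destruct (ClassicalDescription.excluded_middle_informative
    (forall i, (i < j)%nat -> c i = y i)); [contradiction | reflexivity].
Qed.

Lemma upd_same c j v : upd c j v j = v.
Proof. unfold upd. now rewrite Nat.eqb_refl. Qed.

Lemma upd_other c j v i : i <> j -> upd c j v i = c i.
Proof. intros H. unfold upd. apply Nat.eqb_neq in H. now rewrite H. Qed.

Lemma wz_gen_other j y e c i : i <> j -> wz_gen j y e c i = c i.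
Proof.
  intros H. destruct (classic (forall i, (i < j)%nat -> c i = y i)).
  - rewrite wz_gen_in by trivial. now apply upd_other.
  - now rewrite wz_gen_out.
Qed.

(** Truncated at [k] in order to cover an infinite descending family and also, read backwards, the
    first [k] steps of an ascending one. *)
Record nested (k : nat) (g : nat -> R -> R) (D : nat -> R -> Prop) : Prop := {
  n_pl : forall i, PL (g i);
  n_supp : forall i x, (i < k)%nat -> g i x <> x -> D i x;
  n_sub : forall i x, (i < k)%nat -> D (S i) x -> D i x;
  n_off : forall i, (i < k)%nat -> moves_off (g i) (D (S i)) }.

Lemma nested_pw k g D i n x : nested k g D -> (i < k)%nat -> D i x -> D i (pw (g i) n x).
Proof.
  intros HN Hi. apply pw_supp; [apply HN |]. intros z. now apply (n_supp k g D HN).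
Qed.

Lemma shift_PL k g D c n : nested k g D -> PL (shift g c n).
Proof. intros HN. apply shift_K; [apply group_PL | apply HN]. Qed.

Lemma shift_descend k g D c n m x : nested k g D -> (n <= m <= k)%nat -> D m x ->
  exists z, D n z /\ shift g c m x = shift g c n z.
Proof.
  intros HN. revert x. induction m as [|m IH]; intros x Hm Hx.
  { exists x. now replace n with O by lia. }
  destruct (Nat.eq_dec n (S m)) as [-> | Hn]; [eauto |].
  simpl. apply IH; [lia |]. apply (nested_pw k g D); trivial; [lia |].
  apply (n_sub k g D HN); trivial. lia.
Qed.

(** Translates with different addresses are disjoint: at the last coordinate where they differed, a
    nonzero power of the generator would bring the next set back to itself. *)
Lemma shift_disjoint k g D c y n z1 z2 : nested k g D -> (n <= k)%nat -> D n z1 -> D n z2 ->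
  shift g c n z1 = shift g y n z2 -> (forall i, (i < n)%nat -> c i = y i) /\ z1 = z2.
Proof.
  intros HN. revert z1 z2. induction n as [|n IH]; intros z1 z2 Hn H1 H2 E.
  { split; trivial. lia. }
  assert (Hg : PL (g n)) by apply HN. simpl in E.
  apply IH in E; [| lia | apply (nested_pw k); trivial; apply (n_sub k g D HN); trivial; lia
    | apply (nested_pw k); trivial; apply (n_sub k g D HN); trivial; lia].
  destruct E as [Hc E].
  assert (E' : z1 = pw (g n) (- c n + y n) z2).
  { rewrite pw_add, <- E by trivial. symmetry. apply pw_cancel; trivial; lia. }
  destruct (Z.eq_dec (c n) (y n)) as [Hcn | Hcn].
  - split.
    + intros i Hi. destruct (Nat.eq_dec i n) as [-> |]; trivial. apply Hc. lia.
    + rewrite E', Hcn. now replace (- y n + y n)%Z with 0%Z by lia.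
  - exfalso. apply (n_off k g D HN n Hn z2 (- c n + y n)%Z); trivial; [lia |]. now rewrite <- E'.
Qed.

(** A letter acts on a translate by changing its address. If the addresses do not match,
    disjointness puts the translate outside the support of the letter. *)
Lemma actR_shift k g D s c n z : nested k g D -> (S n <= k)%nat -> D n z -> (level s <= n)%nat ->
  actR g s (shift g c (S n) z) = shift g (actO s c) (S n) z.
Proof.
  intros HN Hn Hz Hs. destruct s as [[j y] e]. unfold level in Hs. simpl in Hs.
  unfold actR, actO. assert (Hg : forall i, PL (g i)) by apply HN.
  assert (Hsame : forall m z', (m < k)%nat -> j = m -> D m z' ->
    conjg (pw (g j) e) (shift g y j) (shift g c (S m) z') = shift g (wz_gen j y e c) (S m) z').
  { intros m z' Hm -> Hz'.
    assert (HU : PL (shift g y m)) by now apply (shift_PL k g D).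
    assert (Hz'' : D m (pw (g m) (c m) z')) by now apply (nested_pw k).
    destruct (classic (forall i, (i < m)%nat -> c i = y i)) as [Hcy | Hcy].
    - rewrite wz_gen_in by trivial. simpl.
      rewrite (shift_ext g c y m) by trivial. unfold conjg. rewrite finv_l by trivial.
      rewrite (shift_ext g (upd c m (c m + e)) y m) by
        (intros i Hi; rewrite upd_other by lia; auto).
      rewrite upd_same, <- pw_add by trivial. now rewrite Z.add_comm.
    - rewrite wz_gen_out by trivial. simpl.
      apply conjg_fix; trivial. apply NNPP. intros Hmv. apply pw_moved in Hmv; trivial.
      apply (n_supp k g D HN) in Hmv; trivial. apply Hcy.
      apply (shift_disjoint k g D c y m _ _ HN ltac:(lia) Hz'' Hmv). now rewrite finv_r. }
  revert z Hn Hz Hs. induction n as [|n IH]; intros z Hn Hz Hs.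
  - apply Hsame; trivial; lia.
  - destruct (Nat.eq_dec j (S n)) as [E | E]; [apply Hsame; trivial; lia |].
    change (shift g c (S (S n)) z) with (shift g c (S n) (pw (g (S n)) (c (S n)) z)).
    rewrite IH; [| lia | | lia].
    + change (shift g (wz_gen j y e c) (S (S n)) z) with
        (shift g (wz_gen j y e c) (S n) (pw (g (S n)) (wz_gen j y e c (S n)) z)).
      rewrite wz_gen_other; auto.
    + apply (n_sub k g D HN); [lia |]. apply (nested_pw k); trivial.
Qed.

(* A point of [D n] lying in no translate of [D (S n)] is not reached by the levels above [n]. *)
Definition terminal (g : nat -> R -> R) (D : nat -> R -> Prop) (n : nat) (z : R) : Prop :=
  D n z /\ forall m, ~ D (S n) (pw (g n) m z).

(** The support of a letter above level [n] lies in translates of [D (S n)], which the orbit of a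
    terminal point avoids; on addresses such a letter changes only later coordinates. *)
Lemma actR_terminal k g D s c n z : nested k g D -> (n < k)%nat -> terminal g D n z ->
  (level s < k)%nat -> actR g s (shift g c (S n) z) = shift g (actO s c) (S n) z.
Proof.
  intros HN Hn [Hz Hterm] Hs.
  destruct (Nat.le_gt_cases (level s) n) as [Hsn | Hsn]; [now apply (actR_shift k g D) |].
  destruct s as [[j y] e]. unfold level in Hs, Hsn. simpl in Hs, Hsn. unfold actR, actO.
  assert (Hg : forall i, PL (g i)) by apply HN.
  rewrite (shift_ext g (wz_gen j y e c) c) by (intros i Hi; apply wz_gen_other; lia).
  assert (HU : PL (shift g y j)) by now apply (shift_PL k g D).
  apply conjg_fix; trivial. apply NNPP. intros Hmv. apply pw_moved in Hmv; trivial.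
  apply (n_supp k g D HN) in Hmv; trivial.
  destruct (shift_descend k g D y (S n) j _ HN ltac:(lia) Hmv) as (t & Ht & E).
  rewrite finv_r in E by trivial. simpl in E.
  destruct (shift_disjoint k g D c y n (pw (g n) (c n) z) (pw (g n) (y n) t) HN) as [_ E'];
    trivial; [lia | now apply (nested_pw k) | |].
  { apply (nested_pw k); trivial. now apply (n_sub k g D HN). }
  apply (Hterm (- y n + c n)%Z). rewrite pw_add, E', pw_cancel by (trivial; lia). trivial.
Qed.

(** Follow the point into the nested sets, recording its address, until no power leads into the next
    set or level [n] is reached. *)
Lemma decompose k g D x n : nested k g D -> (n <= k)%nat -> D O x ->
  (exists i c z, (i < n)%nat /\ terminal g D i z /\ x = shift g c (S i) z) \/
  exists c z, D n z /\ x = shift g c n z.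
Proof.
  intros HN Hn Hx. induction n as [|n IH]; [right; now exists (fun _ => 0%Z), x |].
  assert (Hg : PL (g n)) by apply HN.
  destruct IH as [(i & c & z & Hi & Hz & E) | (c & z & Hz & E)]; [lia | left; exists i, c, z; auto |].
  destruct (classic (exists m, D (S n) (pw (g n) m z))) as [[m Hm] | Hno].
  (* The new coordinate undoes the power that led into [D (S n)]. *)
  - right. exists (upd c n (- m)), (pw (g n) m z). split; trivial. simpl.
    rewrite upd_same, pw_cancel by (trivial; lia). rewrite E.
    apply shift_ext. intros i Hi. rewrite upd_other; trivial; lia.
  - left. exists n, (upd c n 0), z. split; [lia |]. split.
    + split; trivial. intros m Hm. eauto.
    + simpl. rewrite upd_same, pw_0, E.
      apply shift_ext. intros i Hi. rewrite upd_other; trivial; lia.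
Qed.

Lemma evR_shift k g D w c n z : nested k g D -> (n <= k)%nat -> D n z ->
  (forall s, In s w -> (level s < n)%nat) -> evR g w (shift g c n z) = shift g (evO w c) n z.
Proof.
  intros HN Hn Hz. revert c. induction w as [|s w IH]; intros c Hw; trivial. rewrite evR_cons, evO_cons.
  assert (Hs : (level s < n)%nat) by (apply Hw; now left).
  destruct n as [|n]; [lia |].
  rewrite (actR_shift k g D) by (trivial; try lia; now apply (n_sub k g D HN)).
  apply IH. intros s' Hs'. apply Hw. now right.
Qed.

Lemma evR_terminal k g D w c n z : nested k g D -> (n < k)%nat -> terminal g D n z ->
  (forall s, In s w -> (level s < k)%nat) -> evR g w (shift g c (S n) z) = shift g (evO w c) (S n) z.
Proof.
  intros HN Hn Hz. revert c. induction w as [|s w IH]; intros c Hw; trivial. rewrite evR_cons, evO_cons.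
  rewrite (actR_terminal k g D) by (trivial; apply Hw; now left).
  apply IH. intros s' Hs'. apply Hw. now right.
Qed.

Lemma evR_outside k g D w x : nested k g D -> ~ D O x ->
  (forall s, In s w -> (level s < k)%nat) -> evR g w x = x.
Proof.
  intros HN Hx. induction w as [|[[j y] e] w IH]; intros Hw; trivial. simpl.
  assert (Hj : (j < k)%nat) by (apply (Hw (j, y, e)); now left).
  assert (HU : PL (shift g y j)) by now apply (shift_PL k g D).
  rewrite conjg_fix; trivial.
  - apply IH. intros s' Hs'. apply Hw. now right.
  - apply NNPP. intros Hmv. apply pw_moved in Hmv; [| apply HN].
    apply (n_supp k g D HN) in Hmv; trivial.
    destruct (shift_descend k g D y 0 j _ HN ltac:(lia) Hmv) as (t & Ht & E).
    rewrite finv_r in E by trivial. simpl in E. apply Hx. now rewrite E.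
Qed.

Lemma evO_high k w c i : (forall s, In s w -> (level s < k)%nat) -> (k <= i)%nat -> evO w c i = c i.
Proof.
  intros Hw Hi. revert c Hw. induction w as [|[[j y] e] w IH]; intros c Hw; trivial. simpl.
  rewrite IH by (intros s Hs; apply Hw; now right).
  apply wz_gen_other. assert (H := Hw (j, y, e) (or_introl eq_refl)). unfold level in H. simpl in H. lia.
Qed.

(** By [decompose] a word acts on the line only through addresses. Conversely, the translates of one
    point of [D k] reveal the first [k] coordinates of an address, and later ones never change. *)
Lemma ev_faithful k g D w w' : nested k g D -> (exists x, D k x) ->
  (forall s, In s w -> (level s < k)%nat) -> (forall s, In s w' -> (level s < k)%nat) ->
  evO w = evO w' <-> evR g w = evR g w'.
Proof.
  intros HN [x0 Hx0] Hw Hw'. split; intros E.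
  - extensionality x. destruct (classic (D O x)) as [Hx | Hx].
    + destruct (decompose k g D x k HN (le_n k) Hx) as [(i & c & z & Hi & Hz & ->) | (c & z & Hz & ->)].
      * rewrite !(evR_terminal k g D) by trivial. now rewrite E.
      * rewrite !(evR_shift k g D) by (trivial; lia). now rewrite E.
    + now rewrite !(evR_outside k g D).
  - extensionality c. extensionality i.
    destruct (Nat.lt_ge_cases i k) as [Hi | Hi]; [| now rewrite !(evO_high k)].
    apply (shift_disjoint k g D (evO w c) (evO w' c) k x0 x0 HN); trivial.
    rewrite <- !(evR_shift k g D) by (trivial; lia). now rewrite E.
Qed.

(** * Embeddings defined through words *)

(** Choose any word for each element: the equivalence makes the image independent of the choice in
    one direction and the map injective in the other. *)
Lemma embeds_by_words (L : Type) (G : (Omega -> Omega) -> Prop) (H : (R -> R) -> Prop)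
  (eO : list L -> Omega -> Omega) (eR : list L -> R -> R) :
  (forall a, G a -> exists w, a = eO w) ->
  (forall w w' c, eO (w ++ w') c = eO w' (eO w c)) ->
  (forall w w' x, eR (w ++ w') x = eR w' (eR w x)) ->
  (forall w, H (eR w)) ->
  (forall w w', eO w = eO w' <-> eR w = eR w') ->
  embeds_in G H.
Proof.
  intros HG HO HR HH Hiff.
  set (word := fun a => epsilon (inhabits nil) (fun w : list L => a = eO w)).
  assert (Hword : forall a, G a -> a = eO (word a)).
  { intros a Ha. unfold word. apply epsilon_spec. auto. }
  exists (fun a => eR (word a)). split; [| split].
  - intros a _. apply HH.
  - intros a b Ha Hb.
    transitivity (eR (word a ++ word b)).
    + assert (Hab : (fun c => b (a c)) = eO (word a ++ word b)).
      { extensionality c. rewrite HO, <- Hword, <- Hword; trivial. }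
      apply Hiff. rewrite <- Hab. symmetry. unfold word. apply epsilon_spec. eauto.
    + extensionality x. apply HR.
  - intros a b Ha Hb E. rewrite (Hword a), (Hword b) by trivial. now apply Hiff.
Qed.

Lemma list_bound {A} (f : A -> nat) (l : list A) : exists k, forall s, In s l -> (f s < k)%nat.
Proof.
  induction l as [|a l [k IH]]; [exists O; intros s [] |].
  exists (S (f a + k)). intros s [<- | Hs]; [lia |]. specialize (IH s Hs). lia.
Qed.

Lemma descending_embeds H g (D : nat -> R -> Prop) : group H -> (forall i, H (g i)) ->
  (forall i x, g i x <> x -> D i x) -> (forall i x, D (S i) x -> D i x) ->
  (forall i, moves_off (g i) (D (S i))) -> (forall i, exists x, D i x) ->
  embeds_in WrZ_infty H.
Proof.
  intros HH Hg Hsupp Hsub Hoff Hne.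
  apply (embeds_by_words letter _ _ evO (evR g)).
  - intros a. induction 1 as [| f s Hf [w ->] (j & y & e & ->)]; [now exists nil |].
    exists (w ++ (j, y, e) :: nil). extensionality c. unfold evO. now rewrite fold_left_app.
  - intros w w' c. apply fold_left_app.
  - intros w w' x. apply fold_left_app.
  - intros w. now apply evR_K.
  (* Only two words are compared at a time, so a finite truncation suffices. *)
  - intros w w'. destruct (list_bound level (w ++ w')) as [k Hk].
    apply (ev_faithful k g D); auto.
    + split; auto. intros i. now apply HH.
    + intros s Hs. apply Hk, in_or_app. now left.
    + intros s Hs. apply Hk, in_or_app. now right.
Qed.

(** * Ascending supports, by reversal of the coordinates *)

Definition zletter : Type := nat * Z.

Definition evZ (w : list zletter) (c : Omega) : Omega :=
  fold_left (fun c s => zw_gen (fst s) (snd s) c) w c.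

Definition evP (g : nat -> R -> R) (w : list zletter) (x : R) : R :=
  fold_left (fun x s => pw (g (fst s)) (snd s) x) w x.

(** On sequences vanishing from [k] on, this turns the condition that later coordinates are zero
    into the condition that earlier ones are, that is, [zw_gen] into [wz_gen] at address zero. *)
Definition rev_coord (k : nat) (c : Omega) : Omega :=
  fun i => if (i <? k)%nat then c (k - 1 - i)%nat else c i.

Definition rev_letter (k : nat) (s : zletter) : letter :=
  ((k - 1 - fst s)%nat, (fun _ => 0%Z), snd s).

Lemma rev_coord_invol k c : rev_coord k (rev_coord k c) = c.
Proof.
  extensionality i. unfold rev_coord. destruct (Nat.ltb_spec i k) as [Hi | Hi]; trivial.
  destruct (Nat.ltb_spec (k - 1 - i) k); [f_equal | ]; lia.
Qed.

Definition vanishes (k : nat) (c : Omega) : Prop := forall i, (k <= i)%nat -> c i = 0%Z.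

Lemma zw_gen_in j e c : (forall i, (j < i)%nat -> c i = 0%Z) ->
  zw_gen j e c = upd c j (c j + e).
Proof.
  intros H. unfold zw_gen.
  destruct (ClassicalDescription.excluded_middle_informative
    (forall i, (j < i)%nat -> c i = 0%Z)); [reflexivity | contradiction].
Qed.

Lemma zw_gen_out j e c : ~ (forall i, (j < i)%nat -> c i = 0%Z) -> zw_gen j e c = c.
Proof.
  intros H. unfold zw_gen.
  destruct (ClassicalDescription.excluded_middle_informative
    (forall i, (j < i)%nat -> c i = 0%Z)); [contradiction | reflexivity].
Qed.

Lemma zw_gen_other j e c i : i <> j -> zw_gen j e c i = c i.
Proof.
  intros H. destruct (classic (forall i, (j < i)%nat -> c i = 0%Z)).
  - rewrite zw_gen_in by trivial. now apply upd_other.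
  - now rewrite zw_gen_out.
Qed.

Lemma rev_zw_gen k j e c : (j < k)%nat -> vanishes k c ->
  rev_coord k (zw_gen j e c) = actO (rev_letter k (j, e)) (rev_coord k c).
Proof.
  intros Hj Hc. unfold actO, rev_letter. simpl.
  assert (Hiff : (forall i, (j < i)%nat -> c i = 0%Z) <->
    forall i, (i < k - 1 - j)%nat -> rev_coord k c i = 0%Z).
  { split; intros H i Hi.
    - unfold rev_coord. rewrite (proj2 (Nat.ltb_lt i k)) by lia. apply H. lia.
    - destruct (Nat.lt_ge_cases i k) as [Hik | Hik]; [| auto].
      specialize (H (k - 1 - i)%nat ltac:(lia)). unfold rev_coord in H.
      rewrite (proj2 (Nat.ltb_lt (k - 1 - i) k)) in H by lia.
      now replace (k - 1 - (k - 1 - i))%nat with i in H by lia. }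
  destruct (classic (forall i, (j < i)%nat -> c i = 0%Z)) as [H | H].
  - rewrite zw_gen_in, wz_gen_in by tauto. extensionality i. unfold rev_coord, upd.
    destruct (Nat.ltb_spec i k), (Nat.eqb_spec i (k - 1 - j)), (Nat.ltb_spec (k - 1 - j) k); try lia.
    + rewrite (proj2 (Nat.eqb_eq (k - 1 - i) j)) by lia.
      now replace (k - 1 - (k - 1 - j))%nat with j by lia.
    + now rewrite (proj2 (Nat.eqb_neq (k - 1 - i) j)) by lia.
    + now rewrite (proj2 (Nat.eqb_neq i j)) by lia.
  - rewrite zw_gen_out, wz_gen_out by tauto. trivial.
Qed.

Lemma rev_evZ k w c : (forall s, In s w -> (fst s < k)%nat) -> vanishes k c ->
  vanishes k (evZ w c) /\ rev_coord k (evZ w c) = evO (map (rev_letter k) w) (rev_coord k c).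
Proof.
  revert c. induction w as [|[j e] w IH]; intros c Hw Hc; [now split |].
  change (vanishes k (evZ w (zw_gen j e c)) /\ rev_coord k (evZ w (zw_gen j e c)) =
    evO (map (rev_letter k) w) (actO (rev_letter k (j, e)) (rev_coord k c))).
  assert (Hj : (j < k)%nat) by (apply (Hw (j, e)); now left).
  rewrite <- (rev_zw_gen k j e c) by trivial. apply IH.
  - intros s Hs. apply Hw. now right.
  - intros i Hi. rewrite zw_gen_other by lia. auto.
Qed.

Lemma evZ_not_vanishes k w c : (forall s, In s w -> (fst s < k)%nat) -> ~ vanishes k c ->
  evZ w c = c.
Proof.
  intros Hw Hc. induction w as [|[j e] w IH]; trivial. simpl.
  assert (Hj : (j < k)%nat) by (apply (Hw (j, e)); now left).
  replace (zw_gen j e c) with c; [apply IH; intros s Hs; apply Hw; now right |].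
  symmetry. apply zw_gen_out. intros H. apply Hc. intros i Hi. apply H. lia.
Qed.

Lemma evO_agree k w c d : (forall s, In s w -> (level s < k)%nat) ->
  (forall i, (i < k)%nat -> c i = d i) -> forall i, (i < k)%nat -> evO w c i = evO w d i.
Proof.
  revert c d. induction w as [|[[j y] e] w IH]; intros c d Hw Hcd; trivial. simpl.
  assert (Hj : (j < k)%nat) by (apply (Hw (j, y, e)); now left).
  apply IH; [intros s Hs; apply Hw; now right |].
  intros i Hi. destruct (classic (forall i, (i < j)%nat -> c i = y i)) as [H | H].
  - rewrite !wz_gen_in by (intros; rewrite <- ?Hcd by lia; auto).
    unfold upd. rewrite (Hcd j) by trivial. destruct (Nat.eqb i j); auto.
  - rewrite !wz_gen_out; auto. intros H'. apply H. intros i' Hi'. rewrite Hcd by lia. auto.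
Qed.

Lemma evZ_evO k w w' : (forall s, In s w -> (fst s < k)%nat) -> (forall s, In s w' -> (fst s < k)%nat) ->
  evZ w = evZ w' <-> evO (map (rev_letter k) w) = evO (map (rev_letter k) w').
Proof.
  intros Hw Hw'.
  assert (Hlev : forall w, (forall s, In s w -> (fst s < k)%nat) ->
    forall s, In s (map (rev_letter k) w) -> (level s < k)%nat).
  { intros v Hv s Hs. apply in_map_iff in Hs. destruct Hs as ([j e] & <- & Hs).
    specialize (Hv _ Hs). unfold level, rev_letter. simpl in *. lia. }
  assert (Lw := Hlev w Hw). assert (Lw' := Hlev w' Hw'). split; intros E.
  - extensionality c. extensionality i.
    destruct (Nat.lt_ge_cases i k) as [Hi | Hi]; [| now rewrite !(evO_high k)].
    (* Words of level below [k] neither read nor change the coordinates from [k] on; setting these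
       to zero leads to the sequences on which the reversal intertwines the two actions. *)
    set (c0 := fun i => if (i <? k)%nat then c i else 0%Z).
    assert (Hc0 : forall i, (i < k)%nat -> c i = c0 i).
    { intros i' Hi'. unfold c0. now rewrite (proj2 (Nat.ltb_lt i' k)). }
    rewrite (evO_agree k _ c c0), (evO_agree k _ c c0) by trivial.
    assert (Hv : vanishes k (rev_coord k c0)).
    { intros i' Hi'. unfold rev_coord, c0. now rewrite !(proj2 (Nat.ltb_ge i' k)). }
    rewrite <- (rev_coord_invol k c0).
    rewrite <- (proj2 (rev_evZ k w _ Hw Hv)), <- (proj2 (rev_evZ k w' _ Hw' Hv)). now rewrite E.
  - extensionality c. destruct (classic (vanishes k c)) as [Hc | Hc].
    + rewrite <- (rev_coord_invol k (evZ w c)), <- (rev_coord_invol k (evZ w' c)).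
      now rewrite (proj2 (rev_evZ k w c Hw Hc)), (proj2 (rev_evZ k w' c Hw' Hc)), E.
    + now rewrite !(evZ_not_vanishes k).
Qed.

Lemma shift_zero g n x : shift g (fun _ => 0%Z) n x = x.
Proof. induction n as [|n IH]; trivial. Qed.

(** The reversed letters have address zero, so the conjugating [shift] is the identity. *)
Lemma evP_evR k g w x : (forall s, In s w -> (fst s < k)%nat) ->
  evP g w x = evR (fun i => g (k - 1 - i)%nat) (map (rev_letter k) w) x.
Proof.
  revert x. induction w as [|[j e] w IH]; intros x Hw; trivial. simpl.
  assert (Hj : (j < k)%nat) by (apply (Hw (j, e)); now left).
  rewrite IH by (intros s Hs; apply Hw; now right). f_equal. unfold conjg.
  rewrite shift_zero. replace (k - 1 - (k - 1 - j))%nat with j by lia. f_equal.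
  set (h := shift _ _ _). assert (Hh : forall z, h z = z) by (intros z; apply shift_zero).
  unfold finv. rewrite <- (epsilon_spec (inhabits 0) (fun z => h z = x)) at 1 by (exists x; apply Hh).
  apply Hh.
Qed.

Lemma ascending_embeds H g (E : nat -> R -> Prop) : group H -> (forall i, H (g i)) ->
  (forall i x, g i x <> x -> E (S i) x) -> (forall i x, E i x -> E (S i) x) ->
  (forall i, moves_off (g i) (E i)) -> (exists x, E O x) ->
  embeds_in ZWr_infty H.
Proof.
  intros HH Hg Hsupp Hsub Hoff Hne.
  apply (embeds_by_words zletter _ _ evZ (evP g)).
  - intros a. induction 1 as [| f s Hf [w ->] (j & e & ->)]; [now exists nil |].
    exists (w ++ (j, e) :: nil). extensionality c. unfold evZ. now rewrite fold_left_app.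
  - intros w w' c. apply fold_left_app.
  - intros w w' x. apply fold_left_app.
  - intros w. induction w as [|s w IH] using rev_ind; [apply (g_id H HH) |].
    replace (evP g (w ++ s :: nil)) with (rmul (evP g w) (pw (g (fst s)) (snd s))).
    + apply HH; trivial. now apply pw_K.
    + extensionality x. unfold evP, rmul. now rewrite fold_left_app.
  - intros w w'. destruct (list_bound fst (w ++ w')) as [k Hk].
    assert (Hw : forall s, In s w -> (fst s < k)%nat) by (intros s Hs; apply Hk, in_or_app; now left).
    assert (Hw' : forall s, In s w' -> (fst s < k)%nat) by (intros s Hs; apply Hk, in_or_app; now right).
    assert (Hlev : forall w, (forall s, In s w -> (fst s < k)%nat) ->
      forall s, In s (map (rev_letter k) w) -> (level s < k)%nat).
    { intros v Hv s Hs. apply in_map_iff in Hs. destruct Hs as ([j e] & <- & Hs).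
      specialize (Hv _ Hs). unfold level, rev_letter. simpl in *. lia. }
    rewrite (evZ_evO k w w') by trivial.
    (* Read backwards from [E k], the ascending sets are nested, with the nonempty set [E O]
       innermost. *)
    rewrite (ev_faithful k (fun i => g (k - 1 - i)%nat) (fun i => E (k - i)%nat)); auto.
    + split; intros Eq; extensionality x; assert (Eqx := f_equal (fun f => f x) Eq); simpl in Eqx.
      * now rewrite !(evP_evR k).
      * now rewrite <- !(evP_evR k).
    + split.
      * intros i. now apply HH.
      * intros i x Hi Hx. replace (k - i)%nat with (S (k - 1 - i)) by lia. now apply Hsupp.
      * intros i x Hi Hx. replace (k - i)%nat with (S (k - S i)) by lia. now apply Hsub.
      * intros i Hi. replace (k - S i)%nat with (k - 1 - i)%nat by lia. apply Hoff.
    + now rewrite Nat.sub_diag.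
    + now apply Hlev.
    + now apply Hlev.
Qed.

(** * Assembling the two cases *)

Lemma list_filter {A} (P : A -> Prop) (l : list A) :
  exists l', forall x, In x l' <-> In x l /\ P x.
Proof.
  induction l as [|a l [l' IH]]; [exists nil; intros x; simpl; tauto |].
  destruct (classic (P a)) as [Ha | Ha].
  - exists (a :: l'). intros x. simpl. rewrite IH. split; [intros [<- | ]; tauto | tauto].
  - exists l'. intros x. simpl. rewrite IH. split; [tauto | intros [[<- | ] ?]; tauto].
Qed.

Lemma typeI_embeds H l a b : group H -> (forall g, In g l -> H g) ->
  orbital_of (fgen l) a b -> nofix (der (fgen l)) a b -> embeds_in ZWr_infty H.
Proof.
  intros HH Hl HO HND.
  assert (Hlp : forall g, In g l -> PL g) by (intros g Hg; apply HH; auto).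
  set (K := fgen l) in *. assert (HK : group K) by now apply group_fgen.
  assert (HKH : forall g, K g -> H g) by (intros g; now apply gen_incl).
  destruct (orbital_cover l Hlp) as (os & Hos & Hcov). fold K in Hos, Hcov.
  destruct (list_filter (fun o => nofix (der K) (fst o) (snd o)) os) as [os1 H1].
  destruct (list_filter (fun o => ~ nofix (der K) (fst o) (snd o)) os) as [os2 H2].
  set (M := der_kernels K os2).
  assert (HM : group M) by now apply group_der_kernels.
  assert (HMK : forall g, M g -> K g) by (intros g [Hg _]; now apply der_sub).
  assert (Hos1 : forall o, In o os1 -> orbital_of K (fst o) (snd o) /\ nofix M (fst o) (snd o)).
  { intros o Ho. apply H1 in Ho. destruct Ho as [Ho HN]. split; [auto |].
    apply der_kernels_nofix; auto. intros o' Ho'. apply H2 in Ho'. split; [apply Hos |]; apply Ho'. }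
  assert (Hcov1 : forall g x, M g -> g x <> x -> exists o, In o os1 /\ fst o < x < snd o).
  { intros g x Hg Hgx. destruct (Hcov x g (HMK g Hg) Hgx) as (o & Ho & Hxo).
    exists o. split; trivial. apply H1. split; trivial. apply NNPP. intros HN.
    apply Hgx. apply (proj2 Hg o); trivial. apply H2. now split. }
  assert (Hcs : forall g o, M g -> In o os1 -> cs g (fst o) (snd o)).
  { intros g o [Hg _] Ho. destruct (Hos1 o Ho) as [(Hab & Ha & Hb & _) _]. now apply (cs_der K). }
  set (good := fun D g => M g /\ moves_off g D /\ confined os1 (fun x => D x \/ g x <> x)).
  set (next := fun D => epsilon (inhabits (fun x : R => x)) (good D)).
  (* The midpoints are just a confined set to start from, nonempty because one of the listed
     orbitals is the given one. Each further set absorbs the support of the element that moves the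
     previous set off itself. *)
  set (E := fix E n := match n with
    | O => fun x => exists o, In o os1 /\ x = (fst o + snd o) / 2
    | S m => fun x => E m x \/ next (E m) x <> x end).
  assert (HE : forall n, confined os1 (E n) /\ good (E n) (next (E n))).
  { assert (Hgood : forall D, confined os1 D -> good D (next D)).
    { intros D HD. apply epsilon_spec. now apply (ascent_step K). }
    induction n as [|n [IH1 IH2]].
    - assert (confined os1 (E O)); [| auto].
      exists (fun o => (fst o + snd o) / 2), (fun o => (fst o + snd o) / 2). split.
      + intros o Ho. destruct (Hos1 o Ho) as [[Hab _] _]. lra.
      + intros x (o & Ho & ->). exists o. split; trivial. lra.
    - assert (confined os1 (E (S n))) by apply IH2. auto. }
  apply (ascending_embeds H (fun n => next (E n)) E); trivial.
  - intros n. apply HKH, HMK, HE.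
  - intros n x Hx. now right.
  - intros n x Hx. now left.
  - intros n. apply HE.
  - exists ((a + b) / 2). assert (Hab : a < b) by apply HO.
    destruct (HND ((a + b) / 2)) as (g & Hg & Hgx); [lra |].
    destruct (Hcov _ g (der_sub K g HK Hg) Hgx) as (o & Ho & Hxo).
    destruct (orbital_unique K a b (fst o) (snd o) ((a + b) / 2)) as [-> ->]; auto; [lra |].
    exists o. split; trivial. now apply H1.
Qed.

(** Every step of the descent yields a new finitely generated group, so the assumption on orbitals
    is made for all of them. The supports of these groups are the nested sets. *)
Lemma no_typeI_embeds H l : group H -> (forall g, In g l -> H g) ->
  (forall l' a b, (forall g, In g l' -> H g) -> orbital_of (fgen l') a b ->
     ~ nofix (der (fgen l')) a b) ->
  tall (fgen l) -> embeds_in WrZ_infty H.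
Proof.
  intros HH Hl Hno Htall.
  set (good := fun l (p : list (R -> R) * (R -> R)) => (forall f, In f (fst p) -> fgen l f) /\
    tall (fgen (fst p)) /\ fgen l (snd p) /\ moves_off (snd p) (supp (fgen (fst p)))).
  set (next := fun l => epsilon (inhabits (nil, fun x : R => x)) (good l)).
  set (L := fix L n := match n with O => l | S m => fst (next (L m)) end).
  assert (HL : forall n, (forall g, In g (L n) -> H g) /\ tall (fgen (L n)) /\ good (L n) (next (L n))).
  { assert (Hgood : forall l', (forall g, In g l' -> H g) -> tall (fgen l') -> good l' (next l')).
    { intros l' Hl' Ht. apply epsilon_spec.
      destruct (descent_step l') as (l'' & g & D1 & D2 & D3 & D4); auto.
      - intros g Hg. apply HH. auto.
      - now exists (l'', g). }
    induction n as [|n (IH1 & IH2 & IH3)]; [auto |].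
    assert (I1 : forall g, In g (L (S n)) -> H g).
    { intros g Hg. apply IH3 in Hg. revert Hg. now apply gen_incl. }
    assert (I2 : tall (fgen (L (S n)))) by apply IH3. auto. }
  assert (HGL : forall n, group (fgen (L n))).
  { intros n. apply group_fgen. intros g Hg. apply HH. now apply (proj1 (HL n)). }
  apply (descending_embeds H (fun n => snd (next (L n))) (fun n => supp (fgen (L n)))); trivial.
  - intros n. destruct (HL n) as (I1 & _ & _ & _ & I4 & _). revert I4. now apply gen_incl.
  - intros n x Hx. exists (snd (next (L n))). split; trivial. apply HL.
  - intros n x (g & Hg & Hgx). exists g. split; trivial. revert Hg. apply gen_incl; trivial.
    apply HL.
  - intros n. apply HL.
  - intros n. destruct (proj1 (proj2 (HL n)) 1%nat) as (x & g & u & v & Ht & _).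
    destruct (Ht O) as (Hg & _ & _ & Hm & Hx); [lia |]. exists x, (g O). auto.
Qed.

Theorem theorem9 (gens : list (R -> R)) :
  (forall g, In g gens -> is_PLo g) ->
  arbitrarily_large_towers (subgroup_gen (fun g => In g gens)) ->
  embeds_in ZWr_infty (subgroup_gen (fun g => In g gens)) \/
  embeds_in WrZ_infty (subgroup_gen (fun g => In g gens)).
Proof.
  intros Hgens Htow.
  assert (HH : group (fgen gens)) by (apply group_fgen; intros g Hg; now apply PLo_PL, Hgens).
  destruct (classic (exists l a b, (forall g, In g l -> fgen gens g) /\
    orbital_of (fgen l) a b /\ nofix (der (fgen l)) a b)) as [(l & a & b & Hl & HO & HN) | Hno].
  - left. now apply (typeI_embeds (fgen gens) l a b).
  - right. apply (no_typeI_embeds (fgen gens) gens); trivial.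
    + intros g Hg. now apply sg_gen.
    + intros l' a b Hl' HO HN. apply Hno. now exists l', a, b.
    + now apply towers_tall.
Qed.
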